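(* Let $A$ be a relative non-zero sum Heffter array $\mathrm{N}\mathrm{H}_t(m,n;h,k)$ that is simple with respect to two compatible orderings $\omega_r$ and $\omega_c$. Then there exists a cellular biembedding of the two circuit decompositions $\mathcal{C}(\mathcal{D}_{\omega_r^{-1}})$ and $\mathcal{C}(\mathcal{D}_{\omega_c})$ of $K_{\frac{2nk+t}{t}\times t}$ into an orientable surface.
   Context: Arrays. Let $m,n,h,k,t\geq 1$ be integers with $nk=mh$ and $t$ dividing $2nk$, let $v=2nk+t$, and let $J$ be the subgroup of $\mathbb{Z}_v$ of order $t$. An $\mathrm{N}\mathrm{H}_t(m,n;h,k)$ is an $m\times n$ partially filled array $A$ (some cells may be empty) with entries in $\mathbb{Z}_v$ such that: each row contains $h$ filled cells and each column contains $k$ filled cells; the multiset $\{\pm x\mid x\in A\}$ contains each element of $\mathbb{Z}_v\setminus J$ exactly once (and no other element); the sum of the elements in every row and in every column is different from $0$ in $\mathbb{Z}_v$. In particular the entries of $A$ are pairwise distinct. $\mathcal{E}(A)$ denotes the list of entries of $A$. Orderings. An ordering $(t_1,\dots,t_\ell)$ of group elements is simple if its partial sums $s_i=\sum_{j=1}^i t_j$, $1\le i\le \ell$, are all non-zero and pairwise distinct. Let $\omega_{R_i}$ ($1\le i\le m$) and $\omega_{C_j}$ ($1\le j\le n$) be orderings of the entries of the $i$-th row and of the $j$-th column of $A$. $A$ is simple with respect to these orderings if all of them are simple. Each ordering is also regarded as the cyclic permutation of the entries of the row (column) sending each entry to the next one (and the last to the first). Set $\omega_r=\omega_{R_1}\circ\cdots\circ\omega_{R_m}$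 and $\omega_c=\omega_{C_1}\circ\cdots\circ\omega_{C_n}$, permutations of $\mathcal{E}(A)$. The orderings $\omega_r$ and $\omega_c$ are compatible if $\omega_c\circ\omega_r$ is a cycle of length $|\mathcal{E}(A)|$. If $\omega_{R_i}=(a_{1},\dots,a_{h})$, then $\omega_{R_i}^{-1}=(a_{h},\dots,a_{1})$, which is simple as well. Path decompositions. $K_{q\times r}$ is the complete multipartite graph with $q$ parts of size $r$; $K_{\frac{2nk+t}{t}\times t}$ is identified with the Cayley graph on $\mathbb{Z}_v$ with connection set $\mathbb{Z}_v\setminus J$. To a simple ordering with partial sums $s_1,\dots,s_\ell$ associate the path $(0,s_1,\dots,s_\ell)$. $\mathcal{D}_{\omega_r^{-1}}$ is the set of all translates by elements of $\mathbb{Z}_v$ of the paths associated with $\omega_{R_1}^{-1},\dots,\omega_{R_m}^{-1}$; $\mathcal{D}_{\omega_c}$ is the set of all translates of the paths associated with $\omega_{C_1},\dots,\omega_{C_n}$. These are (cyclic) decompositions of $K_{\frac{2nk+t}{t}\times t}$ into paths of length $h$ and $k$ (number of edges), respectively. Circuit decompositions. Given such a path decomposition $\mathcal{D}$ and $P=(x_0,x_1,\dots,x_\ell)\in\mathcal{D}$, let $\lambda_P$ be the minimum positive integer with $\lambda_P(x_\ell-x_0)=0$ in $\mathbb{Z}_v$ and let $C_P$ be the circuit (closed trail) $C_P=\bigcup_{i=0}^{\lambda_P-1}\bigl(P+i(x_\ell-x_0)\bigr)$. Then $\mathcal{C}(\mathcal{D})=\{C_P: P\in\mathcal{D}\}$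 is a decomposition of the graph into circuits. Embeddings. An embedding of a graph $\Gamma$ (as a $1$-dimensional simplicial complex) in a surface $\Sigma$ is a continuous injective map $\phi:\Gamma\to\Sigma$; the connected components of $\Sigma\setminus\phi(\Gamma)$ are its faces; it is cellular if every face is homeomorphic to an open disc. A biembedding of two circuit decompositions $\mathcal{D},\mathcal{D}'$ of a simple graph $\Gamma$ is a face $2$-colorable embedding of $\Gamma$ in which (the boundaries of the faces of) one color class are the circuits of $\mathcal{D}$ and those of the other color class are the circuits of $\mathcal{D}'$. *)

(* Defs.v *)
From HB Require Import structures.
From mathcomp Require Import all_boot all_order all_algebra all_fingroup.
From mathcomp Require Import all_classical all_reals all_analysis.

Set Implicit Arguments.
Unset Strict Implicit.
Unset Printing Implicit Defensive.

Import Order.TTheory GRing.Theory Num.Theory.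
Import numFieldNormedType.Exports.

Local Open Scope classical_set_scope.
Local Open Scope ring_scope.

(** * Relative non-zero sum Heffter arrays *)

(* [None] is an empty cell.  An entry [a] contributes both [a] and [- a] to the
   multiset {±x | x in A}, so the multiplicity of [x] in that multiset is the
   number of cells equal to [x] plus the number of cells equal to [- x]. *)
Definition NH (m n h k t : nat) (J : {group 'Z_(2 * n * k + t)})
    (A : 'M[option 'Z_(2 * n * k + t)]_(m, n)) : Prop :=
  [/\ forall i, #|[pred j | A i j != None]| = h,
      forall j, #|[pred i | A i j != None]| = k,
      forall x : 'Z_(2 * n * k + t),
        (#|[pred c : 'I_m * 'I_n | A c.1 c.2 == Some x]| +
         #|[pred c : 'I_m * 'I_n | A c.1 c.2 == Some (- x)%R]|)%N
        = (x \notin J) :> nat,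
      forall i, \sum_j odflt 0 (A i j) != 0 &
      forall j, \sum_i odflt 0 (A i j) != 0].

Definition row_entries (T : Type) (m n : nat) (A : 'M[option T]_(m, n))
  (i : 'I_m) : seq T := pmap (fun j => A i j) (enum 'I_n).

Definition col_entries (T : Type) (m n : nat) (A : 'M[option T]_(m, n))
  (j : 'I_n) : seq T := pmap (fun i => A i j) (enum 'I_m).

Definition entries (T : Type) (m n : nat) (A : 'M[option T]_(m, n)) : seq T :=
  flatten [seq row_entries A i | i <- enum 'I_m].

(** * Orderings *)

Definition partial_sums (V : nmodType) (s : seq V) : seq V := scanl +%R 0 s.

Definition simple_ordering (V : nmodType) (s : seq V) : bool :=
  (0 \notin partial_sums s) && uniq (partial_sums s).

(* [next s] is the cyclic permutation sending each item of [s] to the following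
   one and fixing everything else. *)
Definition ordering_perm (T : eqType) (l : nat) (w : 'I_l -> seq T) : T -> T :=
  foldr (fun i f => next (w i) \o f) id (enum 'I_l).

Definition compatible (T : eqType) (m n : nat) (A : 'M[option T]_(m, n))
    (wR : 'I_m -> seq T) (wC : 'I_n -> seq T) : Prop :=
  exists s, perm_eq s (entries A) /\
            fcycle (ordering_perm wC \o ordering_perm wR) s.

(** * Path and circuit decompositions *)

(* The Cayley graph on Z_v with connection set Z_v \ J; its parts, as a complete
   multipartite graph, are the cosets of J. *)
Definition cayley_adj (v : nat) (J : {group 'Z_v}) : rel 'Z_v :=
  fun x y => (y - x)%R \notin J.

(* Paths are given by their sequences of vertices. *)
Definition path_decomposition (V : nmodType) (l : nat) (w : 'I_l -> seq V) :
    set (seq V) :=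
  [set P | exists (i : 'I_l) (x : V),
             P = [seq y + x | y <- 0 :: partial_sums (w i)]].

(* A circuit is given by the cyclic sequence of its successive vertices, the
   first vertex not being repeated at the end.  [#[d]%g] is the order of [d] in
   the additive group Z_v. *)
Definition path_circuit (v : nat) (P : seq 'Z_v) : seq 'Z_v :=
  let d := last 0 P - head 0 P in
  flatten [seq [seq y + d *+ i | y <- take (size P).-1 P]
          | i <- iota 0 #[d]%g].

Definition circuits_of (v : nat) (D : set (seq 'Z_v)) : set (seq 'Z_v) :=
  [set path_circuit P | P in D].

Definition circuit_edges (V : finType) (C : seq V) : seq {set V} :=
  [seq ([set e.1; e.2])%SET | e <- zip C (rot 1 C)].

Definition closed_trail (V : finType) (adj : rel V) (C : seq V) : bool :=
  [&& C != [::], path.cycle adj C & uniq (circuit_edges C)].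

Definition same_circuit (V : Type) (C C' : seq V) : Prop :=
  exists i, C' = rot i C \/ C' = rot i (rev C).

Definition circuit_decomposition (V : finType) (adj : rel V)
    (D : set (seq V)) : Prop :=
  [/\ forall C, D C -> closed_trail adj C,
      forall x y, adj x y ->
        exists2 C, D C & ([set x; y])%SET \in circuit_edges C &
      forall C C' e, D C -> D C' ->
        e \in circuit_edges C -> e \in circuit_edges C' -> same_circuit C C'].

(** * Surfaces *)

Section Surfaces.
Variable R : realType.

Definition polar (p : R * R) (r a : R) : R * R :=
  (p.1 + r * cos a, p.2 + r * sin a).

Definition open_disc : set (R * R) := [set p | p.1 ^+ 2 + p.2 ^+ 2 < 1].
Definition closed_disc : set (R * R) := [set p | p.1 ^+ 2 + p.2 ^+ 2 <= 1].

Definition homeomorphism (X Y : topologicalType) (A : set X) (B : set Y)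
    (f : X -> Y) (g : Y -> X) : Prop :=
  [/\ {within A, continuous f}, {within B, continuous g},
      (forall x, A x -> B (f x) /\ g (f x) = x) &
      (forall y, B y -> A (g y) /\ f (g y) = y)].

Definition homeomorphic (X Y : topologicalType) (A : set X) (B : set Y) : Prop :=
  exists f g, homeomorphism A B f g.

Record chart (S : topologicalType) := Chart {
  chart_dom : set S;
  chart_map : S -> R * R;
  chart_inv : R * R -> S }.

Definition is_chart (S : topologicalType) (c : chart S) : Prop :=
  [/\ open (chart_dom c), open (chart_map c @` chart_dom c) &
      homeomorphism (chart_dom c) (chart_map c @` chart_dom c)
                    (chart_map c) (chart_inv c)].

(* Closed surfaces; second countability follows from compactness and the
   existence of charts. *)
Definition surface (S : topologicalType) : Prop :=
  [/\ hausdorff_space S, compact [set: S], connected [set: S] &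
      forall x : S, exists2 c : chart S, is_chart c & chart_dom c x].

(* A homeomorphism [f] between open sets of the plane preserves the orientation
   at [p] when it has local degree 1 there: the image under [f] of each small
   circle around [p] winds exactly once, counterclockwise, around [f p].  Here
   [theta] is a continuous determination of the argument along the image. *)
Definition orientation_preserving_at (f : R * R -> R * R) (p : R * R) : Prop :=
  \forall r \near 0^'+, exists theta : R -> R,
    [/\ {within `[0, 1], continuous theta},
        theta 1 = theta 0 + 2 * pi &
        forall s : R, 0 <= s <= 1 ->
          exists2 rho : R, 0 < rho &
            f (polar p r (2 * pi * s)) = polar (f p) rho (theta s)].

Definition orientable (S : topologicalType) : Prop :=
  exists atlas : set (chart S),
    [/\ forall c, atlas c -> is_chart c,
        forall x : S, exists2 c, atlas c & chart_dom c x &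
        forall c d, atlas c -> atlas d ->
          forall x, chart_dom c x -> chart_dom d x ->
            orientation_preserving_at (chart_map d \o chart_inv c)
                                      (chart_map c x)].

(** * Graph embeddings *)

(* The 1-dimensional simplicial complex of a graph on 'I_N, in R^N. *)
Definition edge_point (N : nat) (x y : 'I_N) (s : R) : 'rV[R]_N :=
  (1 - s) *: delta_mx 0 x + s *: delta_mx 0 y.

Definition edge_segment (N : nat) (x y : 'I_N) : set 'rV[R]_N :=
  [set edge_point x y s | s in [set s : R | 0 <= s <= 1]].

Definition realization (N : nat) (adj : rel 'I_N) : set 'rV[R]_N :=
  [set w | (exists x, w = delta_mx 0 x) \/
           (exists x y, adj x y /\ edge_segment x y w)].

Section Embeddings.
Variables (N : nat) (adj : rel 'I_N) (S : topologicalType).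
Variable phi : 'rV[R]_N -> S.

Definition graph_embedding : Prop :=
  {within realization adj, continuous phi} /\ set_inj (realization adj) phi.

Definition complement : set S := ~` (phi @` realization adj).

Definition face (F : set S) : Prop :=
  exists2 x, complement x & F = connected_component complement x.

Definition cellular : Prop := forall F, face F -> homeomorphic open_disc F.

Definition incident (F : set S) (x y : 'I_N) : Prop :=
  phi @` edge_segment x y `<=` closure F.

(* Every edge separates two faces of different colours; in particular no face
   lies on both sides of an edge. *)
Definition face_2_colouring (col : set S -> bool) : Prop :=
  forall x y, adj x y ->
    exists F G, [/\ face F, face G, col F != col G &
      forall H, face H -> (incident H x y <-> H = F \/ H = G)].

(* The face [F] is the homeomorphic image of the open disc under a continuous
   map of the closed disc which sends the bounding circle, divided into
   [size C] equal arcs, successively along the edges of the circuit [C].  The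
   boundary of a face may visit a vertex several times, so this map need not be
   injective on the circle. *)
Definition face_boundary (F : set S) (C : seq 'I_N) : Prop :=
  exists Phi : R * R -> S,
    [/\ {within closed_disc, continuous Phi},
        exists Psi, homeomorphism open_disc F Phi Psi &
        forall (x0 : 'I_N) (j : nat) (s : R), (j < size C)%N -> 0 <= s <= 1 ->
          Phi (polar (0, 0) 1 (2 * pi * (j%:R + s) / (size C)%:R))
          = phi (edge_point (nth x0 C j) (nth x0 (rot 1 C) j) s)].

(* The faces of colour [b] are, bijectively, the circuits of [D]. *)
Definition colour_class (col : set S -> bool) (b : bool)
    (D : set (seq 'I_N)) : Prop :=
  (forall F, face F -> col F = b -> exists2 C, D C & face_boundary F C) /\
  (forall C, D C -> exists! F, [/\ face F, col F = b & face_boundary F C]).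

Definition biembedding (D D' : set (seq 'I_N)) : Prop :=
  [/\ circuit_decomposition adj D, circuit_decomposition adj D',
      graph_embedding &
      exists col, [/\ face_2_colouring col,
        colour_class col true D & colour_class col false D']].

End Embeddings.
End Surfaces.

(* Main.v *)
Require Import Defs.
From HB Require Import structures.
From mathcomp Require Import all_boot all_order all_algebra all_fingroup.
From mathcomp Require Import all_classical all_reals all_analysis.
From mathcomp Require Import ring lra zify.
From mathcomp Require cyclic.
Import numFieldNormedType.Exports.

Set Implicit Arguments.
Unset Strict Implicit.
Unset Printing Implicit Defensive.

Import Order.TTheory GRing.Theory Num.Theory.

Local Open Scope classical_set_scope.
Local Open Scope ring_scope.

(* Idea.  At every vertex the rotation a |-> - wr(a), - a |-> wc(a) on the steps
   leaving it is a single cycle, because its square is wc o wr on the entries, so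
   it defines a closed surface: glue one cone, over the boundary circuit, for each
   orbit of the induced face permutation.  The faces are the circuits of the
   columns and the reversed circuits of the rows, and every edge separates a column
   face from a row face.  The cones cut the surface into triangles.  The
   quotient is realised inside a finite-dimensional space, through barycentric
   coordinates attached to vertices, sides and triangles, so that it is Hausdorff
   and compact, contains the graph, and is covered by the open stars of its
   vertices.  A star is mapped to the plane by a piecewise linear fan of sectors;
   around a point common to two stars, both charts send the lines parallel to the
   side joining the two vertices to parallel lines, and this forces the change of
   charts to have local degree 1. *)

(** * Maps defined by gluing *)

(** The cones do not form a simplicial complex: a circuit may pass several times through a vertex,
    so that a face centre is joined to this vertex by several sides. Weights at the vertices
    therefore do not separate points. Products of weights, two at a time for a side and three at a
    time for a triangle, do, and they stay polynomial, hence continuous.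

    Stars are modelled on the plane in two ways, behind the common interface [planar_star]. The
    linear sectors of [fan] serve the charts, because there parallels to a side are straight. The
    circular sectors of [round] serve the faces, because [face_boundary] prescribes the unit circle
    run through in equal arcs at constant speed.

    The inverse row orderings come from orientation. A dart whose step is an entry has a column face
    on its left. The same edge seen from its other side has the opposite step, and the face there
    continues with the steps - a, - wr(a), - wr(wr(a)), and so on. Read backwards, this boundary has
    the entries of the row as steps, in the inverse order. *)

Lemma compact_preimage_closed (X Z : topologicalType) (K : set X) (g : X -> Z)
    (W : set Z) :
  compact K -> {within K, continuous g} -> closed W -> compact (K `&` g @^-1` W).
Proof.
move=> cK /continuous_closedP cg /cg /closed_subspaceP[V cV VK].
by rewrite setIC -VK setIC; apply: compact_closedI.
Qed.

(* Each [q i] is a quotient map onto its image, by compactness. *)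
Lemma glue_continuous (X Y Z : topologicalType) (I : finType) (K : I -> set X)
    (q : I -> X -> Y) (h : Y -> Z) :
  hausdorff_space Y -> (forall i, compact (K i)) ->
  (forall i, {within K i, continuous q i}) ->
  (forall i, {within K i, continuous (h \o q i)}) ->
  {within \bigcup_i (q i @` K i), continuous h}.
Proof.
move=> hY cK cq chq; apply/continuous_closedP => W cW.
apply/closed_subspaceP.
exists (\bigcup_i (q i @` (K i `&` (h \o q i) @^-1` W))).
  apply: closed_bigcup => [|i _]; first exact: finite_finset.
  apply: compact_closed => //; apply: continuous_compact.
    by apply: continuous_subspaceW (cq i) => x [].
  exact: compact_preimage_closed.
rewrite eqEsubset; split => y.
  by move=> [[i _ [x [Kx Wx] <-]] By].
move=> [Wy [i _ [x Kx qx]]]; split; last by exists i => //; exists x.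
by exists i => //; exists x => //; split => //=; rewrite /preimage /= qx.
Qed.

Lemma ptws_continuous (X T : topologicalType) (I : eqType) (f : X -> {ptws I -> T}) :
  (forall i, continuous (fun x => f x i)) -> continuous f.
Proof.
move=> cf x; apply/cvg_sup => i.
apply: (@continuous_comp_initial _ _ _ (fun g : I -> T => g i)
  (fun x => f x : initial_topology (fun g : I -> T => g i))).
exact: cf.
Qed.

(** [U] is relatively clopen in [B], so a connected part of [B] that meets [U] stays in [U]. The
    lemma serves to recognise the open stars of the face centres as the components of the complement
    of the graph. *)
Lemma connected_component_clopen (X : topologicalType) (B U : set X) (x : X) :
  connected U -> U x -> U `<=` B -> open U -> open (B `\` U) ->
  connected_component B x = U.
Proof.
move=> cU Ux UB oU oBU; rewrite eqEsubset; split; last first.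
  exact: connected_component_max.
have cC := @component_connected _ B x.
suff <- : connected_component B x `&` U = connected_component B x by move=> y [].
apply: cC.
- by exists x; split => //; apply: connected_component_refl; exact: UB.
- by exists U.
- exists (~` (B `\` U)); first exact: open_closedC.
  rewrite eqEsubset; split => y [Cy] Uy; split => //; first by move=> [].
  by apply: contrapT => nUy; apply: Uy; split => //;
    exact: connected_component_sub Cy.
Qed.

(** An open star is not a finite union of compact pieces, so [glue_continuous] reaches it only after
    shrinking around a point; this lemma makes the shrinking harmless. *)
Lemma within_continuous_local (X Y : topologicalType) (B : set X) (h : X -> Y) :
  (forall x, B x -> exists U, [/\ open U, U x & {within U `&` B, continuous h}]) ->
  {within B, continuous h}.
Proof.
move=> H; apply/subspace_continuousP => x Bx W hW.
have [U [oU Ux /subspace_continuousP]] := H _ Bx.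
move=> /(_ x (conj Ux Bx) W hW); rewrite /nbhs /= /within /=.
have nU : nbhs x U by exact: open_nbhs_nbhs.
by apply: filterS2 nU => y Uy + By; apply; split.
Qed.

(** * Polar coordinates and fans of sectors *)

Section Plane.
Variable R : realType.
Implicit Types (r s a b x y : R) (n i j : nat).

Lemma cos_eq1 x : - (2 * pi) < x < 2 * pi -> cos x = 1 -> x = 0.
Proof.
wlog x0 : x / 0 <= x.
  move=> H xb cx; have [/H|x0] := leP 0 x; first exact.
  by apply/eqP; rewrite -oppr_eq0; apply/eqP/H; rewrite ?cosN //; lra.
move=> /andP[_ xb] cx; have pp := @pi_gt0 R.
have [xpi|xpi] := leP x pi.
  by apply: cos_inj; rewrite ?cos0 // in_itv /=; lra.
have : 2 * pi - x = 0; last by lra.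
apply: cos_inj; rewrite ?in_itv /=; try lra.
by rewrite cos0 cosB mulr_natl cos2pi sin2pi cx mul1r mul0r addr0.
Qed.

(** The interval is closed at both ends because closed arcs are compared later; the last arc ends at
    the angle 2 pi, where the first one starts. *)
Lemma angle_inj x y : 0 <= x <= 2 * pi -> 0 <= y <= 2 * pi ->
  cos x = cos y -> sin x = sin y ->
  [\/ x = y, x = 0 /\ y = 2 * pi | x = 2 * pi /\ y = 0].
Proof.
move=> /andP[x0 x2] /andP[y0 y2] cxy sxy.
have cB : cos (x - y) = 1.
  by rewrite cosB cxy sxy -!expr2 cos2Dsin2.
have [xy|xy] := eqVneq (x - y) (2 * pi); first by constructor 3; lra.
have [xy'|xy'] := eqVneq (x - y) (- (2 * pi)); first by constructor 2; lra.
constructor 1; apply/eqP; rewrite -subr_eq0; apply/eqP.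
by apply: cos_eq1 cB; rewrite !lt_neqAle xy eq_sym xy' /=; lra.
Qed.

Lemma polar_surj (p : R * R) : exists r a : R,
  [/\ 0 <= r, 0 <= a < 2 * pi & p = polar (0, 0) r a].
Proof.
case: p => x y; rewrite /polar /=; have pp := @pi_gt0 R.
set r := Num.sqrt (x ^+ 2 + y ^+ 2).
have r2 : r ^+ 2 = x ^+ 2 + y ^+ 2.
  by rewrite sqr_sqrtr // addr_ge0 // sqr_ge0.
have r0 : 0 <= r by exact: sqrtr_ge0.
have [re0|rn0] := eqVneq r 0.
  have [-> ->] : x = 0 /\ y = 0 by move: r2; rewrite re0; nra.
  exists 0, 0; split; first by [].
    by rewrite lexx /=; lra.
  by rewrite !mul0r !addr0.
have rp : 0 < r by rewrite lt_neqAle eq_sym rn0.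
have xr : -1 <= x / r <= 1.
  by rewrite ler_pdivlMr // ler_pdivrMr //; apply/andP; nra.
have cA : cos (acos (x / r)) = x / r by rewrite acosK // in_itv.
have sA : r * sin (acos (x / r)) = `|y|.
  rewrite sin_acos // -[r in r * _]gtr0_norm // -sqrtr_sqr -sqrtrM ?sqr_ge0 //.
  rewrite -sqrtr_sqr; congr Num.sqrt.
  by rewrite mulrBr mulr1 expr_div_n mulrCA divff ?expf_neq0 // mulr1 r2; ring.
have a0 := acos_ge0 xr; have a1 := acos_lepi xr.
have [y0|y0] := leP 0 y.
  exists r, (acos (x / r)); split => //; first by rewrite a0 /=; lra.
  by rewrite cA sA ger0_norm // !add0r mulrC divfK.
exists r, (2 * pi - acos (x / r)); split => //.
  rewrite subr_ge0 ltrBlDr ltrDl; apply/andP; split; first by lra.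
  rewrite lt_neqAle a0 andbT; apply/eqP => aE.
  by move: sA; rewrite -aE sin0 mulr0 ltr0_norm //; lra.
rewrite cosB sinB mulr_natl cos2pi sin2pi !mul1r !mul0r addr0 sub0r cA.
by rewrite mulrN sA ltr0_norm // opprK !add0r mulrC divfK.
Qed.

Lemma polar0_inj r r' a b : 0 <= r -> 0 <= r' ->
  polar (0, 0) r a = polar (0, 0) r' b ->
  r = r' /\ (r = 0 \/ cos a = cos b /\ sin a = sin b).
Proof.
move=> r0 r'0 [] /=; rewrite !add0r => cE sE.
have rr : r = r'.
  apply/eqP; rewrite -(@eqrXn2 _ 2) //; apply/eqP.
  rewrite -[LHS]mulr1 -[RHS]mulr1 -{1}(cos2Dsin2 a) -(cos2Dsin2 b) !mulrDr.
  by rewrite -!exprMn cE sE.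
split=> //; have [->|rn] := eqVneq r 0; [by left|right].
by split; apply: (mulfI rn); rewrite ?cE ?sE rr.
Qed.

(** The angle is literally the expression used in [face_boundary], so that the two can be folded
    into each other. *)
Definition arc n i r s : R * R :=
  polar (0, 0) r (2 * pi * (i%:R + s) / n%:R).

Lemma natr_add_inj i j s s' : 0 <= s <= 1 -> 0 <= s' <= 1 ->
  i%:R + s = j%:R + s' ->
  [\/ i = j /\ s = s', [/\ j = i.+1, s = 1 & s' = 0] |
      [/\ i = j.+1, s = 0 & s' = 1]].
Proof.
move=> /andP[s0 s1] /andP[t0 t1] E.
have [ij|ij|ij] := ltngtP i j.
- have := ij; rewrite -(ler_nat R) mulrSr => ij'.
  constructor 2; split; [|lra|lra].
  by apply/eqP; rewrite -(eqr_nat R) mulrSr; apply/eqP; lra.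
- have := ij; rewrite -(ler_nat R) mulrSr => ij'.
  constructor 3; split; [|lra|lra].
  by apply/eqP; rewrite -(eqr_nat R) mulrSr; apply/eqP; lra.
- by constructor 1; split=> //; move: E; rewrite ij; lra.
Qed.

Lemma arc_cover n (p : R * R) : (0 < n)%N ->
  exists (i : 'I_n) (r s : R), [/\ 0 <= r, 0 <= s <= 1 & p = arc n i r s].
Proof.
move=> n0; have pp := @pi_gt0 R; have [r [a [r0 /andP[a0 a1] ->]]] := polar_surj p.
have n0' : 0 < n%:R :> R by rewrite ltr0n.
set t := a * n%:R / (2 * pi).
have t0 : 0 <= t by rewrite divr_ge0 ?mulr_ge0 //; lra.
have tn : t < n%:R.
  by rewrite /t ltr_pdivrMr; [rewrite mulrC ltr_pM2l|lra].
have /andP[ti ti1] := truncn_itv t0.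
have iln : (Num.truncn t < n)%N by rewrite -(ltr_nat R); exact: le_lt_trans tn.
exists (Ordinal iln), r, (t - (Num.truncn t)%:R); split => //=.
  by move: ti1; rewrite mulrSr; lra.
congr polar; rewrite subrKC /t.
have pn0 : 2 * pi != 0 :> R by rewrite gt_eqF //; lra.
by move: (2 * pi) pn0 => P P0; field; rewrite P0 gt_eqF.
Qed.

Lemma arc_inj n i j r s r' s' : (i < n)%N -> (j < n)%N ->
  0 <= r -> 0 <= r' -> 0 <= s <= 1 -> 0 <= s' <= 1 ->
  arc n i r s = arc n j r' s' ->
  r = r' /\ [\/ r = 0, i = j /\ s = s',
     [/\ j = (i.+1 %% n)%N, s = 1 & s' = 0] |
     [/\ i = (j.+1 %% n)%N, s = 0 & s' = 1]].
Proof.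
move=> iln jln r0 r'0 sb tb /polar0_inj [//|//|rr H]; split=> //.
case: H => [|[cE sE]]; first by constructor 1.
have n0 : (0 < n)%N by apply: leq_ltn_trans iln.
have n0' : 0 < n%:R :> R by rewrite ltr0n.
have pp := @pi_gt0 R.
have B k (u : R) : (k < n)%N -> 0 <= u <= 1 ->
    0 <= 2 * pi * (k%:R + u) / n%:R <= 2 * pi.
  move=> kn /andP[u0 u1]; have k0 : 0 <= k%:R :> R by rewrite ler0n.
  have kn' : k%:R + 1 <= n%:R :> R by rewrite -mulrSr ler_nat.
  rewrite divr_ge0 //=; last by rewrite mulr_ge0 //; lra.
  by rewrite ler_pdivrMr // ler_pM2l; lra.
have D (x y : R) : 2 * pi * x / n%:R = 2 * pi * y -> x = y * n%:R.
  move=> E; apply: (@mulfI _ (2 * pi)); first by rewrite gt_eqF; lra.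
  by rewrite mulrA -E divfK // gt_eqF.
case: (angle_inj (B _ _ iln sb) (B _ _ jln tb) cE sE) => [E|[E1 E2]|[E1 E2]].
- have {}E : i%:R + s = j%:R + s'.
    apply: (@mulfI _ (2 * pi)); first by rewrite gt_eqF; lra.
    by apply: (@mulIf _ n%:R^-1) => //; rewrite invr_eq0 gt_eqF.
  case: (natr_add_inj sb tb E) => [|[jE s1 t0]|[iE s0 t1]].
  + by constructor 2.
  + by constructor 3; rewrite -jE modn_small.
  + by constructor 4; rewrite -iE modn_small.
(* The angles are 0 and 2 pi: the start of the first arc is the end of the last one, which gives the
   wrap-around modulo [n]. *)
- have {}E1 : i%:R + s = 0 by rewrite -(mul0r n%:R); apply: D; rewrite mulr0.
  have {}E2 : j%:R + s' = n%:R by rewrite -[RHS]mul1r; apply: D; rewrite mulr1.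
  have i0 : 0 <= i%:R :> R by rewrite ler0n.
  have jn : j.+1%:R <= n%:R :> R by rewrite ler_nat.
  rewrite mulrSr in jn.
  have jE : j.+1 = n by apply/eqP; rewrite -(eqr_nat R) mulrSr; apply/eqP; lra.
  have iE : i = 0%N by apply/eqP; rewrite -(eqr_nat R); apply/eqP; lra.
  by constructor 4; rewrite jE iE modnn; split => //; lra.
- have {}E2 : j%:R + s' = 0 by rewrite -(mul0r n%:R); apply: D; rewrite mulr0.
  have {}E1 : i%:R + s = n%:R by rewrite -[RHS]mul1r; apply: D; rewrite mulr1.
  have i0 : 0 <= j%:R :> R by rewrite ler0n.
  have jn : i.+1%:R <= n%:R :> R by rewrite ler_nat.
  rewrite mulrSr in jn.
  have jE : i.+1 = n by apply/eqP; rewrite -(eqr_nat R) mulrSr; apply/eqP; lra.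
  have iE : j = 0%N by apply/eqP; rewrite -(eqr_nat R); apply/eqP; lra.
  by constructor 3; rewrite jE iE modnn; split => //; lra.
Qed.
End Plane.

(* Otherwise unification unfolds [pi], which is a double, to a sum. *)
Local Opaque pi.

Section Fan.
Variable R : realType.
Implicit Types (r s a b x y : R) (n i j : nat).

Definition angle n i : R := 2 * pi * i%:R / n%:R.
Definition step n : R := 2 * pi / n%:R.

(** The cone over two consecutive [n]-th roots of unity, linear in the coordinates [a] and [b]. *)
Definition fan n i a b : R * R :=
  (a * cos (angle n i) + b * cos (angle n i.+1),
   a * sin (angle n i) + b * sin (angle n i.+1)).

Lemma angleS n i : angle n i.+1 = angle n i + step n.
Proof. by rewrite /angle /step [i.+1%:R]mulrSr mulrDr mulr1 mulrDl. Qed.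

Lemma angle_mod n i : (0 < n)%N ->
  angle n i = angle n (i %% n) + (pi *+ 2) *+ (i %/ n).
Proof.
move=> n0; rewrite -[_ *+ (i %/ n)]mulr_natr -[pi *+ 2]mulr_natl /angle.
have -> : i%:R = (i %/ n)%:R * n%:R + (i %% n)%:R :> R.
  by rewrite -natrM -natrD -divn_eq.
have nn0 : n%:R != 0 :> R by rewrite pnatr_eq0 -lt0n.
by move: (2 * pi) => P; field.
Qed.

Lemma cos_angle_mod n i : (0 < n)%N -> cos (angle n (i %% n)) = cos (angle n i).
Proof.
by move=> n0; rewrite [in RHS]angle_mod // periodicn //; exact: cosD2pi.
Qed.

Lemma sin_angle_mod n i : (0 < n)%N -> sin (angle n (i %% n)) = sin (angle n i).
Proof.
by move=> n0; rewrite [in RHS]angle_mod // periodicn //; exact: sinD2pi.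
Qed.

Lemma fan_glue n i b : (0 < n)%N -> fan n i 0 b = fan n (i.+1 %% n) b 0.
Proof.
by move=> n0; rewrite /fan !mul0r !add0r !addr0 cos_angle_mod // sin_angle_mod.
Qed.

(** With at least three sectors each angle is less than pi, so the two vectors that bound a sector
    are independent and positively oriented. *)
Lemma step_bound n : (3 <= n)%N -> 0 < step n < pi.
Proof.
move=> n3; have pp := @pi_gt0 R.
have n3' : 3%:R <= n%:R :> R by rewrite ler_nat.
have n0 : 0 < n%:R :> R by lra.
apply/andP; split; first by rewrite divr_gt0 //; lra.
rewrite ltr_pdivrMr // [X in _ < X]mulrC ltr_pM2r //; lra.
Qed.

Lemma sin_step_gt0 n : (3 <= n)%N -> 0 < sin (step n).
Proof. by move=> /step_bound; exact: sin_gt0_pi. Qed.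

Lemma arcE n i r s : arc n i r s =
  (r * cos (angle n i + step n * s), r * sin (angle n i + step n * s)).
Proof.
rewrite /arc /polar /= !add0r /angle /step.
by rewrite mulrDr mulrDl -[X in _ + X]mulrA [s / _]mulrC [2 * pi / _ * s]mulrAC
  -[_ * s * _]mulrA [s / _]mulrC.
Qed.

(** The law of sines: a vector inside the sector has, along each bounding unit vector, a component
    proportional to the sine of its angle with the other one. Through it, facts on [fan] reduce to
    facts on [arc]. *)
Lemma arc_fan n i r s a b : (3 <= n)%N ->
  a * sin (step n) = r * sin (step n * (1 - s)) ->
  b * sin (step n) = r * sin (step n * s) ->
  arc n i r s = fan n i a b.
Proof.
move=> n3 aE bE; have s0 := sin_step_gt0 n3.
have sn0 : sin (step n) != 0 by rewrite gt_eqF.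
rewrite arcE /fan angleS; move: aE bE.
rewrite mulrBr mulr1 sinB; move: (step n * s) => u aE bE.
congr pair; apply: (mulIf sn0); rewrite [RHS]mulrDl.
  rewrite [a * _ * _]mulrAC aE.
  by rewrite [b * _ * _]mulrAC bE !cosD; ring.
by rewrite [a * _ * _]mulrAC aE [b * _ * _]mulrAC bE !sinD; ring.
Qed.

Lemma fan_arc n i a b : (3 <= n)%N -> 0 <= a -> 0 <= b ->
  exists r s, [/\ 0 <= r, 0 <= s <= 1, fan n i a b = arc n i r s,
    a * sin (step n) = r * sin (step n * (1 - s)) &
    b * sin (step n) = r * sin (step n * s)].
Proof.
move=> n3 a0 b0; have s0 := sin_step_gt0 n3; have /andP[st0 stp] := step_bound n3.
(* The point is written in the frame whose first axis is the [i]-th ray. Its argument [u] must be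
   shown to lie between 0 and [step n]: the signs of [sin u] and of [sin (step n - u)], read off
   from [b] and [a], exclude everything else. *)
have [r [u [r0 /andP[u0 u1] [E1 E2]]]] :=
  polar_surj (a + b * cos (step n), b * sin (step n)).
rewrite /= !add0r in E1 E2.
suff [s [sb aE bE]] : exists s, [/\ 0 <= s <= 1,
    a * sin (step n) = r * sin (step n * (1 - s)) &
    b * sin (step n) = r * sin (step n * s)].
  by exists r, s; split => //; rewrite (arc_fan i n3 aE bE).
have aE : a * sin (step n) = r * sin (step n - u).
  by rewrite sinB mulrBr mulrCA -E1 [cos _ * _]mulrC mulrA -E2; ring.
have [re0|rn0] := eqVneq r 0.
  by exists 0; rewrite E2 aE re0 !mul0r lexx ler01.
have rp : 0 < r by rewrite lt_neqAle eq_sym rn0.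
have su : 0 <= sin u by rewrite -(pmulr_rge0 _ rp) -E2 mulr_ge0 // ltW.
have sd : 0 <= sin (step n - u) by rewrite -(pmulr_rge0 _ rp) -aE mulr_ge0 // ltW.
have upi : u <= pi.
  rewrite leNgt; apply/negP => pu.
  suff : 0 < sin (u - pi) by rewrite sinB cospi sinpi; lra.
  by apply: sin_gt0_pi; lra.
have us : u <= step n.
  rewrite leNgt; apply/negP => pu.
  suff : 0 < sin (u - step n) by rewrite -opprB sinN; lra.
  apply: sin_gt0_pi; apply/andP; split; first by lra.
  by lra.
have uE : step n * (u / step n) = u by rewrite mulrC divfK // gt_eqF.
exists (u / step n); split.
- by rewrite divr_ge0 ?(ltW st0) //= ler_pdivrMr // mul1r.
- by rewrite mulrBr mulr1 uE.
- by rewrite uE.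
Qed.

Lemma fan_cover n (p : R * R) : (3 <= n)%N ->
  exists (i : 'I_n) a b, [/\ 0 <= a, 0 <= b & p = fan n i a b].
Proof.
move=> n3; have n0 : (0 < n)%N by exact: leq_trans n3.
have [i [r [s [r0 /andP[s0 s1] ->]]]] := arc_cover p n0.
have sp := sin_step_gt0 n3; have /andP[st0 stp] := step_bound n3.
have B x : 0 <= x <= 1 -> 0 <= r * sin (step n * x) / sin (step n).
  move=> /andP[x0 x1]; apply: divr_ge0 (ltW sp); apply: mulr_ge0 => //.
  apply: sin_ge0_pi; rewrite mulr_ge0 ?(ltW st0) //=.
  by apply: le_trans (ltW stp); rewrite ler_piMr // ltW.
exists i, (r * sin (step n * (1 - s)) / sin (step n)),
  (r * sin (step n * s) / sin (step n)); split.
- by apply: B; lra.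
- by apply: B; lra.
- by apply: arc_fan => //; rewrite divfK // gt_eqF.
Qed.

Lemma fan_inj n i j a b a' b' : (3 <= n)%N -> (i < n)%N -> (j < n)%N ->
  0 <= a -> 0 <= b -> 0 <= a' -> 0 <= b' ->
  fan n i a b = fan n j a' b' ->
  [\/ [/\ i = j, a = a' & b = b'], [/\ a = 0, b = 0, a' = 0 & b' = 0],
      [/\ j = (i.+1 %% n)%N, a = 0, b' = 0 & b = a'] |
      [/\ i = (j.+1 %% n)%N, a' = 0, b = 0 & b' = a]].
Proof.
move=> n3 iln jln a0 b0 a'0 b'0.
have sn0 : sin (step n) != 0 by rewrite gt_eqF // sin_step_gt0.
have Z x : x * sin (step n) = 0 -> x = 0.
  by move=> /eqP; rewrite mulf_eq0 (negbTE sn0) orbF => /eqP.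
have [r [s [r0 sb -> aE bE]]] := fan_arc i n3 a0 b0.
have [r' [s' [r'0 sb' -> aE' bE']]] := fan_arc j n3 a'0 b'0.
move=> /(arc_inj iln jln r0 r'0 sb sb')[rr]; subst r'; case.
- move=> r_0; constructor 2.
  by split; apply: Z; rewrite ?(aE, bE, aE', bE') r_0 mul0r.
- move=> [-> ss]; subst s'; constructor 1.
  by split=> //; apply: (mulIf sn0); rewrite ?(aE, bE, aE', bE').
- move=> [jE s1 s0]; constructor 3; subst s s'; split=> //.
  + by apply: Z; rewrite aE subrr mulr0 sin0 mulr0.
  + by apply: Z; rewrite bE' mulr0 sin0 mulr0.
  + by apply: (mulIf sn0); rewrite bE aE' subr0.
- move=> [jE s1 s0]; constructor 4; subst s s'; split=> //.
  + by apply: Z; rewrite aE' subrr mulr0 sin0 mulr0.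
  + by apply: Z; rewrite bE mulr0 sin0 mulr0.
  + by apply: (mulIf sn0); rewrite bE' aE subr0.
Qed.

Definition cross (u v : R * R) : R := u.1 * v.2 - u.2 * v.1.
Definition dot (u v : R * R) : R := u.1 * v.1 + u.2 * v.2.

(* The argument of (a, b) in ]-pi, pi[. *)
Lemma half_angle a b : b != 0 \/ 0 < a ->
  let m := Num.sqrt (a ^+ 2 + b ^+ 2) in
  let t := 2 * atan (b / (a + m)) in
  [/\ 0 < m, 0 < a + m, a = m * cos t & b = m * sin t].
Proof.
move=> ab m t.
have m2 : m ^+ 2 = a ^+ 2 + b ^+ 2 by rewrite sqr_sqrtr // addr_ge0 // sqr_ge0.
have m0 : 0 <= m := sqrtr_ge0 _.
have b2 : 0 <= b ^+ 2 := sqr_ge0 b.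
have ap : 0 < a + m.
  case: ab => [bn0|]; last by lra.
  have b2' : 0 < b ^+ 2 by rewrite lt_neqAle eq_sym sqrf_eq0 bn0 b2.
  rewrite ltNge; apply/negP => am; nra.
have mp : 0 < m by rewrite lt_neqAle eq_sym m0 andbT; apply/eqP => m_0; nra.
(* [b / (a + m)] is the tangent of half the argument; 1 plus its square gives the squared cosine of
   the half angle, and duplication formulas do the rest. *)
have E : 1 + (b / (a + m)) ^+ 2 = 2 * m / (a + m).
  have -> : (b / (a + m)) ^+ 2 = (m ^+ 2 - a ^+ 2) / (a + m) ^+ 2.
    by rewrite m2 expr_div_n; congr (_ / _); ring.
  by field; rewrite gt_eqF.
have c2 : cos (atan (b / (a + m))) ^+ 2 = (a + m) / (2 * m).
  rewrite cos_atan exprVn sqr_sqrtr; last by rewrite addr_ge0 // sqr_ge0.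
  by rewrite E invf_div.
have cn0 : cos (atan (b / (a + m))) != 0.
  by rewrite -sqrf_eq0 c2 gt_eqF // divr_gt0 //; lra.
have mn0 : m != 0 by rewrite gt_eqF.
have amn0 : a + m != 0 by rewrite gt_eqF.
split=> //.
- rewrite /t mulr_natl cos_mulr2n c2 -mulr_natl; field.
  by rewrite mn0.
- rewrite /t mulr_natl sin_mulr2n -mulr_natl.
  have -> : sin (atan (b / (a + m))) =
      (b / (a + m)) * cos (atan (b / (a + m))).
    by rewrite -{2}(atanK (b / (a + m))) /tan divfK.
  rewrite [cos _ * (_ * _)]mulrCA -expr2 c2; field.
  by rewrite mn0 amn0.
Qed.
End Fan.

(** * Winding of a map preserving a flag *)

Lemma pair_continuous_at (X Y Z : topologicalType) (f : X -> Y) (g : X -> Z) (x : X) :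
  {for x, continuous f} -> {for x, continuous g} ->
  {for x, continuous (fun x => (f x, g x))}.
Proof. by move=> cf cg; apply: cvg_pair cf cg. Qed.

Lemma pair_continuous (X Y Z : topologicalType) (f : X -> Y) (g : X -> Z) :
  continuous f -> continuous g -> continuous (fun x => (f x, g x)).
Proof. by move=> cf cg x; apply: pair_continuous_at; [exact: cf|exact: cg]. Qed.

Lemma fst_continuous (X Y : topologicalType) : continuous (@fst X Y).
Proof. by move=> x; exact: cvg_fst. Qed.

Lemma snd_continuous (X Y : topologicalType) : continuous (@snd X Y).
Proof. by move=> x; exact: cvg_snd. Qed.

Section Winding.
Variable R : realType.

Lemma polar_continuous (X : topologicalType) (p : R * R) (r a : X -> R) :
  continuous r -> continuous a -> continuous (fun x => polar p (r x) (a x)).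
Proof.
move=> cr ca; apply: pair_continuous => x; apply: cvgD; try exact: cvg_cst.
  by apply: cvgM; [exact: cr|apply: continuous_comp (ca x) _; exact: continuous_cos].
by apply: cvgM; [exact: cr|apply: continuous_comp (ca x) _; exact: continuous_sin].
Qed.

Lemma fan_continuous n i : continuous (fun z : R * R => fan n i z.1 z.2).
Proof.
apply: pair_continuous => z; apply: cvgD; apply: cvgM; try exact: cvg_cst;
  by [exact: fst_continuous|exact: snd_continuous].
Qed.

(* [f q - f p] never points opposite to [q - p] turned by [nu - mu], so the angle
   from the latter to the former is continuous with values in ]-pi, pi[. *)
Lemma flag_orientation (f : R * R -> R * R) (p : R * R) (U : set (R * R)) (mu nu :
  R) :
  let u := (cos mu, sin mu) in let v := (cos nu, sin nu) in
  open U -> U p -> {within U, continuous f} ->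
  (forall q, U q -> q != p ->
    [\/ 0 < cross u (q - p) /\ 0 < cross v (f q - f p),
        cross u (q - p) < 0 /\ cross v (f q - f p) < 0,
        [/\ cross u (q - p) = 0, cross v (f q - f p) = 0,
            0 < dot u (q - p) & 0 < dot v (f q - f p)] |
        [/\ cross u (q - p) = 0, cross v (f q - f p) = 0,
            dot u (q - p) < 0 & dot v (f q - f p) < 0]]) ->
  orientation_preserving_at f p.
Proof.
move=> u v oU Up cf H.
have nU : nbhs p U by exact: open_nbhs_nbhs.
have /nbhs_ballP[e /= e0 eU] := nU.
rewrite /orientation_preserving_at; near=> r.
have r0 : 0 < r by near: r; exact: nbhs_right_gt.
have re : r < e by near: r; exact: nbhs_right_lt.
pose c s : R * R := polar p r (2 * pi * s).
have cU s : U (c s).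
  apply: eU; split => /=; rewrite /ball /= opprD addNKr normrN normrM (gtr0_norm r0).
    by apply: le_lt_trans re; rewrite ler_piMr ?(ltW r0) ?cos_max.
  by apply: le_lt_trans re; rewrite ler_piMr ?(ltW r0) ?sin_max.
have cp s : c s - p = (r * cos (2 * pi * s), r * sin (2 * pi * s)).
  by congr pair; rewrite /= addrC addKr.
have cnp s : c s != p.
  apply/eqP => cE; have := cp s; rewrite cE subrr => -[/esym/eqP + /esym/eqP].
  rewrite !mulf_eq0 (gt_eqF r0) /= => /eqP c0 /eqP s0.
  by have := cos2Dsin2 (2 * pi * s); rewrite c0 s0; lra.
have cc : continuous c.
  apply: polar_continuous => s; first exact: cvg_cst.
  by apply: cvgM; [exact: cvg_cst|exact: cvg_id].
have cfc : continuous (f \o c).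
  move=> s; apply: continuous_comp; first exact: cc.
  by move: cf; rewrite continuous_open_subspace // => /(_ (c s)); apply; rewrite inE.
(* In complex notation, [D1 + i D2] is [q - p] turned by [- mu], [E1 + i E2] is [f q - f p] turned
   by [- nu], and [A + i B] is the conjugate of the first times the second. It must avoid the
   non-positive real axis. *)
pose D1 s := dot u (c s - p); pose D2 s := cross u (c s - p).
pose E1 s := dot v (f (c s) - f p); pose E2 s := cross v (f (c s) - f p).
pose A s := D1 s * E1 s + D2 s * E2 s.
pose B s := D1 s * E2 s - D2 s * E1 s.
have AB s : B s != 0 \/ 0 < A s.
  have := H _ (cU s) (cnp s); rewrite -/(D1 s) -/(D2 s) -/(E1 s) -/(E2 s) /A /B.
  move: (D1 s) (D2 s) (E1 s) (E2 s) => d1 d2 e1 e2.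
  have [B0|Bn0 _] := eqVneq (d1 * e2 - d2 * e1) 0; last by left.
  move=> h; right; case: h => [[d e']|[d e']|[-> -> d e']|[-> -> d e']].
  (* When [B] vanishes the two vectors are parallel, and [A * e2] is [d2] times a squared norm; as
     [d2] and [e2] have the same sign, [A] is positive. *)
  - have : 0 < (d1 * e1 + d2 * e2) * e2.
      have -> : (d1 * e1 + d2 * e2) * e2 = d2 * (e1 ^+ 2 + e2 ^+ 2).
        have -> : (d1 * e1 + d2 * e2) * e2 = (d1 * e2) * e1 + d2 * e2 ^+ 2 by ring.
        by rewrite (_ : d1 * e2 = d2 * e1); [ring|lra].
      rewrite mulr_gt0 // ltr_wpDl ?sqr_ge0 // exprn_gt0 //.
    by rewrite pmulr_lgt0.
  - have : (d1 * e1 + d2 * e2) * e2 < 0.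
      have -> : (d1 * e1 + d2 * e2) * e2 = d2 * (e1 ^+ 2 + e2 ^+ 2).
        have -> : (d1 * e1 + d2 * e2) * e2 = (d1 * e2) * e1 + d2 * e2 ^+ 2 by ring.
        by rewrite (_ : d1 * e2 = d2 * e1); [ring|lra].
      rewrite nmulr_rlt0 // ltr_wpDl ?sqr_ge0 // lt_neqAle eq_sym sqrf_eq0.
      by rewrite sqr_ge0 andbT lt_eqF.
    by rewrite nmulr_llt0.
  - by rewrite mul0r addr0 mulr_gt0.
  - by rewrite mul0r addr0 nmulr_rgt0.
have diffc (i : bool) : continuous (fun s =>
  if i then (f (c s) - f p).1 else (f (c s) - f p).2).
  case: i => s /=; apply: cvgB; try exact: cvg_cst.
    by apply: (cvg_comp _ _ (cfc s)); exact: fst_continuous.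
  by apply: (cvg_comp _ _ (cfc s)); exact: snd_continuous.
have diffd (i : bool) : continuous (fun s => if i then (c s - p).1 else (c s - p).2).
  case: i => s /=; apply: cvgB; try exact: cvg_cst.
    exact: (cvg_comp _ _ (cc s) (@fst_continuous _ _ (c s))).
  exact: (cvg_comp _ _ (cc s) (@snd_continuous _ _ (c s))).
have cD1 : continuous D1.
  by move=> s; apply: cvgD; apply: cvgM; try exact: cvg_cst;
    [exact: (diffd true)|exact: (diffd false)].
have cD2 : continuous D2.
  by move=> s; apply: cvgB; apply: cvgM; try exact: cvg_cst;
    [exact: (diffd false)|exact: (diffd true)].
have cE1 : continuous E1.
  by move=> s; apply: cvgD; apply: cvgM; try exact: cvg_cst;
    [exact: (diffc true)|exact: (diffc false)].
have cE2 : continuous E2.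
  by move=> s; apply: cvgB; apply: cvgM; try exact: cvg_cst;
    [exact: (diffc false)|exact: (diffc true)].
have cA : continuous A.
  by move=> s; apply: cvgD; apply: cvgM;
    [exact: cD1|exact: cE1|exact: cD2|exact: cE2].
have cB : continuous B.
  by move=> s; apply: cvgB; apply: cvgM;
    [exact: cD1|exact: cE2|exact: cD2|exact: cE1].
pose M s := Num.sqrt (A s ^+ 2 + B s ^+ 2).
have cM : continuous M.
  move=> s; apply: (@continuous_comp _ _ _ (fun s => A s ^+ 2 + B s ^+ 2) Num.sqrt);
    last exact: sqrt_continuous.
  by apply: cvgD; rewrite expr2; apply: cvgM;
    [exact: cA|exact: cA|exact: cB|exact: cB].
(* The half-angle form is continuous on the whole slit plane, where [atan (B / A)] would break down
   at [A = 0]. *)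
pose tau s := 2 * atan (B s / (A s + M s)).
have HA s := half_angle (AB s).
have ctau : continuous tau.
  move=> s; apply: cvgM; first exact: cvg_cst.
  apply: (@continuous_comp _ _ _ (fun s => B s / (A s + M s)) atan);
    last exact: continuous_atan.
  apply: cvgM; first exact: cB.
  apply: cvgV; last by apply: cvgD; [exact: cA|exact: cM].
  by have [_ h _ _] := HA s; rewrite gt_eqF.
have c01 : c 1 = c 0.
  by rewrite /c /polar mulr1 mulr0 mulr_natl cos2pi sin2pi cos0 sin0.
(* The argument of [q - p] is [2 * pi * s]; the flag turns it by [nu - mu], and [tau] is the
   remaining angle. Since [tau] takes the same value at 0 and 1, the total increase is one full
   turn. *)
exists (fun s => 2 * pi * s - mu + nu + tau s); split.
- apply: continuous_subspaceT => s; apply: cvgD; last exact: ctau.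
  apply: cvgD; last exact: cvg_cst.
  apply: cvgB; last exact: cvg_cst.
  by apply: cvgM; [exact: cvg_cst|exact: cvg_id].
- rewrite /tau /M /A /B /D1 /D2 /E1 /E2 c01 mulr1 mulr0.
  by ring.
- move=> s _; exists (M s / r); first by rewrite divr_gt0 //; case: (HA s).
  have [M0 AM0 AE BE] := HA s; rewrite -/(M s) -/(tau s) in AE BE M0 AM0.
  have cm := cos2Dsin2 mu; have cn := cos2Dsin2 nu.
  have D1E : D1 s = r * cos (2 * pi * s - mu).
    by rewrite /D1 cp /dot /= cosB; ring.
  have D2E : D2 s = r * sin (2 * pi * s - mu).
    by rewrite /D2 cp /cross /= sinB; ring.
  have DD : D1 s ^+ 2 + D2 s ^+ 2 = r ^+ 2.
    by rewrite D1E D2E !exprMn -mulrDr cos2Dsin2 mulr1.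
  have E1E : r ^+ 2 * E1 s = A s * D1 s - B s * D2 s.
    by rewrite -DD /A /B; ring.
  have E2E : r ^+ 2 * E2 s = A s * D2 s + B s * D1 s.
    by rewrite -DD /A /B; ring.
  have rn : r != 0 by rewrite gt_eqF.
  have {}E1E : E1 s = M s / r * cos (2 * pi * s - mu + tau s).
    apply: (@mulfI _ (r ^+ 2)); first by rewrite expf_neq0.
    rewrite E1E D1E D2E AE BE [cos (_ + tau s)]cosD.
    by move: (cos (_ - _)) (sin (_ - _)) => x y; field.
  have {}E2E : E2 s = M s / r * sin (2 * pi * s - mu + tau s).
    apply: (@mulfI _ (r ^+ 2)); first by rewrite expf_neq0.
    rewrite E2E D1E D2E AE BE [sin (_ + tau s)]sinD.
    by move: (cos (_ - _)) (sin (_ - _)) => x y; field.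
  rewrite -/(c s); move: E1E E2E; rewrite /E1 /E2 /dot /cross /=.
  set fx := f (c s); set fp := f p;
    rewrite /polar [_ + nu + _]addrAC [cos (_ + nu)]cosD [sin (_ + nu)]sinD.
  move: (cos (_ + _)) (sin (_ + _)) (M s / r) => x y m E1E E2E.
  have e1 : fx.1 - fp.1 = m * (x * cos nu - y * sin nu).
    rewrite mulrBr !mulrA -E1E -E2E.
    rewrite -[LHS]mulr1 -cn; ring.
  have e2 : fx.2 - fp.2 = m * (y * cos nu + x * sin nu).
    rewrite mulrDr !mulrA -E1E -E2E.
    rewrite -[LHS]mulr1 -cn; ring.
  by rewrite -e1 -e2 !subrKC; case: (fx).
Unshelve. all: by end_near. Qed.
End Winding.

(** * Cyclic arrangements of sectors *)

Section PlanarStar.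
Variable R : realType.
Implicit Types (r s a b e : R) (n i j : nat) (z : R * R).

Definition simplex e : set (R * R) :=
  [set z | [/\ 0 <= z.1, 0 <= z.2 & z.1 + z.2 <= e]].
(** Only the side opposite to the origin is removed: an open star keeps the sides through its
    centre. *)
Definition osimplex e : set (R * R) :=
  [set z | [/\ 0 <= z.1, 0 <= z.2 & z.1 + z.2 < e]].

Lemma osimplexW e z : osimplex e z -> simplex e z.
Proof. by move=> [z1 z2 /ltW z3]; split. Qed.

Lemma simplex_le e e' : e <= e' -> simplex e `<=` simplex e'.
Proof. by move=> ee z [z1 z2 z3]; split=> //; exact: le_trans ee. Qed.

Lemma closed_superlevel (T : topologicalType) (f : T -> R) e :
  continuous f -> closed [set x | e <= f x].
Proof.
by move=> /continuous_closedP cf; apply: (cf [set y | e <= y]); exact: closed_ge.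
Qed.

Lemma open_superlevel (T : topologicalType) (f : T -> R) e :
  continuous f -> open [set x | e < f x].
Proof. by move=> /continuousP cf; apply: (cf [set y | e < y]); exact: open_gt. Qed.

Lemma simplex_compact e : compact (simplex e).
Proof.
apply: (@subclosed_compact _ _ (`[0, e] `*` `[0, e])).
- have -> : simplex e = [set z | 0 <= z.1] `&` [set z | 0 <= z.2] `&`
      [set z | - e <= - (z.1 + z.2)].
    rewrite eqEsubset; split => z /=; first by case=> *; rewrite lerN2.
    by case=> -[]; rewrite lerN2.
  apply: closedI; first by apply: closedI; apply: closed_superlevel;
    [exact: fst_continuous|exact: snd_continuous].
  apply: closed_superlevel => z; apply: cvgN; apply: cvgD;
    [exact: fst_continuous|exact: snd_continuous].
- by apply: compact_setX; exact: segment_compact.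
- by move=> z [z1 z2 z3]; split => /=; rewrite in_itv /=; lra.
Qed.

(* [g i] maps the standard simplex to the [i]-th of [n] sectors arranged
   cyclically around the origin. *)
Record planar_star n (g : nat -> R * R -> R * R) : Prop := PlanarStar {
  ps_cont : forall i, continuous (g i);
  ps_glue : forall i b, (i < n)%N -> 0 <= b -> g i (0, b) = g (i.+1 %% n)%N (b, 0);
  ps_apex : forall i j, g i (0, 0) = g j (0, 0);
  ps_inj : forall i j a b a' b', (i < n)%N -> (j < n)%N ->
    0 <= a -> 0 <= b -> 0 <= a' -> 0 <= b' -> g i (a, b) = g j (a', b') ->
    [\/ [/\ i = j, a = a' & b = b'], [/\ a = 0, b = 0, a' = 0 & b' = 0],
      [/\ j = (i.+1 %% n)%N, a = 0, b' = 0 & b = a'] |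
      [/\ i = (j.+1 %% n)%N, a' = 0, b = 0 & b' = a]];
  ps_open : forall e, 0 < e ->
    open [set p | exists (i : 'I_n) z, osimplex e z /\ p = g i z] }.

Lemma fan_planar_star n : (3 <= n)%N -> planar_star n (fun i z => fan n i z.1 z.2).
Proof.
move=> n3; have n0 : (0 < n)%N by exact: leq_trans n3.
have s0 := sin_step_gt0 R n3; have sn0 : sin (step R n) != 0 by rewrite gt_eqF.
split => [i|i b _ _|i j|i j a b a' b' iln jln|e e0].
- exact: fan_continuous.
- exact: fan_glue.
- by rewrite /fan !mul0r addr0.
- exact: fan_inj.
pose u i : R * R := (cos (angle R n i), sin (angle R n i)).
(* Cramer's rule: [A i p] and [B i p] are the coordinates of [p] in the basis that bounds sector
   [i]. *)
pose A i p := cross p (u i.+1) / sin (step R n).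
pose B i p := cross (u i) p / sin (step R n).
have uu i : cross (u i) (u i.+1) = sin (step R n).
  by rewrite /cross /u /= angleS [cos (_ + _)]cosD [sin (_ + _)]sinD;
     have := cos2Dsin2 (angle R n i);
       move: (cos (angle R n i)) (sin (angle R n i)) (sin (step R n)) (cos (step R
       n)) => x y s c xy; rewrite -[RHS]mulr1 -xy; ring.
have cc i : continuous (A i) /\ continuous (B i).
  split=> p; apply: cvgM; try exact: cvg_cst; apply: cvgB; apply: cvgM;
    try exact: cvg_cst; by [exact: fst_continuous|exact: snd_continuous].
have ABE i p : p = fan n i (A i p) (B i p).
  case: p => x y; rewrite /fan /A /B; have := uu i; move: sn0; rewrite /cross /u /=.
  move: (cos (angle R n i)) (sin (angle R n i)) (cos (angle R n i.+1)) (sin (angle R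
    n i.+1)) => c1 s1 c2 s2 + D0.
  by rewrite -D0 => {}D0; congr pair; field.
have ABfan i a b : A i (fan n i a b) = a /\ B i (fan n i a b) = b.
  rewrite /A /B; have := uu i; rewrite /fan /cross /u /= => D0.
  split; apply: (mulIf sn0); rewrite divfK // -D0; ring.
(* The sectors cover the plane, so the set is the complement of finitely many closed pieces, the far
   parts of the closed sectors. *)
have -> : [set p | exists (i : 'I_n) z, osimplex e z /\ p = fan n i z.1 z.2] =
    ~` \bigcup_(i : 'I_n) ([set p | 0 <= A i p] `&` [set p | 0 <= B i p] `&`
      [set p | e <= A i p + B i p]).
  rewrite eqEsubset; split => p.
    move=> [i [[a b] [[/= a0 b0 ab] ->]]] [j _ [[/= A0 B0] AB]].
    move: AB; rewrite leNgt => /negP; apply.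
    have /(fan_inj n3 (ltn_ord i) (ltn_ord j) a0 b0 A0 B0) := ABE j (fan n i a b).
    by case=> -[]; lra.
  move=> nU; have [i [a [b [a0 b0 pE]]]] := fan_cover p n3.
  exists i, (a, b); split=> //; split=> //=; rewrite ltNge; apply/negP => eab.
  by apply: nU; exists i => //; have [Aa Bb] := ABfan i a b; rewrite /= pE Aa Bb.
apply: closed_openC; apply: closed_bigcup => [|i _]; first exact: finite_finset.
have [cA cB] := cc i.
apply: closedI; first by apply: closedI; exact: closed_superlevel.
by apply: closed_superlevel => p; apply: cvgD; [exact: cA|exact: cB].
Qed.

(** The sum of the coordinates becomes the radius and their ratio the position on the arc, so the
    side opposite to the origin is wrapped on the unit circle at constant speed. At the origin the
    division by zero is harmless, as the radius is 0. *)
Definition round n i z := arc n i (z.1 + z.2) (z.2 / (z.1 + z.2)).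

Lemma ratio_bound a b : 0 <= a -> 0 <= b -> 0 <= b / (a + b) <= 1.
Proof.
move=> a0 b0; rewrite divr_ge0 ?addr_ge0 //=.
have [->|ab] := eqVneq (a + b) 0; first by rewrite invr0 mulr0.
by rewrite ler_pdivrMr ?mul1r ?lerDr // lt_neqAle eq_sym ab addr_ge0.
Qed.

Lemma round_arc n i r s : 0 <= s <= 1 -> arc n i r s = round n i (r * (1 - s), r * s).
Proof.
move=> sb; rewrite /round /= -mulrDr subrK mulr1.
have [->|r0] := eqVneq r 0; first by rewrite /arc /polar /= !mul0r.
by rewrite [r * s]mulrC mulfK.
Qed.

Lemma arc_norm n i r s : (arc n i r s).1 ^+ 2 + (arc n i r s).2 ^+ 2 = r ^+ 2.
Proof. by rewrite /arc /polar /= !add0r !exprMn -mulrDr cos2Dsin2 mulr1. Qed.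

Lemma open_ball_round n e : (0 < n)%N -> 0 < e ->
  [set p | exists (i : 'I_n) z, osimplex e z /\ p = round n i z] =
  [set p | p.1 ^+ 2 + p.2 ^+ 2 < e ^+ 2].
Proof.
move=> n0 e0; rewrite eqEsubset; split => p /=.
  move=> [i [z [[z1 z2 z3] ->]]]; rewrite arc_norm.
  by rewrite ltr_pXn2r // nnegrE ?addr_ge0 // ltW.
have [i [r [s [r0 sb ->]]]] := arc_cover p n0.
rewrite arc_norm ltr_pXn2r ?nnegrE ?(ltW e0) // => re; move: (sb) => /andP[s0 s1].
exists i, (r * (1 - s), r * s); split; last by rewrite round_arc.
split=> /=; first by rewrite mulr_ge0 // subr_ge0.
- by rewrite mulr_ge0.
- by rewrite -mulrDr subrK mulr1.
Qed.

Lemma closed_ball_round n : (0 < n)%N ->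
  @closed_disc R = \bigcup_(i : 'I_n) (round n i @` simplex 1).
Proof.
move=> n0; rewrite eqEsubset; split => p /=; rewrite /closed_disc /=.
  have [i [r [s [r0 sb ->]]]] := arc_cover p n0.
  rewrite arc_norm -[X in _ <= X -> _](expr1n R 2) ler_pXn2r ?nnegrE // => re;
    move: (sb) => /andP[s0 s1].
  exists i => //; exists (r * (1 - s), r * s); last by rewrite round_arc.
  split=> /=; first by rewrite mulr_ge0 // subr_ge0.
  - by rewrite mulr_ge0.
  - by rewrite -mulrDr subrK mulr1.
move=> [i _ [z [z1 z2 z3] <-]]; rewrite arc_norm -[1](expr1n _ 2).
by rewrite ler_pXn2r // nnegrE // addr_ge0.
Qed.

(** The angle may have no limit where [z.1 + z.2 = 0]; there the radius tends to 0 and absorbs the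
    bounded cosine and sine. *)
Lemma round_continuous n i : continuous (round n i).
Proof.
move=> z; have cs : continuous (fun z : R * R => z.1 + z.2).
  by move=> y; apply: cvgD; [exact: fst_continuous|exact: snd_continuous].
have H (f : R -> R) : continuous f -> (forall x, `|f x| <= 1) ->
    {for z, continuous (fun y : R * R =>
      0 + (y.1 + y.2) * f (2 * pi * (i%:R + y.2 / (y.1 + y.2)) / n%:R))}.
  move=> cf fb; have [z0|zn0] := eqVneq (z.1 + z.2) 0.
    rewrite /prop_for /continuous_at z0 mul0r addr0.
    apply/cvgrPdist_lt => e e0; near=> y.
    rewrite sub0r normrN add0r normrM; apply: (@le_lt_trans _ _ `|y.1 + y.2|).
      by rewrite ler_piMr.
    near: y; have /cvgrPdist_lt/(_ _ e0) := cs z.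
    by apply: filterS => y; rewrite z0 sub0r normrN.
  apply: cvgD; first exact: cvg_cst.
  apply: cvgM; first exact: cs.
  apply: (@continuous_comp _ _ _ (fun y : R * R =>
    2 * pi * (i%:R + y.2 / (y.1 + y.2)) / n%:R) f); last exact: cf.
  apply: cvgM; last exact: cvg_cst.
  apply: cvgM; first exact: cvg_cst.
  apply: cvgD; first exact: cvg_cst.
  by apply: cvgM; [exact: snd_continuous|apply: cvgV => //; exact: cs].
exact: (pair_continuous_at (H _ (@continuous_cos R) (@cos_max R))
  (H _ (@continuous_sin R) (@sin_max R))).
Unshelve. all: by end_near. Qed.

Lemma round_planar_star n : (0 < n)%N -> planar_star n (round n).
Proof.
move=> n0; split => [i|i b iln b0|i j|i j a b a' b' iln jln a0 b0 a0' b0'|e e0].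
- exact: round_continuous.
- have [->|bn0] := eqVneq b 0.
    by rewrite /round /= !addr0 /arc /polar /= !mul0r.
  have nn0 : n%:R != 0 :> R by rewrite pnatr_eq0 -lt0n.
  rewrite /round /= add0r addr0 divff // mul0r !arcE mulr0 addr0 mulr1 -angleS.
  by rewrite cos_angle_mod // sin_angle_mod.
- by rewrite /round /= !addr0 /arc /polar /= !mul0r.
- have sb := ratio_bound a0 b0; have sb' := ratio_bound a0' b0'.
  move=> /(arc_inj iln jln (addr_ge0 a0 b0) (addr_ge0 a0' b0') sb sb') /=.
  move=> [rr H]; have [r0|rn0] := eqVneq (a + b) 0.
    by constructor 2; move: r0 rr => r0; rewrite r0; split; lra.
  have rp : 0 < a + b by rewrite lt_neqAle eq_sym rn0 addr_ge0.
  have bE : b = b / (a + b) * (a + b) by rewrite divfK.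
  have bE' : b' = b' / (a' + b') * (a' + b') by rewrite divfK // -rr.
  case: H => [r0|[ij ss]|[ij s1 s0]|[ij s1 s0]].
  + by rewrite r0 eqxx in rn0.
  + have bb : b = b'.
      by rewrite bE ss rr -bE'.
    by constructor 1; split=> //; lra.
  + by constructor 3; move: bE bE'; rewrite s1 s0 -rr mul0r mul1r => ? ?;
    split=> //; lra.
  + by constructor 4; move: bE bE'; rewrite s1 s0 -rr mul0r mul1r => ? ?;
    split=> //; lra.
- rewrite open_ball_round //.
  have -> : [set p : R * R | p.1 ^+ 2 + p.2 ^+ 2 < e ^+ 2] =
     [set p | - e ^+ 2 < - (p.1 * p.1 + p.2 * p.2)].
    by rewrite eqEsubset; split => p /=; rewrite ltrN2 !expr2.
  apply: open_superlevel => p; apply: cvgN; apply: cvgD; apply: cvgM;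
    by [exact: fst_continuous|exact: snd_continuous].
Qed.

End PlanarStar.

(** * Triangulated surfaces *)

(* A closed oriented triangulated surface.  The darts are the pairs of a triangle
   and one of its corners; [tnext] turns around the triangle and [topp] reverses
   the side from a corner to the next one, so that [vnext] turns
   counterclockwise around a vertex. *)
Record triangulation := Triangulation {
  tdart :> finType;
  tnext : tdart -> tdart;
  topp : tdart -> tdart;
  vnext := fun c => topp (tnext (tnext c));
  tnext3 : forall c, tnext (tnext (tnext c)) = c;
  toppK : involutive topp;
  tapart : forall c, ~~ fconnect vnext c (tnext c);
  tdegree : forall c, (3 <= fingraph.order vnext c)%N;
  tconn : forall P : pred tdart, (forall c, P c -> P (tnext c)) ->
    (forall c, P c -> P (topp c)) -> forall c d, P c -> P d;
  tbase : tdart }.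

Arguments tnext {t} c.
Arguments topp {t} c.
Arguments vnext {t} c.
Arguments tbase {t}.

Section Triangulation.
Variables (R : realType) (C : triangulation).

Definition same (c d : C) := fconnect (@vnext C) c d.

Implicit Types (c d : C) (a b : R) (z : R * R).

Lemma vnext_inj : injective (@vnext C).
Proof. by move=> c d /(congr1 (tnext \o topp)); rewrite /= !toppK !tnext3. Qed.

Lemma same_refl c : same c c.
Proof. exact: connect0. Qed.

Lemma same_sym c d : same c d = same d c.
Proof. exact: (fconnect_sym vnext_inj). Qed.

Lemma same_trans c d e : same c d -> same d e -> same c e.
Proof. exact: connect_trans. Qed.

Lemma same_vnext c : same c (vnext c).
Proof. exact: fconnect1. Qed.

Lemma same_l c d e : same c d -> same c e = same d e.
Proof.
by move=> cd; apply/idP/idP; apply: same_trans => //; rewrite same_sym.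
Qed.

Lemma same_r c d e : same c d -> same e c = same e d.
Proof. by move=> cd; rewrite ![same e _]same_sym; exact: same_l. Qed.

Lemma same_tnext c : same c (tnext c) = false.
Proof. exact/negbTE/tapart. Qed.

Lemma same_tnext2 c : same c (tnext (tnext c)) = false.
Proof. by rewrite -[c in same c]tnext3 same_sym same_tnext. Qed.

Lemma vnext_tnext c : vnext (tnext c) = topp c.
Proof. by rewrite /vnext tnext3. Qed.

Lemma rot_vnext c : same (tnext (vnext c)) (tnext (tnext c)).
Proof.
rewrite /same -[X in connect _ _ X](toppK) -[topp (tnext (tnext c))]/(vnext c).
by rewrite -vnext_tnext; exact: fconnect1.
Qed.

(* The sides [c] -> [tnext c] and [topp c] -> [tnext (topp c)] are glued together. *)
Definition side c d := (c == d) || (topp c == d).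
Definition in_tri c d := [|| c == d, c == tnext d | c == tnext (tnext d)].

(* [z] stands for the point of the triangle of [c] with barycentric coordinates
   [1 - z.1 - z.2], [z.1] and [z.2] at [c], [tnext c] and [tnext (tnext c)].  The
   quotient surface is realised through coordinates attached to its vertices,
   edges and triangles. *)
Definition vcoord c z d : R :=
  (same d c)%:R * (1 - z.1 - z.2) + (same d (tnext c))%:R * z.1 +
  (same d (tnext (tnext c)))%:R * z.2.
Definition ecoord c z d : R :=
  (side d c)%:R * ((1 - z.1 - z.2) * z.1) + (side d (tnext c))%:R * (z.1 * z.2) +
  (side d (tnext (tnext c)))%:R * (z.2 * (1 - z.1 - z.2)).
Definition tcoord c z d : R :=
  (in_tri d c)%:R * ((1 - z.1 - z.2) * z.1 * z.2).

Definition coord c z (x : C * 'I_3) : R :=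
  match val x.2 with
  | 0%N => vcoord c z x.1 | 1%N => ecoord c z x.1 | _ => tcoord c z x.1 end.

Definition surf_set : set {ptws C * 'I_3 -> R} :=
  [set f | exists c z, simplex 1 z /\ f = coord c z].

Definition surf : topologicalType := set_type surf_set.

Lemma base_mem : surf_set (coord tbase (0, 0)).
Proof. by exists tbase, (0, 0); split=> //; split => //=; rewrite addr0. Qed.

Lemma coord_mem c z : simplex 1 z -> surf_set (coord c z).
Proof. by move=> sz; exists c, z. Qed.

Definition pt0 : surf := SigSub (mem_set base_mem).

Definition tri c z : surf :=
  match pselect (simplex 1 z) with
  | left h => SigSub (mem_set (coord_mem c h))
  | right _ => pt0
  end.

Lemma triE c z : simplex 1 z -> val (tri c z) = coord c z.
Proof. by move=> sz; rewrite /tri; case: pselect. Qed.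

Lemma tri_surj (p : surf) : exists c z, simplex 1 z /\ p = tri c z.
Proof.
have /set_mem[c [z [sz pE]]] := valP p.
by exists c, z; split => //; apply: val_inj; rewrite triE.
Qed.

Definition vw d (p : surf) : R := (val p : {ptws C * 'I_3 -> R}) (d, inord 0).
Definition ew d (p : surf) : R := (val p : {ptws C * 'I_3 -> R}) (d, inord 1).
Definition tw d (p : surf) : R := (val p : {ptws C * 'I_3 -> R}) (d, inord 2).

Lemma vwE d c z : simplex 1 z -> vw d (tri c z) = vcoord c z d.
Proof. by move=> sz; rewrite /vw triE // /coord /= inordK. Qed.
Lemma ewE d c z : simplex 1 z -> ew d (tri c z) = ecoord c z d.
Proof. by move=> sz; rewrite /ew triE // /coord /= inordK. Qed.
Lemma twE d c z : simplex 1 z -> tw d (tri c z) = tcoord c z d.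
Proof. by move=> sz; rewrite /tw triE // /coord /= inordK. Qed.

Lemma surf_ext (p q : surf) : vw^~ p =1 vw^~ q -> ew^~ p =1 ew^~ q ->
  tw^~ p =1 tw^~ q -> p = q.
Proof.
move=> hv he ht; apply: val_inj; apply: funext => -[d i].
have -> : i = inord i by rewrite inord_val.
by case: i => -[|[|[|]]] //= _; [exact: hv|exact: he|exact: ht].
Qed.

Lemma val_surf_continuous : continuous (val : surf -> {ptws C * 'I_3 -> R}).
Proof. exact: initial_continuous. Qed.

Lemma coordinate_continuous x :
  continuous (fun p : surf => (val p : {ptws C * 'I_3 -> R}) x).
Proof.
move=> p; apply: (@continuous_comp _ _ _ (val : surf -> {ptws C * 'I_3 -> R})
  (fun f : {ptws C * 'I_3 -> R} => f x)).
  exact: val_surf_continuous.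
exact: (@proj_continuous _ (fun _ => R) x).
Qed.

Lemma vw_continuous d : continuous (vw d).
Proof. exact: coordinate_continuous. Qed.
Lemma ew_continuous d : continuous (ew d).
Proof. exact: coordinate_continuous. Qed.

Lemma surf_continuous (X : topologicalType) (K : set X) (f : X -> surf)
    (g : X -> C * 'I_3 -> R) :
  (forall x, continuous (g^~ x)) -> (forall x, K x -> val (f x) = g x) ->
  {within K, continuous f}.
Proof.
move=> cg fg.
apply: (@continuous_comp_initial _ (subspace K) _ (set_val : surf_set -> _)
  (f : subspace K -> surf)).
apply: (@subspace_eq_continuous _ K _ (g : X -> {ptws C * 'I_3 -> R})).
  by move=> x /set_mem Kx; rewrite -fg.
apply: continuous_subspaceT; apply: (@ptws_continuous _ _ _ g) => x; exact: cg.
Qed.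

Lemma tri_continuous c : {within simplex 1, continuous (tri c)}.
Proof.
apply: (surf_continuous (g := coord c)) => [[d i]|z]; last exact: triE.
have c1 := @fst_continuous R R; have c2 := @snd_continuous R R.
have co : continuous (fun z : R * R => 1 - z.1 - z.2).
  by move=> z; apply: cvgB; [apply: cvgB; [exact: cvg_cst|exact: c1]|exact: c2].
rewrite /coord /=; case: (val i) => [|[|_]] z.
- apply: cvgD; first apply: cvgD; apply: cvgM; try exact: cvg_cst;
  [exact: co|exact: c1|exact: c2].
- apply: cvgD; first apply: cvgD; apply: cvgM; try exact: cvg_cst; apply: cvgM;
  by [exact: co|exact: c1|exact: c2].
- apply: cvgM; first exact: cvg_cst.
  by apply: cvgM; [apply: cvgM; [exact: co|exact: c1]|exact: c2].
Qed.

Lemma surf_hausdorff : hausdorff_space surf.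
Proof.
move=> p q pq; apply: val_inj.
apply: (@hausdorff_product (C * 'I_3)%type (fun _ => R)) => [_|U V nU nV].
  exact: Rhausdorff.
have [r [Ur Vr]] := pq _ _ (val_surf_continuous nU) (val_surf_continuous nV).
by exists (val r).
Qed.

Lemma tri_image : [set: surf] = \bigcup_c (tri c @` simplex 1).
Proof.
rewrite eqEsubset; split=> // p _; have [c [z [sz ->]]] := tri_surj p.
by exists c => //; exists z.
Qed.

Lemma compact_bigcup_fin (T : topologicalType) (I : finType) (F : I -> set T) :
  (forall i, compact (F i)) -> compact (\bigcup_i F i).
Proof.
move=> cF; rewrite -bigsetU_fset_set; last exact: finite_finset.
by apply: bigsetU_compact => i _.
Qed.

Lemma surf_compact : compact [set: surf].
Proof.
rewrite tri_image; apply: compact_bigcup_fin => c.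
by apply: continuous_compact; [exact: tri_continuous|exact: simplex_compact].
Qed.

Lemma simplex_tnext a b : simplex 1 (a, b) -> simplex 1 (1 - a - b, a).
Proof. by move=> [/= a0 b0 ab]; split => /=; lra. Qed.

Lemma tri_tnext c a b : simplex 1 (a, b) -> tri (tnext c) (a, b) = tri c (1 - a - b,
  a).
Proof.
move=> sz; have sz' := simplex_tnext sz; apply: surf_ext => d.
- rewrite !vwE // /vcoord /= tnext3; ring.
- rewrite !ewE // /ecoord /= tnext3; ring.
- rewrite !twE // /tcoord /=.
  have -> : in_tri d (tnext c) = in_tri d c by rewrite /in_tri tnext3 orbA orbC.
  ring.
Qed.

Lemma tri_glue c b : 0 <= b <= 1 -> tri c (0, b) = tri (vnext c) (b, 0).
Proof.
move=> /andP[b0 b1].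
have s1 : simplex 1 (0, b) by split => //=; rewrite add0r.
have s2 : simplex 1 (b, 0) by split => //=; rewrite addr0.
apply: surf_ext => d.
- rewrite !vwE // /vcoord /= (same_r d (same_vnext c)) (same_r d (rot_vnext c)); ring.
- rewrite !ewE // /ecoord /= /side.
  have -> : (topp d == vnext c) = (d == tnext (tnext c)) by rewrite (inj_eq (can_inj
    (@toppK C))).
  have -> : (d == vnext c) = (topp d == tnext (tnext c)).
    by rewrite -[d in LHS]toppK (inj_eq (can_inj (@toppK C))).
  rewrite [(topp d == _) || _]orbC; ring.
- rewrite !twE // /tcoord /=; ring.
Qed.

(** By [tapart] a triangle has at most one corner at a given vertex, so the two other terms vanish.
    On a star the vertex coordinate is thus a height, equal to 1 at the centre and 0 on the
    boundary. *)
Lemma vw_apex c d z : same d c -> simplex 1 z -> vw d (tri c z) = 1 - z.1 - z.2.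
Proof.
move=> dc sz; rewrite vwE // /vcoord dc !(same_l _ dc) same_tnext same_tnext2.
by rewrite mul1r !mul0r !addr0.
Qed.

Lemma vw_start d z : simplex 1 z -> vw (tnext d) (tri d z) = z.1.
Proof.
move=> sz; rewrite vwE // /vcoord same_refl same_tnext [same (tnext d) d]same_sym
  same_tnext.
by rewrite mul1r !mul0r add0r addr0.
Qed.

(** The vertex coordinate gives [a = a' + b']. The vanishing triangle coordinate puts the second
    point on one of the two sides at its corner, and the side coordinate tells on which. *)
Lemma edge_star_inj c c' a a' b' : same c c' -> 0 < a < 1 -> osimplex 1 (a', b') ->
  tri c (a, 0) = tri c' (a', b') ->
  (c = c' /\ (a, 0) = (a', b')) \/ [/\ c = vnext c', a' = 0 & b' = a].
Proof.
move=> cc' /andP[a0 a1] /[dup] os' [/= a0' b0' ab'] E.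
have s : simplex 1 (a, 0) by split => //=; lra.
have s' := osimplexW os'.
have W : a = a' + b'.
  have := vw_apex (same_refl c) s; rewrite E vw_apex //= subr0; lra.
have T d : tw d (tri c' (a', b')) = 0.
  by rewrite -E twE // /tcoord /= mulr0 mulr0.
have ab0 : a' * b' = 0.
  have := T c'; rewrite twE // /tcoord /in_tri eqxx mul1r /= -mulrA => /eqP.
  by rewrite mulf_eq0 => /orP[/eqP ?|/eqP //]; lra.
have cr : c == tnext c' = false.
  by apply/negbTE/eqP => cE; move: cc'; rewrite cE same_sym same_tnext.
have crr : c == tnext (tnext c') = false.
  by apply/negbTE/eqP => cE; move: cc'; rewrite cE same_sym same_tnext2.
have oc : topp c == c' = false.
  apply/negbTE/eqP => oE; move: (same_vnext (tnext c)).
  by rewrite vnext_tnext oE same_sym -(same_l _ cc') same_tnext.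
have := ewE c c s; rewrite E ewE // /ecoord /= /side eqxx cr crr oc !orbF ab0.
rewrite !(mulr0, mul0r, addr0, subr0, mul1r).
have [cc _|_] := eqVneq c c'.
  left; split=> //; subst c'.
  have := vw_start c s; rewrite E (vw_start c s') /=.
  by move=> aE; rewrite aE (_ : b' = 0) //; lra.
have [oE|_] := eqVneq (topp c) (tnext (tnext c')); last first.
  rewrite !mul0r addr0 => /esym/eqP; rewrite mulf_eq0 => H; exfalso.
  by case/orP: H => /eqP; lra.
rewrite mul0r add0r mul1r => H; right.
have b1 : b' != 0.
  by apply/eqP => b_0; move: H; rewrite b_0 mul0r => /esym/eqP;
     rewrite mulf_eq0 => /orP[] /eqP; lra.
have a_0 : a' = 0.
  by move/eqP: ab0; rewrite mulf_eq0 (negbTE b1) orbF => /eqP.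
by split=> //; [rewrite /vnext -oE toppK|lra].
Qed.

(** A point off the sides is located by its triangle coordinate, a point on a side by
    [edge_star_inj]. The four cases copy those of [ps_inj], with [vnext] as the successor, so that
    surface and plane carry the same identifications. *)
Lemma star_inj c c' a b a' b' : same c c' ->
  osimplex 1 (a, b) -> osimplex 1 (a', b') -> tri c (a, b) = tri c' (a', b') ->
  [\/ [/\ c = c', a = a' & b = b'], [/\ a = 0, b = 0, a' = 0 & b' = 0],
      [/\ c' = vnext c, a = 0, b' = 0 & b = a'] |
      [/\ c = vnext c', a' = 0, b = 0 & b' = a]].
Proof.
move=> cc' /[dup] os [/= a0 b0 ab] /[dup] os' [/= a0' b0' ab'] E.
have s := osimplexW os; have s' := osimplexW os'.
have W : a + b = a' + b'.
  by have := vw_apex (same_refl c) s; rewrite E vw_apex //=; lra.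
have [b_0|bn0] := eqVneq b 0.
  have [a_0|an0] := eqVneq a 0; first by constructor 2; split=> //; lra.
  have abd : 0 < a < 1 by rewrite lt_neqAle eq_sym an0 a0 /=; lra.
  subst b; case: (edge_star_inj cc' abd os' E) => [[-> [-> ->]]|[-> -> ->]].
    by constructor 1.
  by constructor 4.
have [a_0|an0] := eqVneq a 0.
  have bbd : 0 < b < 1 by rewrite lt_neqAle eq_sym bn0 b0 /=; lra.
  subst a; move: E; rewrite tri_glue; last by lra.
  have vc' : same (vnext c) c' by rewrite -(same_l _ (same_vnext c)).
  move=> /(edge_star_inj vc' bbd os') [[-> [-> ->]]|[/vnext_inj -> -> ->]].
    by constructor 3.
  by constructor 1.
constructor 1.
have ap : 0 < a by rewrite lt_neqAle eq_sym an0.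
have bp : 0 < b by rewrite lt_neqAle eq_sym bn0.
have : tw c (tri c (a, b)) != 0.
  rewrite twE // /tcoord /in_tri eqxx /= mul1r !mulf_neq0 // gt_eqF //; lra.
rewrite E twE // /tcoord mulf_eq0 negb_or => /andP[+ _].
rewrite pnatr_eq0 eqb0 negbK => /or3P[/eqP cE|/eqP cE|/eqP cE].
- subst c'; have := vw_start c s.
  by rewrite E (vw_start c s') /= => aE; split=> //; lra.
- by move: cc'; rewrite cE same_sym same_tnext.
- by move: cc'; rewrite cE same_sym same_tnext2.
Qed.

Definition star d : set surf := [set p | 0 < vw d p].

Lemma star_open d : open (star d).
Proof. by apply: open_superlevel; exact: vw_continuous. Qed.

Lemma starP d p : star d p <->
  exists c z, [/\ same d c, osimplex 1 z & p = tri c z].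
Proof.
split; last first.
  move=> [c [z [dc oz ->]]]; rewrite /star /= vw_apex //; last exact: osimplexW.
  by case: oz; lra.
have [c [[a b] [sz ->]]] := tri_surj p; case: (sz) => /= a0 b0 ab.
rewrite /star /= vwE // /vcoord /=.
have [dc|_] := boolP (same d c).
  rewrite !(same_l _ dc) same_tnext same_tnext2 mul1r !mul0r !addr0 => ab1.
  by exists c, (a, b); split=> //; split=> //=; lra.
have [dc|_] := boolP (same d (tnext c)).
  have -> : same d (tnext (tnext c)) = false by rewrite (same_l _ dc) same_tnext.
  rewrite mul1r !mul0r add0r addr0 => ab1; exists (tnext c), (b, 1 - a - b).
  split => //; first by split => /=; lra.
  rewrite tri_tnext; last by split => /=; lra.
  by congr (tri c (_, _)) => //=; ring.
have [dc|_] := boolP (same d (tnext (tnext c))).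
  rewrite mul1r !mul0r !add0r => ab1; exists (tnext (tnext c)), (1 - a - b, a).
  split => //; first by split => /=; lra.
  do 2 (rewrite tri_tnext; last by split => /=; lra).
  by congr (tri c (_, _)) => //=; ring.
by rewrite !mul0r !addr0 ltxx.
Qed.

(** * Charts on the open stars of the vertices *)

Section StarChart.
Variable d : C.
Let n := fingraph.order (@vnext C) d.
Let corner i := iter i (@vnext C) d.

Lemma star_degree_gt0 : (0 < n)%N. Proof. exact: fingraph.order_gt0. Qed.

Lemma same_corner i : same d (corner i).
Proof. exact: fconnect_iter. Qed.

Lemma corner_mod i : corner (i %% n)%N = corner i.
Proof.
rewrite /corner [in RHS](divn_eq i n) addnC iterD; congr iter.
elim: (i %/ n)%N => [|k IH] //; rewrite mulSn addnC iterD.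
by rewrite (iter_order vnext_inj).
Qed.

Lemma cornerS i : corner (i.+1 %% n)%N = vnext (corner i).
Proof. by rewrite corner_mod /corner iterS. Qed.

Lemma corner_inj i j : (i < n)%N -> (j < n)%N -> corner i = corner j -> i = j.
Proof.
move=> iln jln E.
by rewrite -(findex_iter iln) -(findex_iter jln) -/(corner i) E.
Qed.

Lemma corner_surj c : same d c -> exists i : 'I_n, c = corner i.
Proof.
move=> dc; exists (Ordinal (findex_max dc)).
by rewrite /corner /= iter_findex.
Qed.

Variable g : nat -> R * R -> R * R.
Hypothesis hg : planar_star n g.

(** A relation and not a function, because a point on a side has two representations [(i, z)], and
    the centre has [n] of them. It is single-valued in both directions since [star_inj] and [ps_inj]
    list the same coincidences. *)
Definition star_rel (p : surf) (x : R * R) : Prop :=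
  exists (i : 'I_n) z, [/\ osimplex 1 z, p = tri (corner i) z & x = g i z].

Definition star_map p : R * R := xget (0, 0) [set x | star_rel p x].
Definition star_inv x : surf := xget pt0 [set p | star_rel p x].

Definition planar_disc e : set (R * R) :=
  [set x | exists (i : 'I_n) z, osimplex e z /\ x = g i z].

Lemma tri_corner0 i j : tri (corner i) (0, 0) = tri (corner j) (0, 0).
Proof.
have H k : tri (corner k) (0, 0) = tri d (0, 0).
  by elim: k => [|k IH] //; rewrite -IH [RHS]tri_glue ?lexx ?ler01.
by rewrite !H.
Qed.

Lemma star_rel_fun p x y : star_rel p x -> star_rel p y -> x = y.
Proof.
move=> [i [[a b] [oz -> ->]]] [j [[a' b'] [oz' E ->]]].
have ss : same (corner i) (corner j).
  by rewrite -(same_l _ (same_corner i)) same_corner.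
case: (oz) (oz') => /= a0 b0 _ [/= a0' b0' _].
case: (star_inj ss oz oz' E) =>
  [[ij -> ->]|[-> -> -> ->]|[ij -> -> ->]|[ij -> -> ->]].
- by rewrite (corner_inj (ltn_ord i) (ltn_ord j) ij).
- exact: ps_apex hg _ _.
- rewrite -cornerS in ij; rewrite (ps_glue hg) // -?ab.
  by rewrite -(corner_inj (ltn_ord j) _ ij) // ltn_mod star_degree_gt0.
- rewrite -cornerS in ij; rewrite [RHS](ps_glue hg) //.
  by rewrite -(corner_inj (ltn_ord i) _ ij) // ltn_mod star_degree_gt0.
Qed.

(** This direction holds on the closed simplices, and the closed disc of a face needs it there. The
    converse holds only on the open star, whose closure may touch itself along its boundary. *)
Lemma planar_tri i j z z' : (i < n)%N -> (j < n)%N -> simplex 1 z -> simplex 1 z' ->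
  g i z = g j z' -> tri (corner i) z = tri (corner j) z'.
Proof.
case: z z' => [a b] [a' b'] iln jln [/= a0 b0 ab] [/= a0' b0' ab'].
move=> /(ps_inj hg iln jln a0 b0 a0' b0').
case=> [[-> -> ->]|[-> -> -> ->]|[-> a_0 b_0 bE]|[-> a_0 b_0 bE]] //.
- exact: tri_corner0.
- by rewrite cornerS a_0 b_0 bE tri_glue //; lra.
- by rewrite cornerS a_0 b_0 bE [RHS]tri_glue //; lra.
Qed.

Lemma star_rel_inj p q x : star_rel p x -> star_rel q x -> p = q.
Proof.
move=> [i [z [oz -> ->]]] [j [z' [oz' -> E]]].
by apply: planar_tri E => //; exact: osimplexW.
Qed.

Lemma star_mapE p x : star_rel p x -> star_map p = x.
Proof.
move=> px; apply: xget_unique => // y py; exact: star_rel_fun py px.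
Qed.

Lemma star_invE p x : star_rel p x -> star_inv x = p.
Proof.
move=> px; apply: xget_unique => // q qx; exact: star_rel_inj qx px.
Qed.

Lemma star_relP p : star d p -> star_rel p (star_map p).
Proof.
move=> /starP[c [z [dc oz pE]]]; have [i iE] := corner_surj dc.
have px : star_rel p (g i z) by exists i, z; rewrite -iE.
by rewrite (star_mapE px).
Qed.

Lemma planar_discP x : planar_disc 1 x -> star_rel (star_inv x) x.
Proof.
move=> [i [z [oz xE]]]; have px : star_rel (tri (corner i) z) x by exists i, z.
by rewrite (star_invE px).
Qed.

Lemma star_rel_star p x : star_rel p x -> star d p /\ planar_disc 1 x.
Proof.
move=> [i [z [oz -> ->]]]; split; last by exists i, z.
by apply/starP; exists (corner i), z; split => //; exact: same_corner.
Qed.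

Lemma osimplex1 e z : e < 1 -> simplex e z -> osimplex 1 z.
Proof. by move=> e1 [z1 z2 z3]; split=> //; exact: le_lt_trans e1. Qed.

Lemma star_map_continuous : {within star d, continuous star_map}.
Proof.
apply: within_continuous_local => p dp.
(* Where the vertex coordinate exceeds [e], the star is covered by the compact pieces
   [simplex (1 - e)], which avoid its boundary. *)
pose e := vw d p / 2; have e0 : 0 < e by rewrite divr_gt0.
exists [set q | e < vw d q]; split.
- by apply: open_superlevel; exact: vw_continuous.
- by rewrite /= /e ltr_pdivrMr // ltr_pMr // ltr1n.
have e1 : 1 - e < 1 by rewrite gtrBl.
apply: (@continuous_subspaceW _ _ _
  (\bigcup_(i : 'I_n) (tri (corner i) @` simplex (1 - e)))).
  move=> q [/= eq /star_relP[i [z [oz qE _]]]]; exists i => //; exists z => //.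
  move: eq; rewrite qE vw_apex; first by case: oz => *; split=> //; lra.
    exact: same_corner.
  exact: osimplexW.
have sub : simplex (1 - e) `<=` simplex 1 by apply: simplex_le; lra.
apply: glue_continuous.
- exact: surf_hausdorff.
- by move=> i; exact: simplex_compact.
- by move=> i; apply: continuous_subspaceW (@tri_continuous _).
- move=> i; apply: (@subspace_eq_continuous _ _ _ (g i)).
    move=> z /set_mem sz; apply/esym/star_mapE.
    by exists i, z; split=> //; exact: osimplex1 sz.
  by apply: continuous_subspaceT; exact: ps_cont hg i.
Qed.

Lemma planar_disc_open e : 0 < e -> open (planar_disc e).
Proof. exact: ps_open hg e. Qed.

Lemma star_inv_continuous : {within planar_disc 1, continuous star_inv}.
Proof.
apply: within_continuous_local => x [i0 [z0 [oz0 xE]]].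
(* Midway between the level of [x] and 1: the same shrinking, on the plane side. *)
pose e := (1 + (z0.1 + z0.2)) / 2.
have [z01 z02 z03] := oz0.
have e0 : 0 < e by rewrite /e; lra.
have e1 : e < 1 by rewrite /e; lra.
exists (planar_disc e); split.
- exact: planar_disc_open.
- by exists i0, z0; split=> //; split=> //; rewrite /e; lra.
apply: (@continuous_subspaceW _ _ _ (\bigcup_(i : 'I_n) (g i @` simplex e))).
  by move=> y [[i [z [oz ->]]] _]; exists i => //; exists z => //; exact: osimplexW.
have sub : simplex e `<=` simplex 1 by apply: simplex_le; lra.
apply: glue_continuous.
- exact: norm_hausdorff.
- by move=> i; exact: simplex_compact.
- by move=> i; apply: continuous_subspaceT; exact: ps_cont hg i.
- move=> i; apply: (@subspace_eq_continuous _ _ _ (tri (corner i))).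
    move=> z /set_mem sz; apply/esym/star_invE.
    by exists i, z; split=> //; exact: osimplex1 sz.
  exact: continuous_subspaceW (@tri_continuous _).
Qed.

Lemma star_homeomorphism :
  homeomorphism (star d) (planar_disc 1) star_map star_inv.
Proof.
split.
- exact: star_map_continuous.
- exact: star_inv_continuous.
- move=> p /star_relP px; split; first by case: (star_rel_star px).
  exact: star_invE px.
- move=> x /planar_discP px; split; first by case: (star_rel_star px).
  exact: star_mapE px.
Qed.

Lemma star_map_image : star_map @` star d = planar_disc 1.
Proof.
rewrite eqEsubset; split => x.
  by move=> [p /star_relP px <-]; case: (star_rel_star px).
by move=> /planar_discP px; exists (star_inv x);
  [case: (star_rel_star px)|exact: star_mapE px].
Qed.

Definition star_chart : chart R surf := Chart (star d) star_map star_inv.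

Lemma star_is_chart : is_chart star_chart.
Proof.
split => /=; rewrite ?star_map_image; first exact: star_open.
  by apply: planar_disc_open; exact: ltr01.
exact: star_homeomorphism.
Qed.

End StarChart.
End Triangulation.

(** * Connectedness and orientability of the surface *)

Section SurfaceTheory.
Variables (R : realType) (C : triangulation).
Implicit Types (c d e : C) (a b : R) (z : R * R) (p : surf R C).

Lemma ray_connected c z : simplex 1 z ->
  connected [set tri c (s * z.1, s * z.2) | s in `[0 : R, 1]].
Proof.
move=> [z1 z2 z3]; apply: connected_continuous_connected.
  exact: segment_connected.
have sf s : 0 <= s <= 1 -> simplex 1 (s * z.1, s * z.2).
  move=> /andP[s0 s1]; split; rewrite /= ?mulr_ge0 // -mulrDr.
  by apply: le_trans z3; rewrite ler_piMl // addr_ge0.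
apply: (@surf_continuous R C R _ _ (fun s => coord c (s * z.1, s * z.2))); last first.
  by move=> s /=; rewrite in_itv /= => /sf sz; exact: triE.
move=> [d i].
have c1 : continuous (fun s : R => s * z.1).
  by move=> s; apply: cvgM; [exact: cvg_id|exact: cvg_cst].
have c2 : continuous (fun s : R => s * z.2).
  by move=> s; apply: cvgM; [exact: cvg_id|exact: cvg_cst].
have co : continuous (fun s : R => 1 - s * z.1 - s * z.2).
  by move=> s; apply: cvgB; [apply: cvgB; [exact: cvg_cst|exact: c1]|exact: c2].
rewrite /coord /=; case: (val i) => [|[|_]] s.
- by apply: cvgD; [apply: cvgD|]; apply: cvgM; try exact: cvg_cst;
    [exact: co|exact: c1|exact: c2].
- by apply: cvgD; [apply: cvgD|]; apply: cvgM; try exact: cvg_cst; apply: cvgM;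
    [exact: co|exact: c1|exact: c1|exact: c2|exact: c2|exact: co].
- apply: cvgM; first exact: cvg_cst.
  by apply: cvgM; [apply: cvgM; [exact: co|exact: c1]|exact: c2].
Qed.

Lemma ray_ends c z : let r := [set tri c (s * z.1, s * z.2) | s in `[0 : R, 1]] in
  r (tri c (0, 0)) /\ r (tri c z).
Proof.
split; first by exists 0; rewrite ?mul0r //= in_itv /= lexx ler01.
by exists 1; rewrite ?mul1r -?surjective_pairing //= in_itv /= lexx ler01.
Qed.

(** Every point of a triangle is joined to its corner by a segment, and the darts whose corner lies
    in the component of the base point are stable under [tnext] and [topp], so [tconn] reaches all
    of them. *)
Lemma surf_connected : connected [set: surf R C].
Proof.
pose K c := connected_component [set: surf R C] (tri c (0, 0)).
have path c z : simplex 1 z -> K c (tri c z).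
  move=> sz; have [r0 r1] := ray_ends c z.
  by apply: connected_component_max r1 => //; exact: ray_connected.
have s00 : simplex 1 (0 : R, 0 : R) by split=> //=; rewrite addr0.
have KE c : K c (tri tbase (0, 0)).
  pose P c := `[< K tbase (tri c (0, 0)) >].
  have Pn x : P x -> P (tnext x).
    move=> /asboolP Px; apply/asboolP; apply: connected_component_trans Px _.
    rewrite tri_tnext // subr0 subr0; apply: path.
    by split => /=; lra.
  have Po x : P x -> P (topp x).
    move=> /asboolP Px; apply/asboolP; apply: connected_component_trans Px _.
    rewrite -vnext_tnext -tri_glue ?lexx ?ler01 //.
    rewrite tri_tnext // subr0 subr0; apply: path.
    by split => /=; lra.
  apply: connected_component_sym; apply/asboolP.
  apply: (@tconn C P Pn Po tbase); apply/asboolP.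
  exact: connected_component_refl.
suff -> : [set: surf R C] = K tbase by exact: component_connected.
rewrite eqEsubset; split=> // p _; have [c [z [sz ->]]] := tri_surj p.
apply: connected_component_trans (path _ _ sz).
by apply: connected_component_sym; exact: KE.
Qed.

Lemma star_cover p : exists d, star d p.
Proof.
have [c [[a b] [sz ->]]] := tri_surj p; case: (sz) => /= a0 b0 ab.
have [c0|c0] := ltrP 0 (1 - a - b).
  by exists c; apply/starP; exists c, (a, b); split; [exact: same_refl|split=> //=;
    lra|].
have [c1|c1] := ltrP 0 a.
  exists (tnext c); apply/starP; exists (tnext c), (b, 1 - a - b).
  split; [exact: same_refl|by split => /=; lra|].
  rewrite tri_tnext; last by split => /=; lra.
  by congr (tri c (_, _)); ring.
exists (tnext (tnext c)); apply/starP; exists (tnext (tnext c)), (1 - a - b, a).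
split; [exact: same_refl|by split => /=; lra|].
do 2 (rewrite tri_tnext; last by split => /=; lra).
by congr (tri c (_, _)); ring.
Qed.

Definition degree d := fingraph.order (@vnext C) d.
Definition fans n i z : R * R := fan n i z.1 z.2.
Definition fan_chart d := star_chart d (fans (degree d)).

Lemma fans_star d : planar_star (degree d) (fans (degree d)).
Proof. exact/fan_planar_star/tdegree. Qed.

Lemma surf_surface : surface R (surf R C).
Proof.
split.
- exact: surf_hausdorff.
- exact: surf_compact.
- exact: surf_connected.
- move=> p; have [d dp] := star_cover p.
  exists (fan_chart d) => //; exact/star_is_chart/fans_star.
Qed.

Lemma star_connected d : connected (@star R C d).
Proof.
pose P (cz : C * (R * R)) := same d cz.1 /\ osimplex 1 cz.2.
pose ray (cz : C * (R * R)) :=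
  [set tri cz.1 (s * cz.2.1, s * cz.2.2) | s in `[0 : R, 1]].
have -> : star d = \bigcup_(cz in P) ray cz.
  rewrite eqEsubset; split => p.
    move=> /starP[c [z [dc oz ->]]]; exists (c, z) => //.
    by have [] := ray_ends c z.
  move=> [[c z] [/= dc [z1 z2 z3]] [s /=]]; rewrite in_itv /= => /andP[s0 s1] <-.
  apply/starP; exists c, (s * z.1, s * z.2); split => //.
  split; rewrite /= ?mulr_ge0 // -mulrDr.
  by apply: le_lt_trans z3; rewrite ler_piMl // addr_ge0.
have apex c : same d c -> tri c (0, 0) = tri d (0, 0) :> surf R C.
  by move=> /corner_surj[i ->]; exact: (tri_corner0 _ _ i 0).
apply: bigcup_connected.
  exists (tri d (0, 0)) => -[c z] [/= dc _]; rewrite -(apex _ dc).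
  by have [] := ray_ends c z.
by move=> [c z] [_ oz]; apply: ray_connected; exact: osimplexW.
Qed.

Definition vprev c : C := tnext (topp c).

Lemma vprevK c : vnext (vprev c) = c.
Proof. by rewrite /vnext /vprev tnext3 toppK. Qed.

Lemma vnextK c : vprev (vnext c) = c.
Proof. by rewrite /vnext /vprev toppK tnext3. Qed.

(* The two triangles along the side of [c], in coordinates [a] along the side
   and [b] across it. *)
Definition diamond c a b : surf R C :=
  if 0 <= b then tri c (a, b) else tri (vprev c) (- b, a).

Lemma diamond_neg c a b : b <= 0 -> 0 <= a -> a - b <= 1 ->
  diamond c a b = tri (vprev c) (- b, a).
Proof.
move=> b0 a0 ab; rewrite /diamond; case: ifP => // b0'.
have -> : b = 0 by lra.
by rewrite oppr0 tri_glue ?vprevK //; lra.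
Qed.

(** From the other end the side is run backwards: left and right are exchanged, whence [- b], and
    the weight at [tnext c] is replaced by the weight at [c], which is [1 - a - |b|]. *)
Lemma diamond_topp c a b : 0 <= a -> a + `|b| <= 1 ->
  diamond (topp c) (1 - a - `|b|) (- b) = diamond c a b.
Proof.
move=> a0; have [b0|b0] := leP 0 b.
  rewrite (ger0_norm b0) => ab; rewrite diamond_neg; [|lra|lra|lra].
  rewrite opprK /vprev toppK tri_tnext; last by split => /=; lra.
  by rewrite /diamond b0; congr (tri c (_, _)); ring.
rewrite (ltr0_norm b0) => ab; rewrite [RHS]diamond_neg; [|lra|lra|lra].
rewrite /diamond ifT; last by lra.
rewrite /vprev tri_tnext; last by split => /=; lra.
by congr (tri _ (_, _)); ring.
Qed.

(** With [ew_diamond_gt0], this makes the two triangles along a side, without their outer sides, the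
    positivity set of one continuous coordinate, hence open. *)
Lemma ew_diamond c p : 0 < ew c p ->
  exists a b, [/\ 0 < a, a + `|b| < 1 & p = diamond c a b].
Proof.
suff H c' z : simplex 1 z -> 0 < (side c c')%:R * ((1 - z.1 - z.2) * z.1) ->
    exists a b, [/\ 0 < a, a + `|b| < 1 & tri c' z = diamond c a b].
  have [c' [[a b] [sz ->]]] := tri_surj p; case: (sz) => /= a0 b0 ab.
  rewrite ewE // /ecoord /=.
  have [h _|h] := ltrP 0 ((side c c')%:R * ((1 - a - b) * a)).
    exact: (H c' (a, b)).
  have [h' _|h'] := ltrP 0 ((side c (tnext c'))%:R * (a * b)).
    have [||x [y [x0 xy E]]] := H (tnext c') (b, 1 - a - b).
    - by split => /=; lra.
    - by rewrite /= (_ : 1 - b - (1 - a - b) = a) //; ring.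
    exists x, y; split=> //; rewrite -E tri_tnext; last by split => /=; lra.
    by congr (tri c' (_, _)); ring.
  move=> h'';
    have {}h'' : 0 < (side c (tnext (tnext c')))%:R * (b * (1 - a - b)) by lra.
  have [||x [y [x0 xy E]]] := H (tnext (tnext c')) (1 - a - b, a).
  - by split => /=; lra.
  - by rewrite /= (_ : 1 - (1 - a - b) - a = b) //; ring.
  exists x, y; split=> //; rewrite -E.
  do 2 (rewrite tri_tnext; last by split => /=; lra).
  by congr (tri c' (_, _)); ring.
case: z => a b [/= a0 b0 ab]; rewrite /side.
have [->|_] := eqVneq c c'.
  rewrite mul1r => h; have {}h : 0 < (1 - a - b) /\ 0 < a by split; nra.
  by exists a, b; rewrite ger0_norm // /diamond b0; split=> //; lra.
have [<-|_] := eqVneq (topp c) c'; last by rewrite mul0r ltxx.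
rewrite mul1r => h; have {}h : 0 < (1 - a - b) /\ 0 < a by split; nra.
exists (1 - a - b), (- b); rewrite normrN ger0_norm //; split; [lra|lra|].
have -> : tri (topp c) (a, b) = diamond (topp c) a b by rewrite /diamond b0.
by have := @diamond_topp (topp c) a b a0; rewrite toppK ger0_norm // => ->.
Qed.

Lemma ew_diamond_gt0 c a b : 0 < a -> a + `|b| < 1 -> 0 < ew c (diamond c a b).
Proof.
have H c' a' b' : side c c' -> 0 < a' -> 0 <= b' -> a' + b' < 1 ->
    0 < ew c (tri c' (a', b')).
  move=> cc' a0 b0 ab; rewrite ewE /ecoord; last by split => /=; lra.
  rewrite cc' /= mul1r -addrA ltr_pwDl ?addr_ge0 ?mulr_ge0 ?ler0n ?mulr_gt0 //; lra.
move=> a0; have [b0|b0] := leP 0 b.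
  rewrite (ger0_norm b0) /diamond b0 => ab.
  by apply: H => //; rewrite /side eqxx.
move=> ab; rewrite -diamond_topp ?(ltW a0) ?(ltW ab) //.
move: ab; rewrite (ltr0_norm b0) => ab.
rewrite /diamond ifT; last by lra.
by apply: H; rewrite ?/side ?eqxx ?orbT //; lra.
Qed.

Lemma star_same d e : same d e -> @star R C d = star e.
Proof.
move=> de; rewrite eqEsubset; split => p /starP[c [z [dc oz ->]]];
  apply/starP; exists c, z; split => //.
  by rewrite -(same_l _ de).
by rewrite (same_l _ de).
Qed.

(** Two vertices may be joined by several sides, so [c] depends on the point [p]; orientation is
    therefore compared near [p] and not on the whole intersection of the stars. *)
Lemma diamond_cover d e p : ~~ same d e -> star d p -> star e p ->
  exists c a b, [/\ same d c, same e (topp c), 0 < a, a + `|b| < 1 &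
    p = diamond c a b].
Proof.
move=> nde /starP[c [[a b] [dc oz ->]]]; have sz := osimplexW oz.
case: oz => /= a0 b0 ab; rewrite /star /= vwE // /vcoord /=.
have -> : same e c = false.
  by apply/negbTE; apply: contra nde => ec; rewrite (same_l _ dc) same_sym.
rewrite mul0r add0r.
have [ec|_] := boolP (same e (tnext c)).
  have -> : same e (tnext (tnext c)) = false by rewrite (same_l _ ec) same_tnext.
  rewrite mul1r mul0r addr0 => a0'.
  exists c, a, b; split => //; last by rewrite /diamond b0.
    by rewrite (same_l _ ec) -vnext_tnext same_vnext.
  by rewrite ger0_norm.
rewrite mul0r add0r; have [ec|_] := boolP (same e (tnext (tnext c))); last first.
  by rewrite mul0r ltxx.
rewrite mul1r => b0'; exists (vnext c), b, (- a); split => //.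
- by rewrite -(same_r _ (same_vnext c)).
- by rewrite /vnext toppK.
- by rewrite normrN ger0_norm // addrC.
- by rewrite diamond_neg ?vnextK ?opprK //; lra.
Qed.

(** The unit vector [u] is the image of the side. The neighbouring rays make the angles plus and
    minus one step with it, so the distance to the line of [u] depends on [b] alone, and for fixed
    [b] the position along [u] is [a] up to a constant. *)
Lemma fan_chart_diamond d c : same d c -> exists mu, forall a b,
  0 < a -> a + `|b| < 1 ->
  let u := (cos mu, sin mu) in
  let x := chart_map (fan_chart d) (diamond c a b) in
  cross u x = b * sin (step R (degree d)) /\
  dot u x = a + `|b| * cos (step R (degree d)).
Proof.
move=> dc; have n0 : (0 < degree d)%N by exact: fingraph.order_gt0.
have [i iE] := corner_surj dc; set n := degree d in n0 i iE *.
exists (angle R n i) => a b a0 ab u x.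
have cu := cos2Dsin2 (angle R n i).
have uu : cross u u = 0 by rewrite /cross /u /=; ring.
have dd : dot u u = 1 by rewrite /dot /u /= -!expr2.
suff [y [yc yd xE]] : exists y : R * R,
    [/\ cross u y = sin (step R n) * b, dot u y = cos (step R n) * `|b| &
     x = (a * u.1 + y.1, a * u.2 + y.2)].
  split.
    have -> : cross u x = a * cross u u + cross u y by rewrite xE /cross /=; ring.
    by rewrite uu mulr0 add0r yc mulrC.
  have -> : dot u x = a * dot u u + dot u y by rewrite xE /dot /=; ring.
  by rewrite dd mulr1 yd mulrC.
rewrite {}/x /diamond; have [b0|b0] := leP 0 b.
  exists (b * cos (angle R n i.+1), b * sin (angle R n i.+1)).
  rewrite (ger0_norm b0) angleS cosD sinD /cross /dot /u /=; split.
  - rewrite -[RHS]mulr1 -cu; ring.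
  - rewrite -[RHS]mulr1 -cu; ring.
  rewrite (@star_mapE _ _ d _ (fans_star d) _ (fans n i (a, b))).
    by rewrite /fans /fan /= angleS cosD sinD.
  exists i, (a, b); rewrite -/n iE; split => //; split => //=; first exact: ltW.
  by move: ab; rewrite ger0_norm.
have cv : same c (vprev c) by rewrite -{1}(vprevK c) same_sym same_vnext.
have [j jE] := corner_surj (same_trans dc cv); rewrite -/n in j jE.
have ij : i = (j.+1 %% n)%N :> nat.
  apply: (@corner_inj _ d _ _ (ltn_ord i) (ltn_pmod _ n0)).
  by rewrite cornerS -jE -iE vprevK.
have uE : u = (cos (angle R n j + step R n), sin (angle R n j + step R n)).
  by rewrite /u ij cos_angle_mod // sin_angle_mod // angleS.
exists (- b * cos (angle R n j), - b * sin (angle R n j)).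
have cj := cos2Dsin2 (angle R n j).
rewrite ltr0_norm // uE [cos (_ + _)]cosD [sin (_ + _)]sinD /cross /dot /=; split.
- rewrite -[RHS]mulr1 -cj; ring.
- rewrite -[RHS]mulr1 -cj; ring.
rewrite (@star_mapE _ _ d _ (fans_star d) _ (fans n j (- b, a))).
  by rewrite /fans /fan /= angleS cosD sinD; congr pair; ring.
exists j, (- b, a); rewrite -/n jE; split => //.
by move: ab; rewrite ltr0_norm // => ab; split => /=; lra.
Qed.

Definition fan_atlas : set (chart R (surf R C)) :=
  [set c | exists d, c = fan_chart (froot (@vnext C) d)].

Lemma fan_chart_homeo d :
  homeomorphism (star d) (planar_disc d (fans (degree d)) 1)
    (chart_map (fan_chart d)) (chart_inv (fan_chart d)).
Proof. exact/star_homeomorphism/fans_star. Qed.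

(* One chart per vertex: charts at different darts of a vertex differ by a
   rotation, hence the choice of the canonical dart [froot]. *)
Lemma surf_orientable : orientable R (surf R C).
Proof.
exists fan_atlas; split.
- move=> _ [d ->]; exact/star_is_chart/fans_star.
- move=> p; have [d dp] := star_cover p.
  exists (fan_chart (froot (@vnext C) d)); first by exists d.
  by rewrite /= -(star_same (connect_root _ d)).
move=> _ _ [d' ->] [e' ->]; set d := froot _ d'; set e := froot _ e'.
move=> p dp ep; rewrite /= in dp ep.
have [cd cdi dK dK'] := fan_chart_homeo d.
have [ce cei eK eK'] := fan_chart_homeo e.
have oD : open (planar_disc d (fans (degree d)) 1).
  by apply: planar_disc_open (fans_star d) _ _; exact: ltr01.
have cI : {in planar_disc d (fans (degree d)) 1, continuous (chart_inv (fan_chart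
  d))}.
  by rewrite -continuous_open_subspace.
have [de|nde] := boolP (same d e).
  have dE : d = e.
    have /(fingraph.rootP (fconnect_sym (@vnext_inj C))) := de.
    by rewrite /d /e !(root_root (fconnect_sym (@vnext_inj C))).
  rewrite -{}dE {e e' ep ce cei eK eK' de}.
  apply: (@flag_orientation _ _ _ _ 0 0 oD).
  - by have [] := dK _ dp.
  - apply: (@subspace_eq_continuous _ (planar_disc d (fans (degree d)) 1) _
      (fun x : R * R => x : R * R)).
      by move=> x /set_mem Dx; have [_ xK] := dK' _ Dx; exact/esym.
    by apply: continuous_subspaceT => x; exact: cvg_id.
  move=> q Dq qp; have [Dp pK] := dK _ dp.
  have I y : planar_disc d (fans (degree d)) 1 y ->
      (chart_map (fan_chart d) \o chart_inv (fan_chart d)) y = y.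
    by move=> /dK'[].
  rewrite !I //; set x := chart_map _ p in qp *.
  rewrite /cross /dot cos0 sin0 !mul1r !mul0r !subr0 !addr0.
  have [h|h|h] := ltrgtP 0 ((q - x).2); [by constructor 1|by constructor 2|].
  have [h'|h'|h'] := ltrgtP 0 ((q - x).1); [by constructor 3|by constructor 4|].
  by case/eqP: qp; apply/eqP; rewrite -subr_eq0; apply/eqP;
    rewrite [LHS]surjective_pairing -h -h'.
have [c [a0 [b0 [dc ec a0p ab0 pE]]]] := diamond_cover nde dp ep.
(* On the diamond around [p] both charts are described by the same pair [(a, b)]. *)
pose O := star e `&` [set q : surf R C | 0 < ew c q].
have oO : open O.
  by apply: openI; [exact: star_open|apply: open_superlevel; exact: ew_continuous].
pose U := planar_disc d (fans (degree d)) 1 `&` chart_inv (fan_chart d) @^-1` O.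
have oU : open U by move/(continuous_inP _ oD): cI; exact.
have [mu Hmu] := fan_chart_diamond dc; have [nu Hnu] := fan_chart_diamond ec.
have Uq q : U q -> exists a b, [/\ 0 < a, a + `|b| < 1,
    chart_inv (fan_chart d) q = diamond c a b &
    q = chart_map (fan_chart d) (diamond c a b)].
  move=> [Dq [eq /ew_diamond[a [b [a0' ab' qE]]]]]; exists a, b; split => //.
  by rewrite -qE; have [] := dK' _ Dq.
have Up : U (chart_map (fan_chart d) p).
  have [Dp pK] := dK _ dp; split => //.
  suff : O (chart_inv (fan_chart d) (chart_map (fan_chart d) p)) by [].
  by rewrite pK; split => //=; rewrite pE; exact: ew_diamond_gt0.
(* In the chart of [e] the angle [nu] points along the side from [e] back to [d]; adding [pi]
   restores the direction from [d] to [e]. *)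
apply: (@flag_orientation _ _ _ _ mu (nu + pi) oU Up).
  apply: within_continuous_comp; last first.
    by apply: continuous_subspaceW cdi => x [].
  move: ce; rewrite continuous_open_subspace; last exact: star_open.
  by move=> ce x /set_mem[y [_ [ey _]] <-]; apply: ce; rewrite inE.
move=> q Uqq qp; have [a [b [a0' ab' qE qE']]] := Uq _ Uqq.
have [_ pK] := dK _ dp.
have sd := sin_step_gt0 R (tdegree d); have se := sin_step_gt0 R (tdegree e).
set f := (_ \o _); set x := chart_map _ p in qp *.
have -> : f q = chart_map (fan_chart e) (diamond c a b) by rewrite -qE.
have -> : f x = chart_map (fan_chart e) p by rewrite -[in RHS]pK.
have [q1 q2] := Hmu _ _ a0' ab'; have [x1 x2] := Hmu _ _ a0p ab0.
rewrite -qE' in q1 q2; rewrite -pE -/x in x1 x2.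
have H a' b' : 0 < a' -> a' + `|b'| < 1 -> 0 < 1 - a' - `|b'| /\
    1 - a' - `|b'| + `|- b'| < 1 by rewrite normrN => *; split; lra.
have [fq1 fq2] := Hnu _ _ (H _ _ a0' ab').1 (H _ _ a0' ab').2.
have [fx1 fx2] := Hnu _ _ (H _ _ a0p ab0).1 (H _ _ a0p ab0).2.
rewrite diamond_topp ?(ltW a0') ?(ltW ab') // in fq1 fq2.
rewrite diamond_topp ?(ltW a0p) ?(ltW ab0) // -pE in fx1 fx2.
rewrite !normrN in fq2 fx2.
set y := chart_map (fan_chart e) _ in fq1 fq2 *.
set y0 := chart_map (fan_chart e) _ in fx1 fx2 *.
set u := (_, _) in q1 q2 x1 x2 *; set v := (cos nu, sin nu) in fq1 fq2 fx1 fx2.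
set w := (_, _).
have cu : cross u (q - x) = (b - b0) * sin (step R (degree d)).
  rewrite mulrBl -q1 -x1 /cross /=; ring.
have du : dot u (q - x) =
    (a - a0) + (`|b| - `|b0|) * cos (step R (degree d)).
  rewrite -[LHS]/(u.1 * (q.1 - x.1) + u.2 * (q.2 - x.2)).
  move: q2 x2; rewrite /dot => q2 x2; lra.
have wE : w = (- v.1, - v.2) by rewrite /w cosDpi sinDpi.
have cw : cross w (y - y0) = (b - b0) * sin (step R (degree e)).
  rewrite wE -[LHS]/(- v.1 * (y.2 - y0.2) - (- v.2) * (y.1 - y0.1)).
  move: fq1 fx1; rewrite /cross => fq1 fx1; lra.
have dw : dot w (y - y0) =
    (a - a0) + (`|b| - `|b0|) * (1 - cos (step R (degree e))).
  rewrite wE -[LHS]/(- v.1 * (y.1 - y0.1) + (- v.2) * (y.2 - y0.2)).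
  move: fq2 fx2; rewrite /dot => fq2 fx2; lra.
(* The transverse coordinate [b] decides the side of the line in both charts. On the line itself the
   terms in [|b|] cancel, and [a] decides the direction. *)
rewrite cu cw du dw; have [bb|bb|bb] := ltrgtP b b0.
- by constructor 2; rewrite !nmulr_rlt0 ?subr_lt0.
- by constructor 1; rewrite !mulr_gt0 ?subr_gt0.
rewrite bb !subrr !mul0r !addr0; have [aa|aa|aa] := ltrgtP a a0.
- by constructor 4; rewrite subr_lt0.
- by constructor 3; rewrite subr_gt0.
by case/eqP: qp; rewrite qE' /x pE bb aa.
Qed.

End SurfaceTheory.

(** * Embeddings from rotation systems *)

(* A rotation system for a simple graph: [face_next] sends a dart to the following
   one on the face to its left, and the faces are 2-coloured. *)
Record scheme (N : nat) (adj : rel 'I_N) := Scheme {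
  sdart :> finType;
  src : sdart -> 'I_N;
  flip : sdart -> sdart;
  face_next : sdart -> sdart;
  colour : sdart -> bool;
  flipK : involutive flip;
  face_next_inj : injective face_next;
  src_next : forall d, src (face_next d) = src (flip d);
  dart_adj : forall d, adj (src d) (src (flip d));
  dart_inj : forall d e, src d = src e -> src (flip d) = src (flip e) -> d = e;
  dart_ex : forall x y, adj x y -> exists2 d, src d = x & src (flip d) = y;
  src_surj : forall x, exists d, src d = x;
  src_flip : forall d, src d != src (flip d);
  rotation_transitive : forall d e, src d = src e ->
    fconnect (face_next \o flip) d e;
  face_size : forall d, (3 <= fingraph.order face_next d)%N;
  vertex_degree : forall d, face_next (flip d) != d;
  colour_next : forall d, colour (face_next d) = colour d;
  colour_flip : forall d, colour (flip d) = ~~ colour d;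
  scheme_connected : forall P : pred 'I_N,
    (forall d, P (src d) -> P (src (flip d))) -> forall x y, P x -> P y;
  sbase : sdart }.

(** * The triangulation of a rotation system *)

Section SchemeTriangulation.
Variables (N : nat) (adj : rel 'I_N) (D : scheme adj).
Implicit Types (d e : D).

(* Each dart [d] spans a triangle with corners [(d, None)] at its source,
   [(d, Some false)] at its target and [(d, Some true)] at the centre of the face
   to its left. *)
Definition flag : finType := (D * option bool)%type.

Definition flag_next (c : flag) : flag :=
  match c.2 with
  | None => (c.1, Some false) | Some false => (c.1, Some true)
  | Some true => (c.1, None) end.

Definition flag_opp (c : flag) : flag :=
  match c.2 with
  | None => (flip c.1, None) | Some false => (face_next c.1, Some true)
  | Some true => (finv (@face_next _ _ D) c.1, Some false) end.

Definition flag_vnext (c : flag) : flag := flag_opp (flag_next (flag_next c)).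

(** Invariant under turning around a corner. It separates the three corners of a triangle, but gives
    the same value to all face centres. *)
Definition flag_vertex (c : flag) : option 'I_N :=
  match c.2 with
  | None => Some (src c.1) | Some false => Some (src (flip c.1))
  | Some true => None end.

Lemma flag_next3 c : flag_next (flag_next (flag_next c)) = c.
Proof. by case: c => d [[]|]. Qed.

Lemma flag_oppK : involutive flag_opp.
Proof.
case=> d [[]|]; rewrite /flag_opp /= ?flipK //.
  by rewrite f_finv //; exact: face_next_inj.
by rewrite finv_f //; exact: face_next_inj.
Qed.

Lemma flag_vnext_inj : injective flag_vnext.
Proof.
by move=> c c' /(congr1 (flag_next \o flag_opp)); rewrite /= !flag_oppK !flag_next3.
Qed.

Lemma flag_vertex_vnext c : flag_vertex (flag_vnext c) = flag_vertex c.
Proof.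
case: c => d [[]|] //; rewrite /flag_vertex /flag_vnext /flag_opp /=.
by rewrite -src_next f_finv //; exact: face_next_inj.
Qed.

Lemma flag_vertex_connect c c' : fconnect flag_vnext c c' ->
  flag_vertex c' = flag_vertex c.
Proof.
by move=> /iter_findex <-; elim: findex => //= k <-; rewrite flag_vertex_vnext.
Qed.

Lemma iter_flag_centre k d :
  iter k flag_vnext (d, Some true) = (iter k (@face_next _ _ D) d, Some true).
Proof. by elim: k => //= k ->. Qed.

Lemma flag_sym : connect_sym (frel flag_vnext).
Proof. exact: fconnect_sym flag_vnext_inj. Qed.

(** Around a vertex of the graph, sides to neighbours alternate with sides to face centres: one step
    of [face_next \o flip] is undone by two steps of [flag_vnext]. *)
Lemma flag_source_connect d e : src d = src e ->
  fconnect flag_vnext (d, None) (e, None).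
Proof.
move=> /rotation_transitive/connectP[p]; elim: p d => [|x p IH] d /=.
  by move=> _ ->; exact: connect0.
move=> /andP[/eqP <- pth] lst; apply: connect_trans (IH _ pth lst).
rewrite flag_sym /=; set x' := face_next (flip d).
have -> : (d, None) = flag_vnext (flag_vnext (x', None)) :> flag.
  rewrite /flag_vnext /flag_opp /= /x' /= finv_f ?flipK //; exact: face_next_inj.
by apply: connect_trans (fconnect1 _ _) (fconnect1 _ _).
Qed.

Lemma flag_target_connect d : fconnect flag_vnext (d, Some false) (flip d, None).
Proof. exact: (fconnect1 flag_vnext (d, Some false)). Qed.

Lemma flag_vertexP c c0 x : flag_vertex c = Some x -> flag_vertex c0 = Some x ->
  fconnect flag_vnext c c0.
Proof.
have H c' : flag_vertex c' = Some x ->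
    exists2 d, src d = x & fconnect flag_vnext c' (d, None).
  case: c' => d [[]|] //= [dx]; last by exists d => //; exact: connect0.
  by exists (flip d) => //; exact: flag_target_connect.
move=> /H[d dx cd] /H[d' dx' cd']; apply: connect_trans cd _.
by rewrite flag_sym; apply: connect_trans cd' _; apply: flag_source_connect;
  rewrite dx dx'.
Qed.

Lemma flag_apart c : ~~ fconnect flag_vnext c (flag_next c).
Proof.
apply/negP => /flag_vertex_connect; case: c => d [[]|] //=.
rewrite /flag_vertex /= => -[E]; have := src_flip d.
by rewrite E eqxx.
Qed.

Lemma flag_centre_order d :
  fingraph.order flag_vnext (d, Some true) = fingraph.order (@face_next _ _ D) d.
Proof.
rewrite /fingraph.order.
have inj : injective (fun e : D => (e, Some true) : flag) by move=> x y [].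
rewrite -(fintype.card_image inj); apply: eq_card => c; apply/idP/fintype.imageP.
  move=> /iter_findex <-; rewrite iter_flag_centre.
  by exists (iter (findex flag_vnext (d, Some true) c) (@face_next _ _ D) d) => //;
    exact: fconnect_iter.
by move=> [e /iter_findex <- ->]; rewrite -iter_flag_centre; exact: fconnect_iter.
Qed.

Lemma flag_degree c : (3 <= fingraph.order flag_vnext c)%N.
Proof.
have source d : (3 <= fingraph.order flag_vnext (d, None))%N.
  pose c0 : flag := (d, None).
  have u : uniq [:: c0; flag_vnext c0; flag_vnext (flag_vnext c0)].
    have n1 : c0 != flag_vnext c0 by apply/eqP.
    have n2 : flag_vnext c0 != flag_vnext (flag_vnext c0) by apply/eqP.
    rewrite /uniq !inE negb_or n1 n2 !andbT; apply/eqP => -[dE];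
      have := vertex_degree d.
    rewrite {1}dE flipK f_finv ?eqxx //; exact: face_next_inj.
  rewrite -[3%N](card_uniqP u); apply: subset_leq_card; apply/fintype.subsetP => x.
  rewrite !inE => /or3P[] /eqP ->; first exact: connect0.
    exact: fconnect1.
  by apply: connect_trans (fconnect1 _ _) (fconnect1 _ _).
case: c => d [[]|] //; first by rewrite flag_centre_order; exact: face_size.
have := source (flip d); rewrite /fingraph.order => /leq_trans; apply.
apply: subset_leq_card; apply/fintype.subsetP => x; rewrite !inE.
by apply: connect_trans; exact: flag_target_connect.
Qed.

(** Since the rotation is transitive at each vertex, a stable predicate depends only on the source
    of the dart, and connectedness becomes that of the graph. *)
Lemma flag_connected (P : pred flag) : (forall c, P c -> P (flag_next c)) ->
  (forall c, P c -> P (flag_opp c)) -> forall c c', P c -> P c'.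
Proof.
move=> Pn Po.
have all3 d i : P (d, i) = P (d, None).
  have h1 : P (d, None) -> P (d, Some false) by exact: Pn.
  have h2 : P (d, Some false) -> P (d, Some true) by exact: Pn.
  have h3 : P (d, Some true) -> P (d, None) by exact: Pn.
  by case: i => [[]|] //; apply/idP/idP; auto.
have Pf d : P (d, None) -> P (flip d, None) by exact: Po.
have Pnx d : P (d, None) -> P (face_next d, None).
  by rewrite -(all3 _ (Some false)) => /Po; rewrite /flag_opp /= all3.
have Psrc d e : src d = src e -> P (d, None) -> P (e, None).
  move=> /rotation_transitive/iter_findex <-; elim: findex => //= k IH Pd.
  by apply: Pnx; apply: Pf; exact: IH.
pose Q x := [exists d : D, (src d == x) && P (d, None)].
have Qc d : Q (src d) -> Q (src (flip d)).
  move=> /existsP[e /andP[/eqP ed Pe]]; apply/existsP; exists (flip d).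
  by rewrite eqxx /=; apply: Pf; exact: Psrc Pe.
move=> [d i] [e j]; rewrite (all3 d) (all3 e) => Pd.
have Qd : Q (src d) by apply/existsP; exists d; rewrite eqxx.
have /existsP[e' /andP[/eqP ee Pe]] := scheme_connected Qc (src e) Qd.
exact: Psrc Pe.
Qed.

Definition scheme_triangulation : triangulation :=
  @Triangulation flag flag_next flag_opp flag_next3 flag_oppK flag_apart
    flag_degree flag_connected (sbase D, None).

End SchemeTriangulation.

(** * The embedding of the graph in the surface *)

Section SchemeEmbedding.
Variables (R : realType) (N : nat) (adj : rel 'I_N) (D : scheme adj).
Implicit Types (d e : D) (w : 'rV[R]_N).

Local Notation C := (scheme_triangulation D).
Local Notation S := (surf R C).

Definition source d : C := (d, None).
Definition target d : C := (d, Some false).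
Definition centre d : C := (d, Some true).

Lemma vertex_same (c c' : C) x : flag_vertex c = Some x ->
  same c c' = (flag_vertex c' == Some x).
Proof.
move=> cx; apply/idP/eqP; first by move=> /flag_vertex_connect ->.
exact: flag_vertexP cx.
Qed.

Lemma centre_same d (c : C) : same (centre d) c ->
  exists2 e, c = centre e & fconnect (@face_next _ _ D) d e.
Proof.
move=> /iter_findex <-; rewrite (iter_flag_centre _ d).
exists (iter (findex vnext (centre d) c) (@face_next _ _ D) d) => //.
exact: fconnect_iter.
Qed.

Lemma same_centre d e :
  same (centre d) (centre e) = fconnect (@face_next _ _ D) d e.
Proof.
apply/idP/idP; first by move=> /centre_same[e' [->]].
move=> /iter_findex <-; elim: findex => [|k IH]; first exact: same_refl.
apply: same_trans IH _ => /=; exact: (same_vnext (centre (iter k _ d))).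
Qed.

Lemma centre_source d e : same (centre d) (source e) = false.
Proof. by apply/negbTE/negP => /centre_same[]. Qed.

Lemma centre_target d e : same (centre d) (target e) = false.
Proof. by apply/negbTE/negP => /centre_same[]. Qed.

Lemma simplex_side (s : R) : 0 <= s <= 1 -> simplex 1 (s, 0).
Proof. by move=> s01; split => /=; lra. Qed.

Definition vertex_coord w (v : option 'I_N) : R :=
  if v is Some x then w 0 x else 0.

(** The coordinates of the image are polynomials in the weights [w]: continuity of the embedding is
    then immediate, without gluing edges together. *)
Definition graph_coord w (x : C * 'I_3) : R :=
  match val x.2 with
  | 0%N => vertex_coord w (flag_vertex x.1)
  | 1%N => if x.1.2 is None then w 0 (src x.1.1) * w 0 (src (flip x.1.1)) else 0
  | _ => 0
  end.

Definition embed w : S :=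
  match pselect (surf_set (graph_coord w)) with
  | left h => SigSub (mem_set h)
  | right _ => pt0 R C
  end.

Lemma edge_pointE (x y z : 'I_N) (s : R) :
  edge_point x y s 0 z = (1 - s) * (x == z)%:R + s * (y == z)%:R.
Proof. by rewrite /edge_point !mxE !eqxx /= ![z == _]eq_sym. Qed.

(** On an edge only the two end weights are non-zero. As the graph is simple ([dart_inj]), the only
    sides of graph edges with both ends weighted are [d] and its flip, so the products of end
    weights are the side coordinates. *)
Lemma graph_coord_edge d (s : R) : 0 <= s <= 1 ->
  graph_coord (edge_point (src d) (src (flip d)) s) = coord (source d) (s, 0).
Proof.
move=> s01; apply: funext => -[c [[|[|[|i]]] hi]] //; rewrite /graph_coord /coord /=.
- rewrite /vcoord /= mulr0 addr0 subr0 ![same c _]same_sym.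
  rewrite (@vertex_same (source d) c (src d)) // (@vertex_same (target d) c (src
    (flip d))) //.
  case: (flag_vertex c) => [x|] /=; last by rewrite !mul0r addr0.
  rewrite edge_pointE mulrC [s * _]mulrC.
  by rewrite ![Some x == _]eq_sym !(inj_eq (@Some_inj _)).
- rewrite /ecoord /= !(mulr0, mul0r, addr0, subr0); case: c => e [b|].
    rewrite /side.
    have -> : ((e, Some b) == source d :> C) = false by apply/negbTE/eqP.
    have -> : (topp ((e, Some b) : C) == source d) = false.
      by apply/negbTE/eqP; case: b.
    by rewrite mul0r.
  have -> : side ((e, None) : C) (source d) = (e == d) || (flip e == d).
    rewrite /side; congr orb.
      by apply/eqP/eqP => [[]|->].
    by apply/eqP/eqP => [[]|<-].
  rewrite /= !edge_pointE.
  have nf e' : (src e' == src (flip e')) = false by apply/negbTE; exact: src_flip.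
  have fn e' : (src (flip e') == src e') = false by rewrite eq_sym.
  have [->|ned] := eqVneq e d.
    by rewrite !eqxx nf fn /=; ring.
  have [<-|nfd] := eqVneq (flip e) d.
    by rewrite flipK !eqxx nf fn /=; ring.
  rewrite mul0r.
  have [E1|n1] := eqVneq (src d) (src e).
    have [E2|n2] := eqVneq (src (flip d)) (src (flip e)).
      by rewrite (dart_inj E1 E2) eqxx in ned.
    have -> : (src (flip d) == src e) = false by rewrite -E1.
    have -> : (src d == src (flip e)) = false by rewrite E1.
    by rewrite !mulr0 !addr0 mulr0.
  have [E2|n2] := eqVneq (src (flip d)) (src e); last by rewrite !mulr0 addr0 mul0r.
  have [E3|n3] := eqVneq (src d) (src (flip e)).
    case/eqP: nfd; apply: dart_inj => //; first by rewrite flipK E2.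
  have -> : (src (flip d) == src (flip e)) = false by rewrite E2.
  by rewrite !mulr0 !addr0 mulr0.
- by rewrite /tcoord /= !mulr0.
Qed.

Lemma embed_edge d (s : R) : 0 <= s <= 1 ->
  embed (edge_point (src d) (src (flip d)) s) = tri (source d) (s, 0).
Proof.
move=> s01; have sz := simplex_side s01; apply: val_inj; rewrite triE //.
rewrite /embed; case: pselect => [h|[]] /=; first exact: graph_coord_edge.
by rewrite graph_coord_edge //; exact: coord_mem.
Qed.

Lemma edge_point0 (x y : 'I_N) : edge_point x y (0 : R) = delta_mx 0 x.
Proof. by rewrite /edge_point subr0 scale1r scale0r addr0. Qed.

Lemma edge_pointC (x y : 'I_N) (s : R) : edge_point y x (1 - s) = edge_point x y s.
Proof. by rewrite /edge_point subKr addrC. Qed.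

Lemma realizationP w : realization adj w <->
  exists d (s : R), 0 <= s <= 1 /\ w = edge_point (src d) (src (flip d)) s.
Proof.
split.
  move=> [[x ->]|[x [y [xy [s /= s01 <-]]]]].
    have [d dx] := src_surj D x; exists d, 0; rewrite lexx ler01.
    by rewrite dx edge_point0.
  by have [d <- <-] := dart_ex D xy; exists d, s.
move=> [d [s [s01 ->]]]; right; exists (src d), (src (flip d)).
by split; [exact: dart_adj|exists s].
Qed.

Lemma graph_coord_embed w : realization adj w -> val (embed w) = graph_coord w.
Proof.
move=> /realizationP[d [s [s01 ->]]].
by rewrite embed_edge // triE ?graph_coord_edge //; exact: simplex_side.
Qed.

Lemma embed_graph : graph_embedding adj embed.
Proof.
split.
  apply: (@surf_continuous R C _ _ embed graph_coord); last first.
    exact: graph_coord_embed.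
  have cc x : continuous (fun w : 'rV[R]_N => w 0 x) by exact: coord_continuous.
  move=> [c [[|[|i]] hi]] w; rewrite /graph_coord /=.
  - by rewrite /vertex_coord; case: (flag_vertex c) => [x|];
    [exact: cc|exact: cst_continuous].
  - by case: (c.2) => [_|];
    [exact: cst_continuous|exact: (cvgM (cc (src c.1) w) (cc (src (flip c.1)) w))].
  - exact: cst_continuous.
move=> w w' /set_mem rw /set_mem rw' E; apply/rowP => x.
have [d dx] := src_surj D x.
have H u : realization adj u -> vw (source d) (embed u) = u 0 x.
  by move=> ru; rewrite /vw graph_coord_embed // /graph_coord /= inordK //= dx.
by rewrite -!H // E.
Qed.

(** In the triangle of a dart, the graph is the side opposite to the face centre, where the
    coordinate of the centre vanishes. *)
Lemma complementP (p : S) : complement adj embed p <-> exists d, star (centre d) p.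
Proof.
split; last first.
  move=> [d dp] [w /realizationP[e [s [s01 ->]]] pE]; move: dp.
  rewrite -pE embed_edge // /star /= vwE; last exact: simplex_side.
  by rewrite /vcoord centre_source centre_target /= !mul0r mulr0 !addr0 ltxx.
move=> np; have [c [[a b] [sz pE]]] := tri_surj p.
suff [d [a' [b' [sz' pE']]]] : exists d a b, simplex 1 (a, b) /\ p = tri (source d)
  (a, b).
  exists d; rewrite pE' /star /= vwE // /vcoord centre_source centre_target.
  rewrite !mul0r !add0r [tnext _]/(centre d) same_refl mul1r /=.
  case: (sz') => /= a0 b0 ab; rewrite lt_neqAle b0 andbT; apply/eqP => b_0.
  have a01 : 0 <= a' <= 1 by lra.
  apply: np; exists (edge_point (src d) (src (flip d)) a').
    by apply/realizationP; exists d, a'.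
  by rewrite embed_edge // pE' -b_0.
case: c pE => d [[]|] pE; exists d.
- exists b, (1 - a - b); split; first by case: sz => /= *; split => /=; lra.
  rewrite pE -[(d, Some true)]/(tnext (tnext (source d))).
  do 2 (rewrite tri_tnext; last by case: sz => /= *; split => /=; lra).
  by congr (tri _ (_, _)); ring.
- exists (1 - a - b), a; split; first by case: sz => /= *; split => /=; lra.
  rewrite pE -[(d, Some false)]/(tnext (source d)).
  by rewrite tri_tnext //.
- by exists a, b.
Qed.

(** Otherwise [diamond_cover] would give a side joining two face centres, but every side at a centre
    leads to a vertex of the graph. *)
Lemma star_centre_same d e (p : S) : star (centre d) p -> star (centre e) p ->
  same (centre d) (centre e).
Proof.
move=> dp ep; apply: contrapT => /negP nde.
have [c [_ [_ [dc ec _ _ _]]]] := diamond_cover nde dp ep.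
have [d' cE _] := centre_same dc; move: ec.
rewrite cE -[topp _]/(target (finv (@face_next _ _ D) d')).
by rewrite centre_target.
Qed.

End SchemeEmbedding.

Lemma nth_rot1 (T : Type) (x0 : T) (c : seq T) j : (j < size c)%N ->
  nth x0 (rot 1 c) j = nth x0 c (j.+1 %% size c).
Proof.
case: c => // x s; rewrite rot1_cons nth_rcons /= ltnS leq_eqVlt => /orP[/eqP->|js].
  by rewrite ltnn eqxx modnn.
by rewrite js modn_small.
Qed.

(** * Faces, their boundaries and their colours *)

Section SchemeFaces.
Variables (R : realType) (N : nat) (adj : rel 'I_N) (D : scheme adj).
Implicit Types (d e : D) (w : 'rV[R]_N).

Local Notation C := (scheme_triangulation D).
Local Notation S := (surf R C).
Local Notation phi := (@embed R N adj D).
Local Notation fnext := (@face_next N adj D).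

Definition face_of d : set S := star (centre d).

Lemma face_of_eq d e : face_of d = face_of e <-> fconnect fnext d e.
Proof.
rewrite -same_centre; split => [E|]; last exact: star_same.
have : face_of d (tri (centre d) (0, 0)).
  apply/starP; exists (centre d), (0, 0).
  by split; [exact: same_refl|split => //=; rewrite addr0 ltr01|].
by move=> /[dup] dp; rewrite {1}E => ep; exact: star_centre_same dp ep.
Qed.

Lemma faceP (F : set S) : face adj phi F <-> exists d, F = face_of d.
Proof.
have comp d p : face_of d p -> connected_component (complement adj phi) p = face_of d.
  move=> dp; apply: connected_component_clopen => //.
  - exact: star_connected.
  - by move=> q dq; apply/complementP; exists d.
  - exact: star_open.
  have -> : complement adj phi `\` face_of d =
      \bigcup_(e in [set e | ~~ same (centre d) (centre e)]) face_of e.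
    rewrite eqEsubset; split => q.
      move=> [/complementP[e eq] ndq]; exists e => //=; apply/negP => de.
      by apply: ndq; rewrite /face_of (star_same R de).
    move=> [e /= /negP nde eq]; split; first by apply/complementP; exists e.
    by move=> dq; apply: nde; exact: star_centre_same dq eq.
  by apply: bigcup_open => e _; exact: star_open.
split.
  by move=> [p /complementP[d dp] ->]; exists d; exact: comp.
move=> [d ->]; have dp : face_of d (tri (centre d) (0, 0)).
  apply/starP; exists (centre d), (0, 0).
  by split; [exact: same_refl|split => //=; rewrite addr0 ltr01|].
exists (tri (centre d) (0, 0)); first by apply/complementP; exists d.
exact/esym/comp.
Qed.

Definition face_degree d := fingraph.order (@vnext C) (centre d).

Lemma face_degreeE d : face_degree d = fingraph.order fnext d.
Proof. exact: flag_centre_order. Qed.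

Lemma face_degree_gt0 d : (0 < face_degree d)%N.
Proof. exact: fingraph.order_gt0. Qed.

Lemma rounds d : planar_star (face_degree d) (@round R (face_degree d)).
Proof. exact/round_planar_star/face_degree_gt0. Qed.

Lemma open_disc_planar d :
  @open_disc R = planar_disc (centre d) (@round R (face_degree d)) 1.
Proof.
rewrite /planar_disc (open_ball_round (face_degree_gt0 d) ltr01).
by rewrite expr1n.
Qed.

(** Built on the closed simplices so as to reach the boundary circle; on the open disc it is the
    inverse [star_inv] of the round chart. *)
Definition face_map d (x : R * R) : S :=
  xget (pt0 R C) [set p | exists (i : 'I_(face_degree d)) z,
    [/\ simplex 1 z, x = round (face_degree d) i z &
      p = tri (iter i (@vnext C) (centre d)) z]].

Lemma face_mapE d i z : (i < face_degree d)%N -> simplex 1 z ->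
  face_map d (round (face_degree d) i z) = tri (iter i (@vnext C) (centre d)) z.
Proof.
move=> id sz; apply: xget_unique; first by exists (Ordinal id), z.
move=> q [j [z' [sz' E ->]]]; exact: (planar_tri (rounds d)).
Qed.

Lemma face_map_continuous d : {within @closed_disc R, continuous (face_map d)}.
Proof.
rewrite (closed_ball_round R (face_degree_gt0 d)); apply: glue_continuous.
- exact: norm_hausdorff.
- by move=> i; exact: simplex_compact.
- by move=> i; apply: continuous_subspaceT; exact: round_continuous.
- move=> i; apply: (@subspace_eq_continuous _ (simplex 1) _
    (tri (iter i (@vnext C) (centre d)))).
    by move=> z /set_mem sz; apply/esym/face_mapE.
  exact: tri_continuous.
Qed.

Lemma face_map_homeomorphism d :
  homeomorphism (@open_disc R) (face_of d) (face_map d)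
    (star_map (centre d) (@round R (face_degree d))).
Proof.
have [cm ci mK iK] := star_homeomorphism (rounds d).
have E x : open_disc x -> face_map d x = star_inv (centre d) (@round R (face_degree
  d)) x.
  rewrite (open_disc_planar d) => -[i [z [oz ->]]].
  rewrite face_mapE //; last exact: osimplexW.
  by apply/esym/(star_invE (rounds d)); exists i, z.
split => //.
- by apply: continuous_subspaceW (@face_map_continuous d) => x /ltW.
- by move=> x ox; rewrite E //; apply: iK; rewrite -open_disc_planar.
- move=> p fp; have [Dx pK] := mK _ fp.
  by split; [rewrite (open_disc_planar d)|rewrite E // (open_disc_planar d)].
Qed.

Lemma embed_cellular : cellular adj phi.
Proof.
move=> F /faceP[d ->];
  exists (face_map d), (star_map (centre d) (@round R (face_degree d))).
exact: face_map_homeomorphism.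
Qed.

Lemma face_map_edge d j (s : R) : (j < face_degree d)%N -> 0 <= s <= 1 ->
  face_map d (polar (0, 0) 1 (2 * pi * (j%:R + s) / (face_degree d)%:R)) =
  phi (edge_point (src (iter j fnext d)) (src (iter j.+1 fnext d)) s).
Proof.
move=> jd s01; rewrite iterS src_next embed_edge //.
rewrite -[polar _ _ _]/(arc _ _ _ _) round_arc // face_mapE //; last first.
  by split => /=; lra.
rewrite [iter j _ _](iter_flag_centre j d) !mul1r.
(* The radius is 1, so the point is on the side opposite to the centre; turning the triangle twice
   expresses it from the source of the dart. *)
rewrite -[(_, Some true)]/(tnext (tnext (source (iter j fnext d)))).
rewrite tri_tnext; last by split => /=; lra.
rewrite tri_tnext; last by split => /=; lra.
by congr (tri _ (_, _)); ring.
Qed.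

Lemma face_boundary_forward d (c : seq 'I_N) : size c = face_degree d ->
  (forall x0 j, (j < size c)%N -> nth x0 c j = src (iter j fnext d)) ->
  face_boundary phi (face_of d) c.
Proof.
move=> sc nc; exists (face_map d); split.
- exact: face_map_continuous.
- by eexists; exact: face_map_homeomorphism.
move=> x0 j s jc s01; rewrite sc face_map_edge -?sc //;
  congr (phi (edge_point _ _ _)).
  by rewrite nc.
have n0 := face_degree_gt0 d; rewrite nth_rot1 // nc ?sc ?ltn_pmod //.
move: jc; rewrite sc leq_eqVlt => /orP[/eqP jE|jd]; last by rewrite modn_small.
by rewrite jE modnn face_degreeE (iter_order (@face_next_inj _ _ D)).
Qed.

(* Reflecting the disc traverses the boundary backwards. *)
Lemma face_boundary_backward d (c : seq 'I_N) : size c = face_degree d ->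
  (forall x0 j, (j < size c)%N -> nth x0 c j = src (iter (size c - j) fnext d)) ->
  face_boundary phi (face_of d) c.
Proof.
move=> sc nc; pose m (x : R * R) := (x.1, - x.2).
have cm : continuous m.
  apply: pair_continuous => x; first exact: fst_continuous.
  by apply: cvgN; exact: snd_continuous.
have mK x : m (m x) = x by case: x => x y; rewrite /m /= opprK.
have mo x : open_disc x -> open_disc (m x) by rewrite /open_disc /= sqrrN.
have mc x : closed_disc x -> closed_disc (m x) by rewrite /closed_disc /= sqrrN.
have [hf hg fK gK] := face_map_homeomorphism d.
exists (face_map d \o m); split.
- apply/subspace_continuousP => x cx W nW.
  have /subspace_continuousP/(_ _ (mc _ cx) W nW) := @face_map_continuous d.
  rewrite /nbhs /= /within /= => H.
  have {}H : nbhs x [set y | closed_disc (m y) -> W (face_map d (m y))] := cm x _ H.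
  apply: filterS H => y H' cy.
  by apply: H'; exact: mc.
- exists (m \o star_map (centre d) (@round R (face_degree d))); split.
  + apply/subspace_continuousP => x cx W nW.
    have /subspace_continuousP/(_ _ (mo _ cx) W nW) := hf.
    rewrite /nbhs /= /within /= => H.
    have {}H : nbhs x [set y | open_disc (m y) -> W (face_map d (m y))] := cm x _ H.
    apply: filterS H => y H' cy.
    by apply: H'; exact: mo.
  + by apply: within_continuous_comp hg => x _; exact: cm.
  + by move=> x /mo/fK[fx E]; split=> //=; rewrite E mK.
  + by move=> p /gK[ox E]; split; [exact: mo|rewrite /= mK E].
move=> x0 j s jc s01; have n0 := face_degree_gt0 d.
(* The reflection sends position [j + s] on the circle to [size c - (j + s)], which is
   [j' + (1 - s)]. *)
pose j' := ((size c).-1 - j)%N.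
have jj : (j + j').+1 = size c by rewrite /j' subnKC ?prednK //; lia.
have -> : (face_map d \o m) (polar (0, 0) 1 (2 * pi * (j%:R + s) / (size c)%:R)) =
    face_map d (polar (0, 0) 1 (2 * pi * (j'%:R + (1 - s)) / (face_degree d)%:R)).
  rewrite /= -sc; congr face_map; rewrite /m /polar /= !add0r !mul1r.
  have -> : 2 * pi * (j'%:R + (1 - s)) / (size c)%:R =
      pi *+ 2 - 2 * pi * (j%:R + s) / (size c)%:R :> R.
    rewrite -[pi *+ 2]mulr_natl.
    have -> : j'%:R = (size c)%:R - j%:R - 1 :> R by rewrite -jj mulrSr natrD; ring.
    have : (size c)%:R != 0 :> R by rewrite pnatr_eq0 sc -lt0n.
    by move: (size c)%:R (2 * pi) => M P M0; field.
  by rewrite cosB sinB cos2pi sin2pi !mul1r !mul0r addr0 sub0r.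
rewrite face_map_edge; [|by rewrite -sc; lia|lra].
rewrite edge_pointC nc // nth_rot1 //.
have -> : (size c - j)%N = j'.+1 by lia.
congr (phi (edge_point _ _ _)); move: jc; rewrite leq_eqVlt => /orP[/eqP jE|jd].
  rewrite jE modnn nc ?subn0 ?sc // face_degreeE (iter_order (@face_next_inj _ _ D)).
  by have -> : j' = 0%N by lia.
rewrite modn_small // nc //; congr (src (iter _ _ _)); lia.
Qed.

(** The point [x] is approached along its radius, through [r * x] with [r < 1]; the minimum with
    [1 / 2] in the choice of [r] keeps [r] positive. *)
Lemma closed_disc_closure (F : set S) (f : R * R -> S) (x : R * R) :
  {within @closed_disc R, continuous f} -> (forall y, open_disc y -> F (f y)) ->
  closed_disc x -> closure F (f x).
Proof.
move=> /subspace_continuousP cf oF cx W nW.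
have := cf _ cx W nW; rewrite /nbhs /= /within /= => H.
pose g (r : R) := (r * x.1, r * x.2).
have cg : continuous g.
  by apply: pair_continuous => r; apply: cvgM;
    [exact: cvg_id|exact: cvg_cst|exact: cvg_id|exact: cvg_cst].
have g1 : g 1 = x by rewrite /g !mul1r -surjective_pairing.
have Hg : nbhs (1 : R) [set r | closed_disc (g r) -> W (f (g r))].
  have {}H : nbhs (g 1) [set y | closed_disc y -> W (f y)] by rewrite g1.
  exact: (cg 1 _ H).
have /nbhs_ballP[e /= e0 He] := Hg.
pose r := 1 - Num.min (e / 2) (1 / 2).
have m0 : 0 < Num.min (e / 2) (1 / 2) by rewrite lt_min !divr_gt0.
have m1 : Num.min (e / 2) (1 / 2) <= 1 / 2 by rewrite ge_min lexx orbT.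
have m2 : Num.min (e / 2) (1 / 2) <= e / 2 by rewrite ge_min lexx.
have gr : open_disc (g r).
  rewrite /open_disc /= !exprMn -mulrDr.
  apply: (@le_lt_trans _ _ (r ^+ 2)); first by rewrite ler_piMr ?sqr_ge0.
  by rewrite expr_lt1 ?/r //; lra.
exists (f (g r)); split; first exact: oF.
apply: He; last exact: ltW.
by rewrite /ball /= /r subKr gtr0_norm //; lra.
Qed.

Lemma boundary_incident (F : set S) (c : seq 'I_N) x0 j :
  face_boundary phi F c -> (j < size c)%N ->
  incident phi F (nth x0 c j) (nth x0 (rot 1 c) j).
Proof.
move=> [f [cf [g [_ _ fK _]] fE]] jc p [_ [s /= s01 <-] <-].
rewrite -fE //; apply: closed_disc_closure cf _ _; first by move=> y /fK[].
by rewrite /closed_disc /polar /= !add0r !mul1r cos2Dsin2.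
Qed.

Lemma edge_segmentC (x y : 'I_N) : @edge_segment R N x y = edge_segment y x.
Proof.
suff H u v : @edge_segment R N u v `<=` edge_segment v u by rewrite eqEsubset.
move=> _ [s /= s01 <-]; exists (1 - s); first by rewrite /=; lra.
exact: edge_pointC.
Qed.

Lemma face_of_incident d : incident phi (face_of d) (src d) (src (flip d)).
Proof.
pose c := [seq src (iter j fnext d) | j <- iota 0 (face_degree d)].
have sc : size c = face_degree d by rewrite size_map size_iota.
have nc x0 j : (j < size c)%N -> nth x0 c j = src (iter j fnext d).
  by move=> jc; rewrite (nth_map 0%N) ?nth_iota ?size_iota -?sc.
have d2 : (1 < size c)%N by rewrite sc face_degreeE; exact: leq_trans (face_size d).
have c0 : (0 < size c)%N by exact: ltnW.
have := @boundary_incident _ _ (src d) 0%N (face_boundary_forward sc nc) c0.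
by rewrite nth_rot1 // modn_small // !nc // -src_next.
Qed.

(** The closure of a face lies in the compact union of the triangles around its centre. The midpoint
    of the edge has a positive side coordinate, and among these triangles only those of [d] and
    [flip d] allow it. *)
Lemma incident_face_of d e : incident phi (face_of e) (src d) (src (flip d)) ->
  face_of e = face_of d \/ face_of e = face_of (flip d).
Proof.
pose B := \bigcup_(i : 'I_(face_degree e))
  (tri (iter i (@vnext C) (centre e)) @` simplex (1 : R)).
have cB : closed B.
  apply: compact_closed; first exact: surf_hausdorff.
  apply: compact_bigcup_fin => i; apply: continuous_compact.
    exact: tri_continuous.
  exact: simplex_compact.
have eB : face_of e `<=` B.
  move=> p /starP[c [z [ec oz ->]]]; have [i ->] := corner_surj ec.
  by exists i => //; exists z => //; exact: osimplexW.
have h : 0 <= (2^-1 : R) <= 1 by lra.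
move=> /(_ (phi (edge_point (src d) (src (flip d)) 2^-1))) H.
have {}H : B (tri (source d) (2^-1, 0)).
  rewrite -embed_edge //; move/closure_id: cB => ->; apply: (closureS eB).
  by apply: H; exists (edge_point (src d) (src (flip d)) 2^-1) => //; exists 2^-1.
case: H => i _ [z sz E]; have sh := simplex_side h.
have : 0 < ew (source d) (tri (source d) (2^-1 : R, 0)).
  rewrite ewE // /ecoord /side eqxx /= !(mulr0, mul0r, addr0, subr0) mul1r.
  by rewrite mulr_gt0 //; lra.
rewrite -E [iter i _ _](iter_flag_centre i e); set e' := iter i fnext e.
have ee' : face_of e = face_of e' by apply/face_of_eq; exact: fconnect_iter.
rewrite ewE // /ecoord /=.
have s1 : side (source d) (e', Some true) = false.
  by apply/negbTE/norP; split; apply/eqP.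
have s2 : side (source d) (tnext ((e', Some true) : C)) = (d == e') || (flip d == e').
  by rewrite /side; congr orb; apply/eqP/eqP => [[]|E'] //; rewrite -?E' ?E' //;
    congr pair.
have s3 : side (source d) (tnext (tnext ((e', Some true) : C))) = false.
  by apply/negbTE/norP; split; apply/eqP.
rewrite s1 s2 s3 !mul0r add0r addr0 ee'.
have [E1|_] := eqVneq d e'; first by left; rewrite -E1.
have [E2|_] := eqVneq (flip d) e'; first by right; rewrite -E2.
by rewrite mul0r ltxx.
Qed.

Definition face_colour (F : set S) : bool :=
  `[< exists d, colour d /\ F = face_of d >].

Lemma colour_connect d e : fconnect fnext d e -> colour e = colour d.
Proof. by move=> /iter_findex <-; elim: findex => //= k <-; rewrite colour_next. Qed.

Lemma face_colourE d : face_colour (face_of d) = colour d.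
Proof.
apply/asboolP/idP; last by exists d.
by move=> [e [ce /face_of_eq de]]; rewrite -(colour_connect de).
Qed.

Lemma embed_2_colouring : face_2_colouring adj phi face_colour.
Proof.
move=> x y /(dart_ex D)[d <- <-]; exists (face_of d), (face_of (flip d)).
have fi : incident phi (face_of (flip d)) (src d) (src (flip d)).
  have := @face_of_incident (flip d).
  by rewrite flipK /incident edge_segmentC.
split.
- by apply/faceP; exists d.
- by apply/faceP; exists (flip d).
- by rewrite !face_colourE colour_flip; case: (colour d).
move=> H /faceP[e ->]; split; first exact: incident_face_of.
by move=> [->|->] //; exact: face_of_incident.
Qed.

(** A circuit determines its face within a colour: its first edge borders just two faces, and they
    have different colours. *)
Lemma embed_colour_class b (K : set (seq 'I_N)) :
  (forall c, K c -> closed_trail adj c) ->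
  (forall d, colour d = b -> exists2 c, K c & face_boundary phi (face_of d) c) ->
  (forall c, K c -> exists2 d, colour d = b & face_boundary phi (face_of d) c) ->
  colour_class adj phi face_colour b K.
Proof.
move=> trailK faceK Kface; split.
  by move=> F /faceP[d ->]; rewrite face_colourE => /faceK.
move=> c Kc; have [d db dc] := Kface _ Kc; exists (face_of d); split.
  by split; [apply/faceP; exists d|rewrite face_colourE|].
move=> F [/faceP[e ->] eb ec].
have /and3P[cn0 cyc _] := trailK _ Kc.
case: c Kc dc ec cn0 cyc => [|x c] // Kc dc ec _ cyc.
have di := @boundary_incident _ _ x 0%N dc (ltn0Sn _).
have ei := @boundary_incident _ _ x 0%N ec (ltn0Sn _).
have xy : adj (nth x (x :: c) 0) (nth x (rot 1 (x :: c)) 0).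
  by move: cyc; rewrite /path.cycle rot1_cons; case: (c) => [|y c'] /= /andP[].
have [F1 [F2 [fF1 fF2 c12 H]]] := embed_2_colouring xy.
have fd : face adj phi (face_of d) by apply/faceP; exists d.
have fe : face adj phi (face_of e) by apply/faceP; exists e.
have := (H _ fd).1 di; have := (H _ fe).1 ei.
move: eb; rewrite face_colourE => eb; move: c12.
rewrite -db -face_colourE in eb.
move=> c12 [E1|E1] [E2|E2]; rewrite ?E1 ?E2 //; move: c12.
  by rewrite -E1 -E2 !face_colourE -eb face_colourE eqxx.
by rewrite -E1 -E2 !face_colourE -eb face_colourE eqxx.
Qed.

End SchemeFaces.

(** * Circuits of an ordering *)

Section WordCircuit.
Variables (v : nat) (w : seq 'Z_v).
Hypothesis w_uniq : uniq w.
Hypothesis w_gt0 : (0 < size w)%N.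
Implicit Types (x y : 'Z_v) (q i j : nat).

Definition prefix_sum j : 'Z_v := \sum_(i < j) nth 0 w i.
Definition word_sum : 'Z_v := prefix_sum (size w).
Definition circuit_length : nat := (#[word_sum]%g * size w)%N.

(* The [q]-th dart (vertex and step) of the circuit generated by the translate
   by [x] of the path of [w]. *)
Definition circuit_dart x q : 'Z_v * 'Z_v :=
  (x + prefix_sum (q %% size w) + word_sum *+ (q %/ size w), nth 0 w (q %% size w)).

Lemma circuit_length_gt0 : (0 < circuit_length)%N.
Proof. by rewrite /circuit_length muln_gt0 fingroup.order_gt0. Qed.

Lemma size_circuit_length : (size w <= circuit_length)%N.
Proof. by rewrite /circuit_length leq_pmull // fingroup.order_gt0. Qed.

Lemma circuit_dart_mem x q : (circuit_dart x q).2 \in w.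
Proof. by rewrite mem_nth // ltn_pmod. Qed.

(** The successor does not involve [x] or [q], so the darts form an orbit of one map. At the end of
    the word the prefix sum restarts from 0 and the quotient supplies the completed sum. *)
Lemma circuit_dartS x q : circuit_dart x q.+1 =
  ((circuit_dart x q).1 + (circuit_dart x q).2, next w (circuit_dart x q).2).
Proof.
have pS j : prefix_sum j.+1 = prefix_sum j + nth 0 w j.
  by rewrite /prefix_sum big_ord_recr.
have nx j : (j < size w)%N -> next w (nth 0 w j) = nth 0 w (j.+1 %% size w).
  move=> jw; rewrite next_nth mem_nth // index_uniq //.
  case: (w) jw => [|a s] // jw; rewrite /= ltnS leq_eqVlt in jw *.
  case/orP: jw => [/eqP->|js]; first by rewrite modnn nth_default.
  by rewrite modn_small ?ltnS //; apply: set_nth_default.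
rewrite /circuit_dart /= nx ?ltn_pmod //.
have qE := divn_eq q (size w); set i := (q %/ size w)%N in qE *.
set j := (q %% size w)%N in qE *; have jw : (j < size w)%N by rewrite ltn_pmod.
have -> : (q.+1 %% size w)%N = (j.+1 %% size w)%N.
  by rewrite qE -addnS modnMDl.
congr pair; rewrite qE -addnS divnMDl //.
move: jw; rewrite leq_eqVlt => /orP[/eqP jE|jw]; last first.
  by rewrite modn_small // divn_small // addn0 pS; move: (word_sum *+ i) => y; ring.
have wE : word_sum = prefix_sum j + nth 0 w j by rewrite -pS jE.
rewrite jE modnn divnn w_gt0 addn1 mulrSr {1}/prefix_sum big_ord0 addr0.
by move: (word_sum *+ i) => y; rewrite wE; ring.
Qed.

Lemma circuit_dart_period x q : circuit_dart x (q + circuit_length) = circuit_dart x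
  q.
Proof.
rewrite /circuit_dart /circuit_length addnC modnMDl divnMDl //.
congr (_ + _, _); rewrite mulrnDr.
have -> : word_sum *+ #[word_sum]%g = 0.
  by have := expg_order word_sum; rewrite FinRing.zmodXgE.
by rewrite add0r.
Qed.

Lemma circuit_dart_periodM x q i :
  circuit_dart x (q + i * circuit_length) = circuit_dart x q.
Proof.
by elim: i => [|i IH]; rewrite ?addn0 // mulSn addnCA addnC circuit_dart_period.
Qed.

(** As the letters are distinct, the step gives [q] modulo the length of the word; the order of
    [word_sum] then gives the quotient. *)
Lemma circuit_dart_inj x q q' : (q < circuit_length)%N -> (q' < circuit_length)%N ->
  circuit_dart x q = circuit_dart x q' -> q = q'.
Proof.
move=> ql ql' E.
have /= E1 := congr1 fst E; have /= E2 := congr1 snd E.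
have mE : (q %% size w = q' %% size w)%N.
  by apply/eqP; move/eqP: E2; rewrite nth_uniq // ltn_pmod.
rewrite mE in E1; move/eqP: E1; rewrite (inj_eq (addrI _)).
rewrite -!FinRing.zmodXgE cyclic.eq_expg_mod_order !modn_small ?ltn_divLR // =>
  /eqP dE.
by rewrite (divn_eq q (size w)) (divn_eq q' (size w)) mE dE.
Qed.

Lemma circuit_dart_shift x x' q q' r : circuit_dart x q = circuit_dart x' q' ->
  circuit_dart x (q + r) = circuit_dart x' (q' + r).
Proof.
move=> E; elim: r => [|r IH]; first by rewrite !addn0.
by rewrite !addnS !circuit_dartS IH.
Qed.

Definition word_path x : seq 'Z_v := [seq y + x | y <- 0 :: partial_sums w].

Lemma partial_sumsE : 0 :: partial_sums w = mkseq prefix_sum (size w).+1.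
Proof.
apply: (@eq_from_nth _ 0) => [|j];
  rewrite /= ?size_scanl ?size_map ?size_iota // => jw.
rewrite [LHS]nth_cons_scanl // nth_mkseq // /prefix_sum.
elim: j jw => [|j IH] jw; first by rewrite take0 big_ord0.
by rewrite (take_nth 0) // foldl_rcons IH ?big_ord_recr // ltnW.
Qed.

Lemma word_circuitE x :
  path_circuit (word_path x) = mkseq (fun q => (circuit_dart x q).1) circuit_length.
Proof.
have sP : size (word_path x) = (size w).+1.
  by rewrite size_map /= size_scanl.
have wP : word_path x = mkseq (fun j => prefix_sum j + x) (size w).+1.
  by rewrite /word_path partial_sumsE -map_comp.
have dE : last 0 (word_path x) - head 0 (word_path x) = word_sum.
  rewrite (last_nth 0) -nth0 sP wP /= !nth_mkseq //.
  by rewrite {2}/prefix_sum big_ord0 add0r addrK.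
rewrite /path_circuit dE sP /= wP /circuit_length.
set o := #[_]%g;
  have -> : take (size w) (mkseq (fun j => prefix_sum j + x) (size w).+1)
    = mkseq (fun j => prefix_sum j + x) (size w).
  by rewrite /mkseq -map_take take_iota (minn_idPl (leqnSn _)).
elim: o => [|o IH]; first by rewrite mul0n.
rewrite -[(o.+1)%N]addn1 iotaD map_cat flatten_cat IH add0n /= cats0 mulnDl mul1n.
rewrite /mkseq iotaD map_cat add0n; congr cat.
rewrite -[(o * size w)%N in RHS]addn0 iotaDl -!map_comp; apply/eq_in_map => j.
rewrite mem_iota /= => jw; rewrite /circuit_dart modnMDl modn_small //.
by rewrite divnMDl // divn_small // addn0 [prefix_sum j + x]addrC.
Qed.

Lemma size_word_circuit x : size (path_circuit (word_path x)) = circuit_length.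
Proof. by rewrite word_circuitE size_mkseq. Qed.

Lemma nth_word_circuit x0 x q : (q < circuit_length)%N ->
  nth x0 (path_circuit (word_path x)) q = (circuit_dart x q).1.
Proof. by move=> ql; rewrite word_circuitE nth_mkseq. Qed.

Lemma circuit_dart_ex x a : a \in w ->
  exists x0 q, (q < circuit_length)%N /\ circuit_dart x0 q = (x, a).
Proof.
move=> aw; have jw : (index a w < size w)%N by rewrite index_mem.
exists (x - prefix_sum (index a w)), (index a w); split.
  by apply: leq_trans jw _; exact: size_circuit_length.
by rewrite /circuit_dart modn_small // divn_small // mulr0n addr0 subrK nth_index.
Qed.

Lemma word_circuit_shift x x' q q' : circuit_dart x q = circuit_dart x' q' ->
  same_circuit (path_circuit (word_path x)) (path_circuit (word_path x')).
Proof.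
move=> E; set L := circuit_length.
(* This is [q - q'] modulo [L]; the multiple of [L] prevents the subtraction from being
   truncated. *)
pose r := ((q + q' * L - q') %% L)%N; exists r; left.
have L0 := circuit_length_gt0.
have rL : (r < L)%N by rewrite ltn_pmod.
have qq : (q' <= q + q' * L)%N by rewrite (leq_trans _ (leq_addl _ _)) // leq_pmulr.
have D p : circuit_dart x' p = circuit_dart x (p + r).
  rewrite -(circuit_dart_periodM x' p q').
  have -> : (p + q' * L = q' + (p + q' * L - q'))%N.
    by rewrite subnKC // (leq_trans _ (leq_addl _ _)) // leq_pmulr.
  rewrite -(circuit_dart_shift _ E).
  rewrite -(circuit_dart_periodM x (p + r) ((q + q' * L - q') %/ L)).
  congr circuit_dart; rewrite -addnA [(r + _)%N]addnC -divn_eq.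
  by rewrite !addnBA // ?(leq_trans _ (leq_addl _ _)) ?leq_pmulr // addnCA.
rewrite !word_circuitE -/L; apply: (@eq_from_nth _ 0).
  by rewrite size_rot !size_mkseq.
move=> p; rewrite size_mkseq => pL;
  rewrite nth_mkseq // D /rot nth_cat size_drop size_mkseq.
case: ltnP => pr; first by rewrite nth_drop nth_mkseq; [rewrite addnC|lia].
rewrite nth_take ?nth_mkseq; [|lia|lia].
by rewrite -(circuit_dart_period _ (p - (L - r))) -/L; congr (circuit_dart _ _).1;
  lia.
Qed.

End WordCircuit.

Lemma pair_ext (T U : Type) (p q : T * U) : p.1 = q.1 -> p.2 = q.2 -> p = q.
Proof. by case: p q => [? ?] [? ?] /= -> ->. Qed.

(** * Circuit decompositions from a family of words *)

Section WordFamily.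
Variables (v : nat) (J : {group 'Z_v}) (E : pred 'Z_v).
Hypothesis E_J : forall a, E a -> a \notin J.
Hypothesis E_total : forall a, a \notin J -> E a || E (- a).
Hypothesis E_opp : forall a, E a -> ~~ E (- a).
Variables (l : nat) (w : 'I_l -> seq 'Z_v).
Hypothesis w_mem : forall i a, a \in w i -> E a.
Hypothesis w_ex : forall a, E a -> exists i, a \in w i.
Hypothesis w_disjoint : forall i j a, a \in w i -> a \in w j -> i = j.
Hypothesis w_uniq : forall i, uniq (w i).
Hypothesis w_gt0 : forall i, (0 < size (w i))%N.
Implicit Types (x y a : 'Z_v).

Local Notation circ i x := (path_circuit (word_path (w i) x)).
Local Notation dart i x q := (circuit_dart (w i) x q).

(** An unoriented edge gives two opposite steps, and [E] contains no two opposite elements, hence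
    not 0 either: the edge determines its dart with step in [E]. *)
Lemma edge_inj x y a b : E a -> E b ->
  ([set x; x + a] = [set y; y + b])%SET -> x = y /\ a = b.
Proof.
move=> Ea Eb /setP H.
have := H x; have := H (x + a); rewrite !in_set2 !eqxx orbT /=.
move=> /esym/orP[/eqP xay|/eqP xay] /esym/orP[/eqP xy|/eqP xy].
- have a0 : a = 0 by apply: (addrI x); rewrite addr0 xay xy.
  by have := E_opp Ea; rewrite a0 oppr0 -a0 Ea.
- have ab : b = - a by apply: (addrI y); rewrite -xy -xay addrK.
  by have := E_opp Ea; rewrite -ab Eb.
- by split=> //; apply: (addrI x); rewrite xay xy.
- have a0 : a = 0 by apply: (addrI x); rewrite addr0 xay xy.
  by have := E_opp Ea; rewrite a0 oppr0 -a0 Ea.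
Qed.

Lemma dart_E i x q : E (dart i x q).2.
Proof. by apply: (@w_mem i); exact: circuit_dart_mem. Qed.

Lemma circuit_edge_nth i x q : (q < circuit_length (w i))%N ->
  nth (finset.set0 : {set 'Z_v}) (circuit_edges (circ i x)) q =
  ([set (dart i x q).1; (dart i x q).1 + (dart i x q).2])%SET.
Proof.
move=> ql; have sC := size_word_circuit (w_gt0 i) x.
rewrite /circuit_edges (nth_map (0, 0)) ?size_zip ?size_rot ?minnn ?sC //.
rewrite nth_zip ?size_rot // nth_rot1 ?sC // !nth_word_circuit ?ltn_pmod //;
  last exact: circuit_length_gt0.
congr ([set _; _])%SET; have := circuit_dartS (w_uniq i) (w_gt0 i) x q.
move: ql; rewrite leq_eqVlt => /orP[/eqP qE|ql]; last first.
  by rewrite modn_small // => ->.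
rewrite qE modnn -[circuit_length _]add0n (circuit_dart_period (w_gt0 i)) => ->.
by [].
Qed.

Lemma size_circuit_edges i x : size (circuit_edges (circ i x)) = circuit_length (w i).
Proof. by rewrite size_map size_zip size_rot minnn size_word_circuit. Qed.

Lemma circuit_edgeP i x e : e \in circuit_edges (circ i x) ->
  exists2 q, (q < circuit_length (w i))%N &
    e = ([set (dart i x q).1; (dart i x q).1 + (dart i x q).2])%SET.
Proof.
move=> /(nthP finset.set0)[q]; rewrite size_circuit_edges => ql <-.
by exists q => //; rewrite circuit_edge_nth.
Qed.

Lemma word_circuit_trail i x : closed_trail (cayley_adj J) (circ i x).
Proof.
have L0 : (0 < circuit_length (w i))%N by exact: circuit_length_gt0.
have sC := size_word_circuit (w_gt0 i) x.
apply/and3P; split.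
- by rewrite -size_eq0 sC -lt0n.
- case cE : (circ i x) => [|y s] //=; apply/(pathP 0) => q; rewrite size_rcons => qs.
  have qL : (q < circuit_length (w i))%N by rewrite -sC cE.
  rewrite -rcons_cons nth_rcons /= qs -rot1_cons -cE nth_rot1 ?sC //.
  have := circuit_edge_nth x qL; rewrite /circuit_edges.
  rewrite !nth_word_circuit ?ltn_pmod //.
  have -> : (dart i x (q.+1 %% circuit_length (w i))).1 = (dart i x q).1 + (dart i x
    q).2.
    have := circuit_dartS (w_uniq i) (w_gt0 i) x q.
    move: qL; rewrite leq_eqVlt => /orP[/eqP qE|ql];
      last by rewrite modn_small // => ->.
    by rewrite qE modnn -[circuit_length _]add0n (circuit_dart_period (w_gt0 i)) =>
      ->.
  move=> _; rewrite /cayley_adj addrC addKr; apply: E_J; exact: dart_E.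
- apply/(uniqP finset.set0) => q q'; rewrite !inE size_circuit_edges => qL qL'.
  rewrite !circuit_edge_nth // => /(edge_inj (dart_E _ _ _) (dart_E _ _ _))[E1 E2].
  by apply: (circuit_dart_inj (w_uniq i) (w_gt0 i) qL qL'); apply: pair_ext;
    [exact: E1|exact: E2].
Qed.

Lemma word_circuit_decomposition :
  circuit_decomposition (cayley_adj J) (circuits_of (path_decomposition w)).
Proof.
split.
- by move=> _ [_ [i [x ->]] <-]; exact: word_circuit_trail.
- have H x a : E a -> exists2 C, circuits_of (path_decomposition w) C &
      ([set x; x + a])%SET \in circuit_edges C.
    move=> Ea; have [i ai] := w_ex Ea.
    have [x0 [q [qL qE]]] := circuit_dart_ex x ai.
    exists (circ i x0); first by exists (word_path (w i) x0) => //; exists i, x0.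
    apply/(nthP finset.set0); exists q; first by rewrite size_circuit_edges.
    by rewrite circuit_edge_nth // qE.
  move=> x y /E_total/orP[|] xy.
    by have [C DC] := H x _ xy; rewrite subrKC; exists C.
  have [C DC] := H y _ xy; rewrite opprB subrKC finset.setUC; by exists C.
- move=> _ _ e [_ [i [x ->]] <-] [_ [i' [x' ->]] <-].
  move=> /circuit_edgeP[q qL ->] /circuit_edgeP[q' qL'].
  move=> /(edge_inj (dart_E _ _ _) (dart_E _ _ _))[E1 E2].
  have ii : i = i'.
    apply: (@w_disjoint _ _ (dart i x q).2); first exact: circuit_dart_mem.
    by rewrite E2; exact: circuit_dart_mem.
  subst i'; apply: (@word_circuit_shift _ _ (w_uniq i) (w_gt0 i) _ _ q q').
  apply: pair_ext; [exact: E1|exact: E2].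
Qed.

(** The cyclic permutations have disjoint supports, so only the factor of the word containing [a]
    moves it. *)
Lemma ordering_perm_word i a : a \in w i -> ordering_perm w a = next (w i) a.
Proof.
rewrite /ordering_perm => ai.
suff H s : uniq s -> foldr (fun i f => next (w i) \o f) id s a =
    if i \in s then next (w i) a else a.
  by rewrite H ?enum_uniq // mem_enum.
elim: s => [|j s IH] //= /andP[js us]; rewrite inE IH //.
have nextE b : b \notin w j -> next (w j) b = b.
  by rewrite next_nth => /negbTE->.
have [ij|ij] /= := eqVneq i j.
  by rewrite -ij in js *; rewrite (negbTE js).
case: ifP => _; apply: nextE; apply/negP => aj; case/eqP: ij.
  by apply: w_disjoint aj; rewrite mem_next.
exact: w_disjoint aj.
Qed.

Lemma ordering_perm_mem i a : a \in w i -> ordering_perm w a \in w i.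
Proof. by move=> ai; rewrite (ordering_perm_word ai) mem_next. Qed.

Lemma ordering_perm_E a : E a -> E (ordering_perm w a).
Proof. by move=> /w_ex[i /ordering_perm_mem]; exact: w_mem. Qed.

Lemma ordering_perm_inj a b : E a -> E b ->
  ordering_perm w a = ordering_perm w b -> a = b.
Proof.
move=> /w_ex[i ai] /w_ex[j bj] ab.
have ij : i = j.
  apply: w_disjoint (ordering_perm_mem ai) _.
  by rewrite ab ordering_perm_mem.
move: ab; rewrite (ordering_perm_word ai) (ordering_perm_word bj) -ij.
exact: (can_inj (prev_next (w_uniq i))).
Qed.

End WordFamily.

(** * The rotation system of a Heffter array *)

Lemma order_eqP (T : finType) (f : T -> T) x n : (0 < n)%N -> iter n f x = x ->
  (forall i j, (i < n)%N -> (j < n)%N -> iter i f x = iter j f x -> i = j) ->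
  fingraph.order f x = n.
Proof.
move=> n0 fx inj; have st := size_traject f x n.
have u : uniq (traject f x n).
  apply/(uniqP x) => i j; rewrite !inE st => ilt jlt.
  by rewrite !nth_traject //; exact: inj.
have cyc : fcycle f (traject f x n).
  case: (n) n0 fx => // n' _ fx; rewrite trajectS /=.
  have -> : rcons (traject f (f x) n') x = traject f (f x) n'.+1.
    by rewrite trajectSr -iterSr fx.
  exact: fpath_traject.
have xt : x \in traject f x n by rewrite -{1}[x]/(iter 0 f x); apply/trajectP;
  exists 0%N.
by rewrite (order_cycle cyc u xt) st.
Qed.

Section CayleyScheme.
Variables (v : nat) (J : {group 'Z_v}) (E : pred 'Z_v).
Hypothesis E_J : forall a, E a -> a \notin J.
Hypothesis E_total : forall a, a \notin J -> E a || E (- a).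
Hypothesis E_opp : forall a, E a -> ~~ E (- a).
Variables r c : 'Z_v -> 'Z_v.
Hypothesis r_E : forall a, E a -> E (r a).
Hypothesis c_E : forall a, E a -> E (c a).
Hypothesis r_inj : forall a b, E a -> E b -> r a = r b -> a = b.
Hypothesis c_inj : forall a b, E a -> E b -> c a = c b -> a = b.
Hypothesis cr_transitive : forall a b, E a -> E b -> exists i, iter i (c \o r) a = b.
Variable a0 : 'Z_v.
Hypothesis a0E : E a0.
Implicit Types (x y a b : 'Z_v).

Lemma notinJ_opp a : (- a \notin J) = (a \notin J).
Proof. by rewrite -[- a]/(a^-1)%g groupV. Qed.

Lemma E_flip a : a \notin J -> E (- a) = ~~ E a.
Proof.
move=> aJ; apply/idP/idP => [/E_opp|nE]; first by rewrite opprK.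
by have := E_total aJ; rewrite (negbTE nE).
Qed.

(* The face of an entry follows its column, the face of the opposite of an entry
   follows its row backwards. *)
Definition face_step a := if E a then c a else - r (- a).

Lemma E_face_step a : a \notin J -> E (face_step a) = E a.
Proof.
move=> aJ; rewrite /face_step; have [Ea|nEa] := boolP (E a); first exact: c_E.
by apply/negbTE; apply: E_opp; apply: r_E; rewrite E_flip.
Qed.

Lemma face_step_notinJ a : a \notin J -> face_step a \notin J.
Proof.
move=> aJ; rewrite /face_step; have [Ea|nEa] := boolP (E a); first exact/E_J/c_E.
by rewrite notinJ_opp; apply/E_J/r_E; rewrite E_flip.
Qed.

Lemma face_step_inj a b : a \notin J -> b \notin J -> face_step a = face_step b -> a
  = b.
Proof.
move=> aJ bJ ab; have Eab : E a = E b by rewrite -E_face_step // ab E_face_step.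
move: ab; rewrite /face_step -Eab; have [Ea|nEa] := boolP (E a).
  by apply: c_inj; rewrite // -Eab.
move=> /oppr_inj /r_inj h; apply: oppr_inj; apply: h; rewrite E_flip //.
by rewrite -Eab.
Qed.

Definition cayley_dart : finType := ('Z_v * {a : 'Z_v | a \notin J})%type.
Implicit Types d e : cayley_dart.

Definition step_of d : 'Z_v := val d.2.
Arguments step_of : simpl never.

(** Total thanks to the default step [a0], which is returned only for steps in [J]. *)
Definition dart_of (x a : 'Z_v) : cayley_dart :=
  (x, insubd (Sub a0 (E_J a0E)) a).

Lemma step_dart_of x a : a \notin J -> step_of (dart_of x a) = a.
Proof. by move=> aJ; rewrite /step_of insubdK. Qed.

Lemma dart_eqP d e : d.1 = e.1 -> step_of d = step_of e -> d = e.
Proof. by case: d e => [x a] [y b]; rewrite /step_of /= => -> /val_inj ->. Qed.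

Lemma step_notinJ d : step_of d \notin J.
Proof. exact: valP d.2. Qed.

Definition cayley_flip d : cayley_dart := dart_of (d.1 + step_of d) (- step_of d).
Definition cayley_next d : cayley_dart :=
  dart_of (d.1 + step_of d) (face_step (step_of d)).

Lemma step_flip d : step_of (cayley_flip d) = - step_of d.
Proof. by rewrite step_dart_of // notinJ_opp step_notinJ. Qed.

Lemma step_next d : step_of (cayley_next d) = face_step (step_of d).
Proof. by rewrite step_dart_of // face_step_notinJ // step_notinJ. Qed.

Lemma cayley_flipK : involutive cayley_flip.
Proof.
move=> d; apply: dart_eqP; last by rewrite !step_flip opprK.
by rewrite [LHS]/= step_flip addrK.
Qed.

Lemma cayley_next_inj : injective cayley_next.
Proof.
move=> d e de; have := congr1 (fun u : cayley_dart => step_of u) de.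
rewrite /= !step_next => /face_step_inj ab.
have {}ab : step_of d = step_of e by apply: ab; exact: step_notinJ.
apply: dart_eqP => //; have /= := congr1 fst de.
by rewrite ab => /addIr.
Qed.

Lemma step_neq0 d : step_of d != 0.
Proof.
apply/eqP => d0; have := step_notinJ d.
by rewrite d0 -[0]/(1%g : 'Z_v) group1.
Qed.

Lemma E_neq_opp a b : a \notin J -> E b = E a -> b != - a.
Proof.
by move=> aJ ba; apply/eqP => bE; move: ba; rewrite bE E_flip //; case: (E a).
Qed.

(** A face of length 1 would have step 0. One of length 2 would have two opposite consecutive steps,
    whereas [face_step] preserves membership in [E] and negation reverses it. *)
Lemma cayley_face_size d : (3 <= fingraph.order cayley_next d)%N.
Proof.
have ne e : cayley_next e != e.
  apply/eqP => /(congr1 fst)/= /eqP; rewrite -subr_eq0 addrC addrA addNr add0r.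
  exact/negP/step_neq0.
have ne2 : cayley_next (cayley_next d) != d.
  apply/eqP => /(congr1 fst) /=.
  rewrite step_next -addrA -[RHS]addr0 => /addrI/eqP.
  rewrite addr_eq0 => /eqP aE.
  have := E_neq_opp (step_notinJ d) (E_face_step (step_notinJ d)).
  by rewrite -[face_step _]opprK -aE eqxx.
have u : uniq [:: d; cayley_next d; cayley_next (cayley_next d)].
  by rewrite /= !inE negb_or !andbT eq_sym ne eq_sym ne2 eq_sym ne.
rewrite -[3%N](card_uniqP u); apply: subset_leq_card; apply/fintype.subsetP => x.
rewrite !inE => /or3P[] /eqP ->; first exact: connect0.
  exact: fconnect1.
by apply: connect_trans (fconnect1 _ _) (fconnect1 _ _).
Qed.

(** Each step of the rotation exchanges entries and opposites of entries. Both darts are first moved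
    onto entries, where [cr_transitive] applies to the square. *)
Lemma cayley_rotation d e : d.1 = e.1 -> fconnect (cayley_next \o cayley_flip) d e.
Proof.
set F := _ \o _.
have F_inj : injective F.
  by apply: inj_comp; [exact: cayley_next_inj|exact: can_inj cayley_flipK].
have F1 d' : (F d').1 = d'.1 by rewrite /F /= step_flip addrK.
have F2 d' : step_of (F d') = face_step (- step_of d').
  by rewrite /F [(_ \o _) _]/= step_next step_flip.
have EF d' : ~~ E (step_of d') -> E (step_of (F d')).
  move=> nE; rewrite F2 E_face_step ?notinJ_opp ?step_notinJ //.
  by rewrite E_flip // step_notinJ.
have to_E d' : exists e', [/\ fconnect F d' e', e'.1 = d'.1 & E (step_of e')].
  have [Ed|nEd] := boolP (E (step_of d')); first by exists d'; split=> //;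
    exact: connect0.
  by exists (F d'); split; [exact: fconnect1|exact: F1|exact: EF].
have FF d' : E (step_of d') -> step_of (F (F d')) = c (r (step_of d')).
  move=> Ed; rewrite F2 F2 {2}/face_step (negbTE (E_opp Ed)) !opprK.
  by rewrite /face_step r_E.
have EE d' e' : d'.1 = e'.1 -> E (step_of d') -> E (step_of e') -> fconnect F d' e'.
  move=> de Ed Ee; have [i iE] := cr_transitive Ed Ee.
  have [I1 [I2 I3]] : (iter (i + i) F d').1 = d'.1 /\
      (step_of (iter (i + i) F d') = iter i (c \o r) (step_of d') /\
       E (iter i (c \o r) (step_of d'))).
    elim: i {iE} => [|i [IH1 [IH2 IH3]]] //; rewrite addnS addSn !iterS !F1 IH1.
    split=> //; rewrite FF ?IH2 //; split=> //=; exact/c_E/r_E.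
  have -> : e' = iter (i + i) F d' by apply: dart_eqP; rewrite ?I1 // I2 iE.
  exact: fconnect_iter.
have [d' [dd' d1 Ed]] := to_E d; have [e' [ee' e1 Ee]] := to_E e.
move=> de; apply: connect_trans dd' _; rewrite (fconnect_sym F_inj).
apply: connect_trans ee' _; rewrite (fconnect_sym F_inj).
by apply: EE; rewrite // d1 e1.
Qed.

(** Two vertices in one coset of [J] are not adjacent and are joined through [x + a0]; if this
    detour failed too, [a0] would be in [J]. *)
Lemma cayley_connected (P : pred 'Z_v) :
  (forall d, P d.1 -> P (cayley_flip d).1) -> forall x y, P x -> P y.
Proof.
move=> H; have H' x a : a \notin J -> P x -> P (x + a).
  by move=> aJ; have := H (dart_of x a); rewrite /= step_dart_of.
move=> x y Px; have [xyJ|xyJ] := boolP (y - x \in J); last first.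
  by rewrite -(subrKC x y); exact: H'.
have a0J := E_J a0E.
have Pa := H' _ _ a0J Px; rewrite -(subrKC (x + a0) y); apply: H' => //.
apply: contra a0J => yJ; have -> : a0 = (y - x) - (y - (x + a0)) by ring.
rewrite -[_ - _]/((y - x) * (y - (x + a0))^-1)%g.
by rewrite groupM // groupV.
Qed.

Definition cayley_scheme : scheme (cayley_adj J).
Proof.
(* Colour [true] marks the steps outside [E], that is the row faces, in agreement with the order of
   the two decompositions in [biembedding]. *)
refine (@Scheme (Zp_trunc v).+2 (cayley_adj J) cayley_dart fst cayley_flip
  cayley_next (fun d => ~~ E (step_of d)) cayley_flipK cayley_next_inj _ _ _ _ _ _
  cayley_rotation cayley_face_size _ _ _ cayley_connected (dart_of 0 a0)).
- by [].
- by move=> d; rewrite /cayley_adj /= addrC addKr step_notinJ.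
- by move=> d e /= de; rewrite de => /addrI; exact: dart_eqP.
- move=> x y xy; exists (dart_of x (y - x)) => //=.
  by rewrite step_dart_of // subrKC.
- by move=> x; exists (dart_of x a0).
- move=> d /=; rewrite eq_sym -subr_eq0 addrC addKr; exact: step_neq0.
- move=> d; apply/eqP => /(congr1 (fun u : cayley_dart => step_of u)).
  rewrite step_next step_flip => aE.
  have nJ : - step_of d \notin J by rewrite notinJ_opp step_notinJ.
  by have := E_neq_opp nJ (E_face_step nJ); rewrite aE opprK eqxx.
- by move=> d; rewrite step_next E_face_step // step_notinJ.
- by move=> d; rewrite step_flip E_flip // step_notinJ.
Defined.

End CayleyScheme.

(** * Row and column circuits as faces *)

Section WordBiembedding.
Variables (R : realType) (v : nat) (J : {group 'Z_v}) (E : pred 'Z_v).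
Hypothesis E_J : forall a, E a -> a \notin J.
Hypothesis E_total : forall a, a \notin J -> E a || E (- a).
Hypothesis E_opp : forall a, E a -> ~~ E (- a).
Variables (m n : nat) (wR : 'I_m -> seq 'Z_v) (wC : 'I_n -> seq 'Z_v).
Hypothesis wR_mem : forall i a, a \in wR i -> E a.
Hypothesis wR_ex : forall a, E a -> exists i, a \in wR i.
Hypothesis wR_disjoint : forall i j a, a \in wR i -> a \in wR j -> i = j.
Hypothesis wR_uniq : forall i, uniq (wR i).
Hypothesis wR_gt0 : forall i, (0 < size (wR i))%N.
Hypothesis wC_mem : forall i a, a \in wC i -> E a.
Hypothesis wC_ex : forall a, E a -> exists i, a \in wC i.
Hypothesis wC_disjoint : forall i j a, a \in wC i -> a \in wC j -> i = j.
Hypothesis wC_uniq : forall i, uniq (wC i).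
Hypothesis wC_gt0 : forall i, (0 < size (wC i))%N.
Hypothesis w_transitive : forall a b, E a -> E b ->
  exists i, iter i (ordering_perm wC \o ordering_perm wR) a = b.
Variable a0 : 'Z_v.
Hypothesis a0E : E a0.
Implicit Types (x y a b : 'Z_v).

Definition word_scheme : scheme (cayley_adj J) :=
  cayley_scheme E_J E_total E_opp
    (ordering_perm_E wR_mem wR_ex wR_disjoint)
    (ordering_perm_E wC_mem wC_ex wC_disjoint)
    (ordering_perm_inj wR_ex wR_disjoint wR_uniq)
    (ordering_perm_inj wC_ex wC_disjoint wC_uniq) w_transitive a0E.

Local Notation sch := word_scheme.
Local Notation phi := (@embed R _ _ sch).
Local Notation fof d := (@face_of R _ _ sch d).
Local Notation mk p := (dart_of E_J a0E p.1 p.2 : sch).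
Local Notation wR' := (fun i => rev (wR i)).

Lemma wR'_mem i a : a \in wR' i -> E a.
Proof. by rewrite mem_rev; exact: wR_mem. Qed.
Lemma wR'_ex a : E a -> exists i, a \in wR' i.
Proof. by move=> /wR_ex[i ai]; exists i; rewrite mem_rev. Qed.
Lemma wR'_disjoint i j a : a \in wR' i -> a \in wR' j -> i = j.
Proof. by rewrite !mem_rev; exact: wR_disjoint. Qed.
Lemma wR'_uniq i : uniq (wR' i).
Proof. by rewrite rev_uniq. Qed.
Lemma wR'_gt0 i : (0 < size (wR' i))%N.
Proof. by rewrite size_rev. Qed.

Lemma colourE (d : sch) : colour d = ~~ E (step_of d).
Proof. by []. Qed.

Lemma srcE (d : sch) : src d = d.1.
Proof. by []. Qed.

Lemma step_face_next (d : sch) : step_of (face_next d) =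
  face_step E (ordering_perm wR) (ordering_perm wC) (step_of d).
Proof.
apply: step_next => // [a|a]; apply: ordering_perm_E;
  [exact: wR_mem|exact: wR_ex|exact: wR_disjoint|exact: wC_mem|exact: wC_ex|
   exact: wC_disjoint].
Qed.

Lemma src_face_next (d : sch) : (face_next d).1 = d.1 + step_of d.
Proof. by []. Qed.

Lemma step_flip_dart (d : sch) : step_of (flip d) = - step_of d.
Proof. exact: step_flip. Qed.

Lemma src_flip_dart (d : sch) : (flip d).1 = d.1 + step_of d.
Proof. by []. Qed.

Lemma step_mk x a : a \notin J -> step_of (mk (x, a)) = a.
Proof. exact: step_dart_of. Qed.

Section Column.
Variables (i : 'I_n) (x : 'Z_v).
Local Notation dart q := (circuit_dart (wC i) x q).
Local Notation L := (circuit_length (wC i)).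

Lemma column_dart_E q : E (dart q).2.
Proof. by apply: (@wC_mem i); apply: circuit_dart_mem; exact: wC_gt0. Qed.

Lemma column_dart_next q : face_next (mk (dart q)) = mk (dart q.+1).
Proof.
have Eq := column_dart_E q.
have EqJ := E_J Eq; rewrite (circuit_dartS (wC_uniq i) (wC_gt0 i)).
have qm := circuit_dart_mem (wC_gt0 i) x q.
apply: dart_eqP; first by rewrite src_face_next step_mk.
rewrite step_face_next !step_mk //.
  by rewrite /face_step Eq (ordering_perm_word wC_disjoint qm).
by apply: E_J; apply: (@wC_mem i); rewrite mem_next.
Qed.

Lemma column_dart_iter q : iter q (@face_next _ _ sch) (mk (dart 0)) = mk (dart q).
Proof. by elim: q => //= q ->; exact: column_dart_next. Qed.

Lemma mk_inj p q : mk (dart p) = mk (dart q) -> dart p = dart q.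
Proof.
move=> E1; apply: pair_ext; first by have := congr1 fst E1.
have := congr1 (@step_of _ J) E1.
by rewrite !step_mk //; apply: E_J; exact: column_dart_E.
Qed.

Lemma column_face_degree : @face_degree _ _ sch (mk (dart 0)) = L.
Proof.
rewrite face_degreeE; have gt0 := wC_gt0 i.
apply: order_eqP; first exact: circuit_length_gt0.
  by rewrite column_dart_iter -[L]add0n circuit_dart_period.
move=> p q pL qL; rewrite !column_dart_iter => /mk_inj.
exact: (circuit_dart_inj (wC_uniq i)).
Qed.

Lemma column_face_boundary :
  face_boundary phi (fof (mk (dart 0))) (path_circuit (word_path (wC i) x)).
Proof.
have sC := size_word_circuit (wC_gt0 i) x.
apply: face_boundary_forward; first by rewrite sC column_face_degree.
move=> x0 q; rewrite sC => qL.
by rewrite nth_word_circuit // column_dart_iter srcE.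
Qed.

Lemma column_face q : fof (mk (dart q)) = fof (mk (dart 0)).
Proof.
by apply/esym/face_of_eq; rewrite -(column_dart_iter q); exact: fconnect_iter.
Qed.

End Column.

Lemma column_colour_class :
  colour_class (cayley_adj J) phi (@face_colour R _ _ sch) false
    (circuits_of (path_decomposition wC)).
Proof.
apply: embed_colour_class.
- move=> _ [_ [i [x ->]] <-].
  exact: (word_circuit_trail E_J E_opp wC_mem wC_uniq wC_gt0).
- move=> d; rewrite colourE => /negbFE Ed; have [i ai] := wC_ex Ed.
  have [x [q [_ qE]]] := circuit_dart_ex d.1 ai.
  exists (path_circuit (word_path (wC i) x)).
    by exists (word_path (wC i) x) => //; exists i, x.
  have -> : d = mk (circuit_dart (wC i) x q).
    by apply: dart_eqP; rewrite qE // step_mk //; exact: E_J.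
  by rewrite column_face; exact: column_face_boundary.
- move=> _ [_ [i [x ->]] <-]; exists (mk (circuit_dart (wC i) x 0)).
    by rewrite colourE step_mk ?(column_dart_E i x 0) //; apply: E_J;
      exact: column_dart_E.
  exact: column_face_boundary.
Qed.

Section Row.
Variables (i : 'I_m) (x : 'Z_v).
Local Notation dart q := (circuit_dart (wR' i) x q).
Local Notation L := (circuit_length (wR' i)).

(** The dart itself has a column face on its left; its flip has the row face there, and runs against
    the circuit. *)
Definition row_dart q : sch := flip (mk (dart q)).

Lemma row_dart_E q : E (dart q).2.
Proof. by apply: (@wR'_mem i); apply: circuit_dart_mem; exact: wR'_gt0. Qed.

Lemma row_dart_fst q : (row_dart q).1 = (dart q.+1).1.
Proof.
rewrite (circuit_dartS (wR'_uniq i) (wR'_gt0 i)) /row_dart src_flip_dart step_mk //.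
by apply: E_J; exact: row_dart_E.
Qed.

Lemma row_dart_snd q : step_of (row_dart q) = - (dart q).2.
Proof.
by rewrite /row_dart step_flip_dart step_mk //; apply: E_J; exact: row_dart_E.
Qed.

(** The successor in the reversed row is the predecessor in the row, while the face of an opposite
    follows the row: the index decreases. *)
Lemma row_dart_next q : face_next (row_dart q.+1) = row_dart q.
Proof.
have S p := circuit_dartS (wR'_uniq i) (wR'_gt0 i) x p.
apply: dart_eqP.
  by rewrite src_face_next row_dart_snd !row_dart_fst S addrK.
rewrite step_face_next !row_dart_snd /face_step (negbTE (E_opp (row_dart_E _))) opprK.
congr (- _); have qm := circuit_dart_mem (wR'_gt0 i) x q; rewrite mem_rev in qm.
rewrite S /= next_rev // (@ordering_perm_word _ _ _ wR_disjoint i) ?mem_prev //.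
by rewrite next_prev.
Qed.

Lemma row_dart_iter q j : iter j (@face_next _ _ sch) (row_dart (q + j)) = row_dart q.
Proof. by elim: j q => [|j IH] q; rewrite ?addn0 // iterSr addnS row_dart_next. Qed.

Lemma row_dart_period q : row_dart (q + L) = row_dart q.
Proof. by rewrite /row_dart circuit_dart_period // wR'_gt0. Qed.

Lemma row_dart_inj p q : row_dart p = row_dart q -> dart p = dart q.
Proof.
move=> E1; have e2 : (dart p).2 = (dart q).2.
  by apply: oppr_inj; rewrite -!row_dart_snd E1.
apply: pair_ext => //; have := congr1 fst E1.
rewrite !row_dart_fst !(circuit_dartS (wR'_uniq i) (wR'_gt0 i)) => h.
have {}h : (dart p).1 + (dart p).2 = (dart q).1 + (dart q).2 := h.
by rewrite e2 in h; exact: addIr h.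
Qed.

Let L0 : (0 < L)%N. Proof. by apply: circuit_length_gt0; exact: wR'_gt0. Qed.

(** The base index is [L.-1] because [row_dart q] starts at vertex [q.+1] of the circuit: this dart
    starts at vertex [L], which is vertex 0. *)
Lemma row_face_degree : @face_degree _ _ sch (row_dart L.-1) = L.
Proof.
rewrite face_degreeE; apply: order_eqP => //.
  by rewrite -[in X in iter _ _ X]row_dart_period row_dart_iter.
have iterE p : (p < L)%N -> iter p (@face_next _ _ sch) (row_dart L.-1) = row_dart
  (L.-1 - p).
  move=> pL; have pL' : (p <= L.-1)%N by rewrite -ltnS prednK.
  by rewrite -{1}(subnK pL') row_dart_iter.
move=> p q pL qL; rewrite !iterE // => /row_dart_inj.
move=> /(circuit_dart_inj (wR'_uniq i) (wR'_gt0 i)) H.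
have : (L.-1 - p = L.-1 - q)%N by apply: H; lia.
by move: pL qL L0; lia.
Qed.

Lemma row_face_boundary :
  face_boundary phi (fof (row_dart L.-1)) (path_circuit (word_path (wR' i) x)).
Proof.
have sC := size_word_circuit (wR'_gt0 i) x.
apply: face_boundary_backward; first by rewrite sC row_face_degree.
move=> x0 q; rewrite sC => qL; rewrite nth_word_circuit ?wR'_gt0 //.
(* One period is added so that the [L - q] backward steps stay among non-negative indices; they end
   at the vertex of index [L + q], the same as [q]. *)
rewrite -row_dart_period; have -> : (L.-1 + L = (L + q).-1 + (L - q))%N by lia.
rewrite row_dart_iter srcE row_dart_fst prednK; last by lia.
by rewrite addnC circuit_dart_period ?wR'_gt0.
Qed.

Lemma row_face q : fof (row_dart q) = fof (row_dart L.-1).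
Proof.
have H p r : fof (row_dart (p + r)) = fof (row_dart p).
  by apply/face_of_eq; rewrite -(row_dart_iter p r); exact: fconnect_iter.
rewrite -(H q L.-1) addnC; exact: H.
Qed.

End Row.

Lemma row_colour_class :
  colour_class (cayley_adj J) phi (@face_colour R _ _ sch) true
    (circuits_of (path_decomposition wR')).
Proof.
apply: embed_colour_class.
- move=> _ [_ [i [x ->]] <-].
  exact: (word_circuit_trail E_J E_opp wR'_mem wR'_uniq wR'_gt0).
- move=> d; rewrite colourE => nEd.
  have dJ := step_notinJ d;
    have Ed : E (- step_of d) by rewrite (E_flip E_total E_opp).
  have [i ai] := wR'_ex Ed.
  have [x [q [_ qE]]] := circuit_dart_ex (d.1 + step_of d) ai.
  exists (path_circuit (word_path (wR' i) x)).
    by exists (word_path (wR' i) x) => //; exists i, x.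
  have -> : d = row_dart i x q.
    apply: dart_eqP; last by rewrite row_dart_snd qE opprK.
    rewrite row_dart_fst (circuit_dartS (wR'_uniq i) (wR'_gt0 i)) qE.
    by rewrite /= addrK.
  by rewrite row_face; exact: row_face_boundary.
- move=> _ [_ [i [x ->]] <-]; exists (row_dart i x (circuit_length (wR' i)).-1).
    by rewrite colourE row_dart_snd; apply: E_opp; exact: row_dart_E.
  exact: row_face_boundary.
Qed.

Lemma word_biembedding :
  [/\ surface R (surf R (scheme_triangulation sch)),
      orientable R (surf R (scheme_triangulation sch)),
      cellular (cayley_adj J) phi &
      biembedding (cayley_adj J) phi
        (circuits_of (path_decomposition wR')) (circuits_of (path_decomposition wC))].
Proof.
split; [exact: surf_surface|exact: surf_orientable|exact: embed_cellular|].
split.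
- exact: (word_circuit_decomposition E_J E_total E_opp wR'_mem wR'_ex wR'_disjoint
    wR'_uniq wR'_gt0).
- exact: (word_circuit_decomposition E_J E_total E_opp wC_mem wC_ex wC_disjoint
    wC_uniq wC_gt0).
- exact: embed_graph.
exists (@face_colour R _ _ sch).
by split; [exact: embed_2_colouring|exact: row_colour_class|exact:
  column_colour_class].
Qed.

End WordBiembedding.

(** * From the array to its words *)

Lemma pmap_uniq_in (U : eqType) (V : eqType) (f : U -> option V) s :
  uniq s -> (forall x y a, f x = Some a -> f y = Some a -> x = y) -> uniq (pmap f s).
Proof.
move=> us inj; elim: s us => //= x s IH /andP[xs us].
case fx: (f x) => [a|] /=; last exact: IH.
rewrite IH // andbT mem_pmap; apply/negP => /mapP[y ys /esym fy].
by move: xs; rewrite (inj _ _ _ fx fy) ys.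
Qed.

Theorem proposition5p6 (R : realType) (m n h k t : nat)
    (m_gt0 : (1 <= m)%N) (n_gt0 : (1 <= n)%N) (h_gt0 : (1 <= h)%N)
    (k_gt0 : (1 <= k)%N) (t_gt0 : (1 <= t)%N)
    (nk_mh : (n * k)%N = (m * h)%N) (t_dvd : (t %| 2 * n * k)%N)
    (J : {group 'Z_(2 * n * k + t)}) (cardJ : #|J| = t)
    (A : 'M[option 'Z_(2 * n * k + t)]_(m, n)) (NH_A : NH h J A)
    (wR : 'I_m -> seq 'Z_(2 * n * k + t)) (wC : 'I_n -> seq 'Z_(2 * n * k + t))
    (wR_row : forall i, perm_eq (wR i) (row_entries A i))
    (wC_col : forall j, perm_eq (wC j) (col_entries A j))
    (wR_simple : forall i, simple_ordering (wR i))
    (wC_simple : forall j, simple_ordering (wC j))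
    (w_compat : compatible A wR wC) :
  exists (S : topologicalType)
         (phi : 'rV[R]_(Zp_trunc (2 * n * k + t)).+2 -> S),
    [/\ surface R S, orientable R S,
        cellular (cayley_adj J) phi &
        biembedding (cayley_adj J) phi
          (circuits_of (path_decomposition (fun i => rev (wR i))))
          (circuits_of (path_decomposition wC))].
Proof.
case: NH_A => row_size col_size count_J _ _.
pose cells a := [pred c : 'I_m * 'I_n | A c.1 c.2 == Some a].
(* The set of entries. The counting condition puts exactly one element of each pair of opposites
   outside [J] in it, filling a single cell; an element outside [J] equal to its opposite would be
   counted an even number of times. *)
pose E : pred 'Z_(2 * n * k + t) := fun a => [exists c, cells a c].
have E_card a : E a = (0 < #|cells a|)%N.
  by apply/existsP/card_gt0P => -[c cP]; exists c.
have cell_uniq a : (#|cells a| <= 1)%N.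
  by have := count_J a; rewrite -/(cells a); case: (a \notin J) => /=; lia.
have E_J a : E a -> a \notin J.
  rewrite E_card => a_gt0; have := count_J a; rewrite -/(cells a).
  by case: (a \notin J) => //; lia.
have E_opp a : E a -> ~~ E (- a).
  rewrite !E_card => a_gt0; have := count_J a; rewrite -/(cells a) -/(cells (- a)).
  by case: (a \notin J) => /=; lia.
have E_total a : a \notin J -> E a || E (- a).
  rewrite !E_card => aJ; have := count_J a; rewrite -/(cells a) -/(cells (- a)) aJ /=.
  by case: #|_|; case: #|_|.
have cell_eq a c c' : A c.1 c.2 = Some a -> A c'.1 c'.2 = Some a -> c = c'.
  move=> ca c'a; have /fintype.card_le1_eqP := cell_uniq a.
  by apply; rewrite inE /= ?ca ?c'a.
have row_mem i a : (a \in wR i) <-> exists j, A i j = Some a.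
  rewrite (perm_mem (wR_row i)) mem_pmap; split.
    by move=> /mapP[j _ ->]; exists j.
  by move=> [j <-]; apply/mapP; exists j; rewrite ?mem_enum.
have col_mem j a : (a \in wC j) <-> exists i, A i j = Some a.
  rewrite (perm_mem (wC_col j)) mem_pmap; split.
    by move=> /mapP[i _ ->]; exists i.
  by move=> [i <-]; apply/mapP; exists i; rewrite ?mem_enum.
have EP a : E a <-> exists i j, A i j = Some a.
  split; first by move=> /existsP[[i j] /eqP ij]; exists i, j.
  by move=> [i [j ij]]; apply/existsP; exists (i, j); rewrite /= ij.
have wR_mem i a : a \in wR i -> E a.
  by move=> /row_mem[j ij]; apply/EP; exists i, j.
have wC_mem j a : a \in wC j -> E a.
  by move=> /col_mem[i ij]; apply/EP; exists i, j.
have wR_ex a : E a -> exists i, a \in wR i.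
  by move=> /EP[i [j ij]]; exists i; apply/row_mem; exists j.
have wC_ex a : E a -> exists j, a \in wC j.
  by move=> /EP[i [j ij]]; exists j; apply/col_mem; exists i.
have wR_disjoint i i' a : a \in wR i -> a \in wR i' -> i = i'.
  by move=> /row_mem[j ij] /row_mem[j' ij'];
    have [] := cell_eq a (i, j) (i', j') ij ij'.
have wC_disjoint j j' a : a \in wC j -> a \in wC j' -> j = j'.
  by move=> /col_mem[i ij] /col_mem[i' ij'];
    have [] := cell_eq a (i, j) (i', j') ij ij'.
have wR_uniq i : uniq (wR i).
  rewrite (perm_uniq (wR_row i)); apply: pmap_uniq_in; first exact: enum_uniq.
  by move=> j j' a ij ij'; have [] := cell_eq a (i, j) (i, j') ij ij'.
have wC_uniq j : uniq (wC j).
  rewrite (perm_uniq (wC_col j)); apply: pmap_uniq_in; first exact: enum_uniq.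
  by move=> i i' a ij ij'; have [] := cell_eq a (i, j) (i', j) ij ij'.
have nonempty (s : seq 'Z_(2 * n * k + t)) a : a \in s -> (0 < size s)%N by case: s.
have wR_gt0 i : (0 < size (wR i))%N.
  have /card_gt0P[j] : (0 < #|[pred j | A i j != None]|)%N by rewrite row_size.
  rewrite inE; case ij: (A i j) => [a|] // _.
  by apply: (@nonempty _ a); apply/row_mem; exists j.
have wC_gt0 j : (0 < size (wC j))%N.
  have /card_gt0P[i] : (0 < #|[pred i | A i j != None]|)%N by rewrite col_size.
  rewrite inE; case ij: (A i j) => [a|] // _.
  by apply: (@nonempty _ a); apply/col_mem; exists i.
(* The cycle given by compatibility lists all the entries, so any of them is reached from any
   other. *)
have w_transitive a b : E a -> E b ->
    exists i, iter i (ordering_perm wC \o ordering_perm wR) a = b.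
  have [s [s_entries s_cycle]] := w_compat.
  have s_mem x : E x -> x \in s.
    move=> /wR_ex[i xi]; rewrite (perm_mem s_entries); apply/flatten_mapP.
    by exists i; rewrite ?mem_enum // -(perm_mem (wR_row i)).
  move=> /s_mem sa /s_mem sb; have := connect_cycle s_cycle sa sb.
  by move=> /iter_findex; exists (findex (ordering_perm wC \o ordering_perm wR) a b).
(* Some entry must be named, as base point of the scheme and as default step; a row exists and is
   not empty. *)
pose i0 : 'I_m := Ordinal m_gt0; pose a0 := nth 0 (wR i0) 0.
have a0E : E a0 by apply: (@wR_mem i0); exact: mem_nth.
pose sch := word_scheme E_J E_total E_opp wR_mem wR_ex wR_disjoint wR_uniq
  wC_mem wC_ex wC_disjoint wC_uniq w_transitive a0E.
exists (surf R (scheme_triangulation sch)), (@embed R _ _ sch).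
exact: word_biembedding.
Qed.
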